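(* Let $m\ge 2$ and consider Impartial Culture on $m$ candidates with $n$ voters. Let $I$ be the $(m-1)\times(m-1)$ identity matrix, $J$ the $(m-1)\times(m-1)$ all-ones matrix, and $H=\frac16\big(I+\frac12J\big)$, so that $H^{-1}=6\big(I-\frac{1}{m+1}J\big)$ and $\det H=\frac{m+1}{2}\cdot\frac{1}{6^{m-1}}$. Then, as $n\to+\infty$, \[ \mathbb{P}(m\text{ is the Condorcet winner})=a_0+a_{1,n}n^{-1/2}+O(n^{-1}), \] where \[ a_0=\frac{1}{\sqrt{(2\pi)^{m-1}\det H}}\int_{(0,+\infty)^{m-1}}e^{-\mathbf{u}^TH^{-1}\mathbf{u}/2}\,d\mathbf{u}, \] and $a_{1,n}=0$ if $n$ is odd, while if $n$ is even \[ a_{1,n}=-\frac{6}{m+1}\cdot\frac{1}{\sqrt{(2\pi)^{m-1}\det H}}\int_{(0,+\infty)^{m-1}}\mathbf{1}^T\mathbf{u}\;e^{-\mathbf{u}^TH^{-1}\mathbf{u}/2}\,d\mathbf{u}. \]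
   Context: Impartial Culture: each of the $n$ voters independently draws a strict ranking of the candidates $\{1,\dots,m\}$ uniformly at random among the $m!$ rankings. Candidate $m$ is the Condorcet winner if for every other candidate $j$, strictly more than $n/2$ voters rank $m$ above $j$. $\mathbf{1}$ denotes the all-ones vector. *)

(* Defs.v *)
From HB Require Import structures.
From mathcomp Require Import all_boot all_order all_algebra all_fingroup.
From mathcomp Require Import all_classical all_reals all_analysis.
Set Implicit Arguments. Unset Strict Implicit. Unset Printing Implicit Defensive.
Import Order.TTheory GRing.Theory Num.Theory.
Local Open Scope ring_scope.

(* A strict ranking of the candidates 'I_m is a permutation s : {perm 'I_m}:
   s c is the position of candidate c (position 0 = top).  A profile of n
   voters is a finite function 'I_n -> {perm 'I_m}. *)
Definition profile (m n : nat) := {ffun 'I_n -> {perm 'I_m}}.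

Definition ranks_above m n (P : profile m n) (v : 'I_n) (a b : 'I_m) : bool :=
  (P v a < P v b)%N.

Definition condorcet_winner m n (P : profile m n) (c : 'I_m) : bool :=
  [forall j : 'I_m, (j != c) ==>
     (n < 2 * #|[set v : 'I_n | ranks_above P v c j]|)%N].

(* Impartial Culture: uniform distribution on profiles (each voter draws
   independently and uniformly one of the m! rankings). *)
Definition prob_cw (R : realType) (m n : nat) (c : 'I_m) : R :=
  (#|[set P : profile m n | condorcet_winner P c]|)%:R
  / (#|{: profile m n}|)%:R.

Definition Hmat (R : realType) (m : nat) : 'M[R]_(m.-1) :=
  6^-1 *: (1%:M + 2^-1 *: const_mx 1).

Definition quadHinv (R : realType) (m : nat) (u : nat -> R) : R :=
  let ur : 'rV[R]_(m.-1) := \row_(i < m.-1) u i in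
  (ur *m invmx (Hmat R m) *m ur^T) ord0 ord0.

(* Iterated Lebesgue integral over (0,+oo)^k of f (coordinates 0..k-1);
   for nonnegative integrands this is the integral over (0,+oo)^k w.r.t.
   k-dimensional Lebesgue measure (Tonelli). *)
Fixpoint iint_pos (R : realType) (k : nat) (f : (nat -> R) -> \bar R) : \bar R :=
  match k with
  | 0 => f (fun _ => 0)
  | k'.+1 => (\int[@lebesgue_measure R]_(x in [set x : R | (0 < x)%R])
               iint_pos k' (fun u => f (fun i => if i == k' then x else u i)))%E
  end.

Definition gauss_const (R : realType) (m : nat) : R :=
  1 / Num.sqrt ((2 * pi) ^+ m.-1 * \det (Hmat R m)).

Definition a0 (R : realType) (m : nat) : R :=
  gauss_const R m *
  fine (iint_pos m.-1 (fun u => (expR (- quadHinv m u / 2))%:E)).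

Definition a1 (R : realType) (m n : nat) : R :=
  if odd n then 0 else
  - (6 / (m.+1)%:R) * gauss_const R m *
  fine (iint_pos m.-1
          (fun u => ((\sum_(i < m.-1) u i) * expR (- quadHinv m u / 2))%:E)).

(* Main.v *)
(** With d = m - 1 opponents, the law of the set of opponents that one voter ranks
    below [c] is an element U of the group algebra of Z^d.  Let F be the law of d
    independent fair coins and C that of d equal fair coins.  The moments of U of
    order at most 3 are those of 2/3 F + 1/3 C (the pair correlations are 1/3), and
    multiplying by F^n gains a factor n^(-1/2) for every discrete derivative in the
    l1 norm.  By a Lindeberg replacement, U^(3k+r) = F^(2k+r) C^k + O(1/k) in l1
    norm.  Conditionally on the k fully correlated votes the coordinates are
    independent, so the probability is the average of the d-th power of a binomial
    distribution function over a binomial law; a local limit theorem with error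
    O(1/k) turns this into the integral of phi(z) Psi(z - tau/sqrt k)^d, where tau is
    1 for n even and 0 for n odd.  Expanding in tau yields two one-dimensional
    integrals.  They are identified with the Gaussian orthant integrals by writing
    exp(-u^T H^-1 u / 2) as a mixture over z of products of one-dimensional
    Gaussians, Tonelli, and an integration by parts in z. *)

Require Import Defs.
From HB Require Import structures.
From mathcomp Require Import all_boot all_order all_algebra all_fingroup.
From mathcomp Require Import all_classical all_reals all_analysis.
From mathcomp Require Import measurable_realfun.
From mathcomp Require Import zify ring lra.
Import Order.TTheory GRing.Theory Num.Theory.
Import numFieldNormedType.Exports.

Set Implicit Arguments.
Unset Strict Implicit.
Unset Printing Implicit Defensive.

Local Open Scope ring_scope.

(** * Polynomials with the l1 norm of their coefficients, and linear functionals *)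

Section L1Norm.
Variable R : realType.
Implicit Types (p q : {poly R}) (a : R).

(** Univariate polynomials stand for the group algebra: a tally vector a becomes the exponent sum_j
    a_j (n+1)^j, whose digits cannot overflow with n voters. These exponents change with n, so every
    l1 estimate is proved for arbitrary exponents [e], with constants that do not depend on [e].
    Replacing blocks U^3 by F^2 C, rather than single votes by 2/3 F + 1/3 C, makes the number of
    fully correlated votes deterministic. The difference carries four discrete derivatives, so a
    block costs n^(-2) and all blocks together 1/n. The obstacle is that in the mixed products only
    F smooths explicitly, and some of them contain few factors F. Since every comparison pattern has
    positive probability, U = w F + W with W of l1 norm at most 1 - w; so a power of U smooths like
    a random, linearly growing number of factors F. The local limit theorem avoids Stirling's
    formula: the height of the Gaussian profile is left unknown and recovered from the total mass 1.
    Each atom sits at the centre of its cell, so the midpoint rule leaves no n^(-1/2) error; the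
    only term of that order is the parity shift tau. *)

Definition l1 p : R := \sum_(i < size p) `|p`_i|.

Lemma l1_widen n p : (size p <= n)%N -> l1 p = \sum_(i < n) `|p`_i|.
Proof.
move=> le_pn; rewrite /l1 (big_ord_widen n (fun i => `|p`_i|)) //.
rewrite big_mkcond; apply: eq_bigr => i _.
by case: ltnP => // /(nth_default 0) ->; rewrite normr0.
Qed.

Lemma l1_ge0 p : 0 <= l1 p.
Proof. exact: sumr_ge0. Qed.

Lemma l1D p q : l1 (p + q) <= l1 p + l1 q.
Proof.
set n := maxn (size p) (size q).
rewrite (@l1_widen n (p + q)) ?size_polyD // (@l1_widen n p) ?leq_maxl //.
rewrite (@l1_widen n q) ?leq_maxr // -big_split; apply: ler_sum => i _.
by rewrite coefD ler_normD.
Qed.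

Lemma l1_0 : l1 0 = 0.
Proof. by rewrite /l1 size_poly0 big_ord0. Qed.

Lemma l1Z a p : l1 (a *: p) = `|a| * l1 p.
Proof.
rewrite (@l1_widen (size p)) ?size_scale_leq // /l1 mulr_sumr.
by apply: eq_bigr => i _; rewrite coefZ normrM.
Qed.

Lemma l1_sum (I : Type) (r : seq I) (P : pred I) (F : I -> {poly R}) :
  l1 (\sum_(i <- r | P i) F i) <= \sum_(i <- r | P i) l1 (F i).
Proof.
elim/big_rec2: _ => [|i y p _ le_py]; first by rewrite l1_0.
by apply: le_trans (l1D _ _) _; rewrite lerD2l.
Qed.

Lemma l1_XnM n p : l1 ('X^n * p) = l1 p.
Proof.
rewrite (@l1_widen (n + size p)); last first.
  have [->|p0] := eqVneq p 0; first by rewrite mulr0 size_poly0.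
  by rewrite mulrC size_mulXn // addnC.
rewrite big_split_ord /= big1 ?add0r => [|i _]; last first.
  by rewrite coefXnM ltn_ord normr0.
by apply: eq_bigr => i _; rewrite coefXnM ltnNge leq_addr /= addKn.
Qed.

Lemma l1_Xn n : l1 'X^n = 1.
Proof. by rewrite -['X^n]mulr1 l1_XnM /l1 size_poly1 big_ord1 coef1 normr1. Qed.

Lemma l1_1 : l1 1 = 1.
Proof. exact: (l1_Xn 0). Qed.

Lemma l1M p q : l1 (p * q) <= l1 p * l1 q.
Proof.
rewrite -[in X in l1 X](coefK p) poly_def mulr_suml.
apply: le_trans (l1_sum _ _ _) _; rewrite {2}/l1 mulr_suml; apply: ler_sum.
by move=> i _; rewrite -scalerAl l1Z l1_XnM.
Qed.

Lemma l1_prod (I : Type) (r : seq I) (P : pred I) (F : I -> {poly R}) :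
  l1 (\prod_(i <- r | P i) F i) <= \prod_(i <- r | P i) l1 (F i).
Proof.
elim/big_rec2: _ => [|i y p _ le_py]; first by rewrite l1_1.
by apply: le_trans (l1M _ _) _; rewrite ler_wpM2l ?l1_ge0.
Qed.

Lemma l1_exp n p : l1 (p ^+ n) <= l1 p ^+ n.
Proof.
elim: n => [|n IHn]; first by rewrite !expr0 l1_1.
by rewrite !exprS; apply: le_trans (l1M _ _) _; rewrite ler_wpM2l ?l1_ge0.
Qed.

Lemma l1M_le p q a b : l1 p <= a -> l1 q <= b -> l1 (p * q) <= a * b.
Proof.
by move=> pa qb; apply: le_trans (l1M _ _) _; rewrite ler_pM ?l1_ge0.
Qed.

Lemma l1D_le p q a b : l1 p <= a -> l1 q <= b -> l1 (p + q) <= a + b.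
Proof. by move=> pa qb; apply: le_trans (l1D _ _) (lerD pa qb). Qed.

Lemma l1_exp_le1 n p : l1 p <= 1 -> l1 (p ^+ n) <= 1.
Proof.
by move=> p1; apply: le_trans (l1_exp _ _) _; rewrite exprn_ile1 ?l1_ge0.
Qed.

Lemma l1_sum_le (I : finType) (F : I -> {poly R}) b :
  (forall i, l1 (F i) <= b) -> l1 (\sum_i F i) <= #|I|%:R * b.
Proof.
move=> Fb; apply: le_trans (l1_sum _ _ _) _.
rewrite mulr_natl -sumr_const; apply: ler_sum => i _; exact: Fb.
Qed.

Section Functional.
Variable f : nat -> R.

(** The integral of [f] against the signed measure on exponents given by the coefficients of [p].
    Bounded by the l1 norm when |f| <= 1, it transfers l1 estimates to probabilities. *)
Definition lin p : R := \sum_(i < size p) p`_i * f i.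

Lemma lin_widen n p : (size p <= n)%N -> lin p = \sum_(i < n) p`_i * f i.
Proof.
move=> le_pn; rewrite /lin (big_ord_widen n (fun i => p`_i * f i)) //.
rewrite big_mkcond; apply: eq_bigr => i _.
by case: ltnP => // /(nth_default 0) ->; rewrite mul0r.
Qed.

Lemma linD p q : lin (p + q) = lin p + lin q.
Proof.
set n := maxn (size p) (size q).
rewrite (@lin_widen n (p + q)) ?size_polyD // (@lin_widen n p) ?leq_maxl //.
rewrite (@lin_widen n q) ?leq_maxr // -big_split; apply: eq_bigr => i _.
by rewrite coefD mulrDl.
Qed.

Lemma lin0 : lin 0 = 0.
Proof. by rewrite /lin size_poly0 big_ord0. Qed.

Lemma linZ a p : lin (a *: p) = a * lin p.
Proof.
rewrite (@lin_widen (size p)) ?size_scale_leq // /lin mulr_sumr.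
by apply: eq_bigr => i _; rewrite coefZ mulrA.
Qed.

Lemma linB p q : lin (p - q) = lin p - lin q.
Proof. by rewrite linD -scaleN1r linZ mulN1r. Qed.

Lemma lin_sum (I : Type) (r : seq I) (P : pred I) (F : I -> {poly R}) :
  lin (\sum_(i <- r | P i) F i) = \sum_(i <- r | P i) lin (F i).
Proof. by apply: big_morph => [p q|]; rewrite ?linD ?lin0. Qed.

Lemma lin_Xn n : lin 'X^n = f n.
Proof.
rewrite /lin size_polyXn big_ord_recr /= big1 ?add0r => [|i _].
  by rewrite coefXn eqxx mul1r.
by rewrite coefXn /= ltn_eqF ?mul0r // ltn_ord.
Qed.

Lemma lin_le_l1 p : (forall i, `|f i| <= 1) -> `|lin p| <= l1 p.
Proof.
move=> f1; apply: le_trans (ler_norm_sum _ _ _) _; apply: ler_sum => i _.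
by rewrite normrM ler_piMr.
Qed.

End Functional.
End L1Norm.

(** * Smoothing of a discrete derivative by fair coins *)

Section CoinSmoothing.
Variable R : realType.

Lemma sum_bin_shift (f : nat -> R) n :
  \sum_(i < n.+2) 'C(n.+1, i)%:R * f i
    = \sum_(i < n.+1) 'C(n, i)%:R * (f i + f i.+1).
Proof.
rewrite big_ord_recl bin0 mul1r.
under eq_bigr do rewrite lift0 binS natrD mulrDl.
rewrite big_split /= addrA.
under [RHS]eq_bigr do rewrite mulrDr.
rewrite big_split /=; congr (_ + _).
rewrite [LHS]addrC big_ord_recr /= bin_small // mul0r addr0 addrC.
rewrite [RHS]big_ord_recl bin0 mul1r; congr (_ + _).
Qed.

(** The offset [t] makes the induction close: one more coin replaces [t] by [t - 1] and [t + 1],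
    whose squares average to [t ^+ 2 + 1]. *)
Lemma binomial_variance n (t : R) :
  \sum_(i < n.+1) 'C(n, i)%:R * (t + 2 * i%:R - n%:R) ^+ 2
    = 2 ^+ n * (t ^+ 2 + n%:R).
Proof.
elim: n t => [|n IHn] t.
  by rewrite big_ord1 bin0 expr0 !mul1r mulr0 subr0 !addr0.
rewrite (sum_bin_shift (fun i => (t + 2 * i%:R - n.+1%:R) ^+ 2)).
under eq_bigr => i _.
  have -> : t + 2 * i%:R - n.+1%:R = (t - 1) + 2 * i%:R - n%:R.
    by rewrite -natr1; ring.
  have -> : t + 2 * i.+1%:R - n.+1%:R = (t + 1) + 2 * i%:R - n%:R.
    by rewrite -[n.+1%:R]natr1 -[i.+1%:R]natr1; ring.
  rewrite mulrDr; over.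
by rewrite big_split /= !IHn [2 ^+ n.+1]exprS -[n.+1%:R]natr1; ring.
Qed.

Lemma sum_bin_abs n :
  \sum_(i < n.+1) 'C(n, i)%:R * `|2 * i%:R - n%:R|
    <= 2 ^+ n * Num.sqrt n%:R :> R.
Proof.
have [->|n0] := posnP n.
  by rewrite big_ord1 mulr0 subrr normr0 mulr0 sqrtr0 mulr0.
set s : R := Num.sqrt n%:R.
have s0 : 0 < s by rewrite sqrtr_gt0 ltr0n.
have s2 : s ^+ 2 = n%:R by rewrite sqr_sqrtr.
(* [2 s |y| <= y^2 + s^2] *)
have : \sum_(i < n.+1) 'C(n, i)%:R * (2 * s * `|2 * i%:R - n%:R|)
    <= \sum_(i < n.+1) 'C(n, i)%:R * ((2 * i%:R - n%:R) ^+ 2 + n%:R) :> R.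
  apply: ler_sum => i _; rewrite ler_wpM2l // -s2 -subr_ge0.
  rewrite -[X in _ <= X + _ - _]real_normK ?num_real //.
  by set z := `|_|; rewrite (_ : _ - _ = (z - s) ^+ 2) ?sqr_ge0 //; ring.
under [X in _ <= X]eq_bigr do rewrite mulrDr.
rewrite big_split /= -mulr_suml.
have -> : \sum_(i < n.+1) 'C(n, i)%:R * (2 * i%:R - n%:R) ^+ 2
    = 2 ^+ n * n%:R :> R.
  rewrite -[n%:R in RHS]add0r -[X in X + _](expr0n R 2) -binomial_variance.
  by apply: eq_bigr => i _; rewrite add0r.
have -> : \sum_(i < n.+1) 'C(n, i)%:R = 2 ^+ n :> R.
  rewrite -natr_sum -natrX; congr (_%:R).
  by rewrite -[2%N]/(1 + 1)%N expnDn; apply: eq_bigr => i _; rewrite !exp1n !muln1.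
under eq_bigr do rewrite mulrCA.
rewrite -mulr_sumr -s2 => h.
rewrite -(ler_pM2l (_ : 0 < 2 * s)); last by rewrite mulr_gt0.
by apply: le_trans h _; rewrite le_eqVlt; apply/orP; left; apply/eqP; ring.
Qed.

(* The coefficients of [(x - 1) (1 + x)^n] are [C(n+1,i) (2i - n - 1) / (n+1)]. *)
Lemma coin_smoothing e n :
  l1 ((2^-1 *: ('X^e - 1)) * (2^-1 *: (1 + 'X^e)) ^+ n : {poly R})
    <= (Num.sqrt n.+1%:R)^-1.
Proof.
set x : {poly R} := 'X^e.
have key : (x - 1) * (1 + x) ^+ n =
    n.+1%:R^-1 *: \sum_(i < n.+2) ('C(n.+1, i)%:R * (2 * i%:R - n.+1%:R)) *: x ^+ i.
  apply: (scalerI (_ : n.+1%:R != 0 :> R)); first by rewrite pnatr_eq0.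
  rewrite scalerA mulfV ?pnatr_eq0 // scale1r.
  have E1 : (1 + x) ^+ n.+1 = \sum_(i < n.+2) 'C(n.+1, i)%:R *: x ^+ i.
    rewrite exprDn; apply: eq_bigr => i _.
    by rewrite expr1n mul1r scaler_nat.
  (* This is x d/dx applied to the expansion [E1]. Then (n+1)(x - 1)(1 + x)^n is twice this
     polynomial minus n+1 times that of [E1]. *)
  have E2 : x * n.+1%:R * (1 + x) ^+ n
      = \sum_(i < n.+2) ('C(n.+1, i)%:R * i%:R) *: x ^+ i.
    rewrite big_ord_recl mulr0 scale0r add0r exprDn mulr_sumr.
    apply: eq_bigr => i _; rewrite expr1n mul1r lift0 exprS.
    rewrite -natrM scaler_nat [x * n.+1%:R]mulr_natr mulrnAl mulrnAr -mulrnA.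
    by congr (_ *+ _); rewrite mulnC mul_bin_diag mulnC.
  transitivity (2 *: (x * n.+1%:R * (1 + x) ^+ n) - n.+1%:R *: (1 + x) ^+ n.+1).
    by rewrite !scaler_nat [(1 + x) ^+ n.+1]exprS; move: {E1 E2} x => y; ring.
  rewrite E1 E2 !scaler_sumr -sumrB; apply: eq_bigr => i _.
  by rewrite !scalerA -scalerBl; congr (_ *: _); ring.
rewrite exprZn -scalerAl -scalerAr scalerA -exprS key scalerA l1Z.
have n1 : 0 < n.+1%:R :> R by rewrite ltr0n.
set s : R := Num.sqrt _.
have s0 : 0 < s by rewrite sqrtr_gt0.
have s2 : s ^+ 2 = n.+1%:R by rewrite sqr_sqrtr // ltW.
rewrite ger0_norm; last by rewrite mulr_ge0 ?exprn_ge0 ?invr_ge0.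
have h : l1 (\sum_(i < n.+2) ('C(n.+1, i)%:R * (2 * i%:R - n.+1%:R)) *: x ^+ i)
    <= 2 ^+ n.+1 * s.
  apply: le_trans (l1_sum _ _ _) _; apply: le_trans (sum_bin_abs _).
  apply: ler_sum => i _; rewrite l1Z normrM -exprM l1_Xn mulr1.
  by rewrite ger0_norm.
apply: le_trans (ler_wpM2l _ h) _.
  by rewrite mulr_ge0 ?exprn_ge0 ?invr_ge0.
rewrite -s2 exprVn [_^-1 * _]mulrC -mulrA [_^-1 * (_ * s)]mulrA mulVf ?expf_neq0 //.
by rewrite mul1r expr2 invfM -mulrA mulVf ?mulr1 // gt_eqF.
Qed.

End CoinSmoothing.

(** * Lindeberg replacement of U^3 by F^2 C *)

Section Replacement.
Variable R : realType.

(** The function 1/t^2 is convex, so its average over a step that is 1 with probability [w] exceeds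
    its value at the mean [t + w]. From t = 3 on, giving up half of the drift pays for this. *)
Lemma sqr_inv_concave (t w : R) : 3 <= t -> 0 <= w <= 1 ->
  w / (t + 1) ^+ 2 + (1 - w) / t ^+ 2 <= 1 / (t + w / 2) ^+ 2.
Proof.
move=> t3 /andP[w0 w1].
have t0 : 0 < t by lra.
have [t1 tw] : 0 < t + 1 /\ 0 < t + w / 2 by split; lra.
rewrite -subr_ge0.
have -> : 1 / (t + w / 2) ^+ 2 - (w / (t + 1) ^+ 2 + (1 - w) / t ^+ 2) =
  w * ((2 * t + 1) * (t + w / 2) ^+ 2 - (t + w / 4) * (t + 1) ^+ 2)
   / (t ^+ 2 * (t + 1) ^+ 2 * (t + w / 2) ^+ 2).
  by field; rewrite !gt_eqF //; lra.
apply: divr_ge0; last first.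
  by apply: mulr_ge0; [apply: mulr_ge0|]; exact: sqr_ge0.
apply: mulr_ge0 => //; rewrite subr_ge0.
(* Using [w <= 1] in the subtracted product and [0 <= w] in the other one removes [w] and leaves a
   cubic inequality in [t]. *)
have h1 : (t + w / 4) * (t + 1) ^+ 2 <= (t + 4^-1) * (t + 1) ^+ 2.
  by rewrite ler_wpM2r ?sqr_ge0 //; lra.
have h2 : (2 * t + 1) * t ^+ 2 <= (2 * t + 1) * (t + w / 2) ^+ 2.
  by rewrite ler_wpM2l ?lerXn2r ?nnegrE //; lra.
have h3 : (t + 4^-1) * (t + 1) ^+ 2 <= (2 * t + 1) * t ^+ 2.
  rewrite -subr_ge0.
  have -> : (2 * t + 1) * t ^+ 2 - (t + 4^-1) * (t + 1) ^+ 2 =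
    (t - 3) * (t ^+ 2 + 7 / 4 * t + 15 / 4) + 11 by field.
  have : 0 <= (t - 3) * (t ^+ 2 + 7 / 4 * t + 15 / 4).
    by have := sqr_ge0 t; move=> ?; apply: mulr_ge0; lra.
  lra.
lra.
Qed.

(* [F] is the law of a vote with independent coordinates, [C] the one with all
   coordinates equal; [2/3 F + 1/3 C] matches the moments of [U] up to order 3. *)
Lemma replacement (c2 c4 w : R) : 0 <= c2 -> 0 <= c4 -> 0 < w <= 1 ->
  exists K, forall F C U W : {poly R},
    l1 F <= 1 -> l1 C <= 1 -> l1 U <= 1 ->
    U = w *: F + W -> l1 W <= 1 - w ->
    (forall n, l1 ((U - F) * F ^+ n) <= c2 / n.+1%:R) ->
    (forall n, l1 ((U - F - 3^-1 *: (C - F)) * F ^+ n) <= c4 / n.+1%:R ^+ 2) ->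
    forall k r, (r < 3)%N ->
    l1 (U ^+ (3 * k + r) - F ^+ (2 * k + r) * C ^+ k) <= K / k.+1%:R.
Proof.
move=> c20 c40 /andP[w0 w1].
pose g := 3 * c4 + 12 * c2 ^+ 2.
have g0 : 0 <= g by rewrite addr_ge0 ?mulr_ge0 ?sqr_ge0.
exists (9 * g / w ^+ 2 + 2 * c2) => F C U W F1 C1 U1 defU W1 hD hE k r r3.
pose G := U ^+ 3 - F ^+ 2 * C.
set D := U - F in hD hE; set E := D - 3^-1 *: (C - F) in hE.
(* Expand in D = U - F. The part linear in D, together with C - F, is 3 F^2 E, where the moments up
   to order 3 cancel; everything else contains D twice. Both kinds of terms amount to four
   derivatives. *)
have GE : G = 3 *: (F ^+ 2 * E) + D ^+ 2 * (F + F + U).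
  rewrite /G /E mulrBr -scalerAr scalerBr scalerA mulfV ?pnatr_eq0 // scale1r.
  by rewrite scaler_nat /D; ring.
have hG n : l1 (G * F ^+ n) <= g / n.+1%:R ^+ 2.
  rewrite GE mulrDl /g mulrDl; apply: l1D_le.
    rewrite -scalerAl l1Z ger0_norm // -[_ * _ * F ^+ n]mulrA -[leRHS]mulrA ler_wpM2l //.
    rewrite -[leRHS]mul1r.
    by apply: l1M_le (hE n); rewrite l1_exp_le1.
  (* Each factor D receives half of the powers of F, which costs a factor 2 per D; with the three
     summands of [F + F + U] this is the 12 = 2 * 2 * 3 in [g]. *)
  have -> : D ^+ 2 * (F + F + U) * F ^+ n =
      (D * F ^+ (n./2)) * (D * F ^+ (uphalf n)) * (F + F + U).
    by rewrite -{1}(odd_double_half n) uphalf_half -addnn !exprD; ring.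
  have n1 : 0 < n.+1%:R :> R by rewrite ltr0n.
  have half_le q : (n <= q.*2.+1)%N -> c2 / q.+1%:R <= 2 * c2 / n.+1%:R.
    move=> nq; rewrite ler_pdivrMr ?ltr0n // mulrAC ler_pdivlMr // mulrAC.
    rewrite [leRHS](_ : _ = c2 * (2 * q.+1%:R)); last by ring.
    by rewrite ler_wpM2l // -natrM ler_nat; move: nq; clear; lia.
  rewrite (_ : 12 * c2 ^+ 2 / n.+1%:R ^+ 2
     = (2 * c2 / n.+1%:R) * (2 * c2 / n.+1%:R) * (1 + 1 + 1)); last first.
    by field; rewrite gt_eqF.
  apply: l1M_le; last by rewrite !l1D_le.
  apply: l1M_le.
    by apply: le_trans (hD _) (half_le _ _); clear; lia.
  by apply: le_trans (hD _) (half_le _ _); clear; lia.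
(* Induction on [a], splitting one U as [w *: F + W]: the first part adds a factor F, the second
   only shrinks the norm. The recursion for the bound is [sqr_inv_concave]. The shift by 3 provides
   its hypothesis, and n + 3 <= 3 (n + 1) is the origin of the 9. *)
have hGU a n : l1 (G * F ^+ n * U ^+ a) <= 9 * g / (n%:R + 3 + w * a%:R / 2) ^+ 2.
  elim: a n => [|a IHa] n.
    rewrite mulr1; apply: le_trans (hG n) _; rewrite mulr0 mul0r addr0.
    have n1 : 0 < n.+1%:R :> R by rewrite ltr0n.
    have n3 : 0 < n%:R + 3 :> R by rewrite ltr_wpDl.
    rewrite ler_pdivrMr ?exprn_gt0 // mulrAC ler_pdivlMr ?exprn_gt0 //.
    rewrite [leRHS](_ : _ = g * (3 * n.+1%:R) ^+ 2); last by ring.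
    rewrite ler_wpM2l // lerXn2r ?nnegrE ?(ltW n3) ?mulr_ge0 //.
    by rewrite -natrM -natrD ler_nat; clear; lia.
  have -> : G * F ^+ n * U ^+ a.+1
      = w *: (G * F ^+ n.+1 * U ^+ a) + W * (G * F ^+ n * U ^+ a).
    by rewrite exprS {1}defU [F ^+ n.+1]exprS -!mul_polyC; ring.
  set t := n%:R + 3 + w * a%:R / 2.
  have t3 : 3 <= t by rewrite /t addrAC lerDr addr_ge0 // ?divr_ge0 ?mulr_ge0 // ltW.
  have := sqr_inv_concave t3 (_ : 0 <= w <= 1); rewrite w1 ltW // => /(_ isT) h.
  rewrite (_ : n%:R + 3 + w * a.+1%:R / 2 = t + w / 2); last first.
    by rewrite -[a.+1%:R]natr1 /t; field.
  rewrite -[(_ ^+ 2)^-1]div1r.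
  apply: le_trans (ler_wpM2l _ h); last by rewrite mulr_ge0.
  rewrite mulrDr; apply: l1D_le.
    rewrite l1Z gtr0_norm // mulrCA ler_wpM2l ?(ltW w0) //.
    apply: le_trans (IHa _) _; rewrite -[n.+1%:R]natr1.
    by rewrite [t + 1](_ : _ = n%:R + 1 + 3 + w * a%:R / 2) //; rewrite /t; ring.
  by rewrite [leRHS]mulrCA; apply: l1M_le => //; exact: IHa.
have k1 : 0 < k.+1%:R :> R by rewrite ltr0n.
have hQ : l1 (U ^+ (3 * k) - (F ^+ 2 * C) ^+ k) <= 9 * g / w ^+ 2 / k.+1%:R.
  rewrite exprM subrXX mulr_sumr -/G.
  (* In the telescoping sum the i-th term has 2i factors F and 3(k-1-i) factors U. Whatever i is,
     their combined smoothing is at least that of w (k+1) factors F; the powers of C are only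
     bounded by 1. *)
  have hi (i : 'I_k) : l1 (G * ((U ^+ 3) ^+ (k.-1 - i) * (F ^+ 2 * C) ^+ i))
      <= 9 * g / (w * k.+1%:R) ^+ 2.
    rewrite [(F ^+ 2 * C) ^+ i]exprMn -!exprM.
    rewrite (_ : G * _ = G * F ^+ (2 * i) * U ^+ (3 * (k.-1 - i)) * C ^+ i);
      last by ring.
    rewrite -[leRHS]mulr1; apply: l1M_le; last exact: l1_exp_le1.
    apply: le_trans (hGU _ _) _.
    rewrite ler_wpM2l ?mulr_ge0 // lef_pV2 ?posrE ?exprn_gt0 ?mulr_gt0 //; last first.
      by rewrite ltr_wpDr ?divr_ge0 ?mulr_ge0 ?(ltW w0) // ltr_wpDl.
    rewrite lerXn2r ?nnegrE ?mulr_ge0 ?addr_ge0 ?divr_ge0 ?(ltW w0) //.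
      by rewrite mulr_ge0 // ltW.
    have -> : k.+1%:R = i%:R + (k.-1 - i)%:R + 2 :> R.
      by rewrite -!natrD; congr (_%:R); have := ltn_ord i; clear; lia.
    rewrite !natrM; set a := (k.-1 - i)%:R; have a0 : 0 <= a by [].
    have i0 : 0 <= (i%:R : R) by [].
    have := mulr_ge0 (ltW w0) a0.
    have : w * i%:R <= i%:R by rewrite ler_piMl.
    lra.
  apply: le_trans (l1_sum_le hi) _; rewrite card_ord.
  rewrite [leLHS](_ : _ = 9 * g / w ^+ 2 / k.+1%:R * (k%:R / k.+1%:R)); last first.
    by field; rewrite !gt_eqF.
  rewrite ler_piMr ?divr_ge0 ?mulr_ge0 ?sqr_ge0 ?(ltW w0) //.
  by rewrite ler_pdivrMr // mul1r ler_nat.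
(* The at most two votes outside the blocks are replaced by F alone. This matches only first
   moments, but a bounded number of errors of order 1/k is affordable. *)
rewrite (_ : _ - _ = U ^+ r * (U ^+ (3 * k) - (F ^+ 2 * C) ^+ k)
     + (U ^+ r - F ^+ r) * (F ^+ (2 * k) * C ^+ k)); last first.
  have -> : (F ^+ 2 * C) ^+ k = F ^+ (2 * k) * C ^+ k by rewrite exprMn -exprM.
  rewrite !exprD.
  by move: (U ^+ (3 * k)) (F ^+ (2 * k)) (C ^+ k) (U ^+ r) (F ^+ r) => *; ring.
rewrite [leRHS]mulrDl; apply: l1D_le.
  by rewrite -[leRHS]mul1r; apply: l1M_le => //; exact: l1_exp_le1.
rewrite subrXX -/D.
rewrite [X in l1 X](_ : _ = (D * F ^+ (2 * k) * (\sum_(i < r) U ^+ (r.-1 - i) * F ^+ i)) * C ^+ k);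
  last by ring.
rewrite -[leRHS]mulr1; apply: l1M_le; last exact: l1_exp_le1.
apply: le_trans (_ : c2 / (2 * k).+1%:R * 2 <= _).
  apply: l1M_le => //; apply: le_trans (l1_sum_le (b := 1) _) _ => [i|].
    by rewrite -[leRHS]mulr1 l1M_le // l1_exp_le1.
  by rewrite card_ord mulr1 ler_nat.
rewrite mulrC mulrA ler_wpM2l ?mulr_ge0 // lef_pV2 ?posrE ?ltr0n // ler_nat.
by clear; lia.
Qed.
End Replacement.

(** * Walsh expansion over the opponents *)

Section CubeExpansion.
Variables (R : realType) (d : nat) (e : 'I_d -> nat).
Implicit Types A S : {set 'I_d}.

Definition coin j : {poly R} := 2^-1 *: (1 + 'X^(e j)).
Definition flip j : {poly R} := 2^-1 *: ('X^(e j) - 1).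
(** A discrete derivative in the directions of [A] and a coin average in all the others. The signs
    [sgn S A] are the Walsh characters. *)
Definition cube A : {poly R} := \prod_j (if j \in A then flip j else coin j).
Definition mono S : {poly R} := \prod_j (if j \in S then 'X^(e j) else 1).
Definition sgn S A : R := \prod_(j in A) (if j \in S then 1 else -1).

(** Coordinatewise, x = coin + flip and 1 = coin - flip; expanding the product over coordinates
    gives the Walsh expansion of a point mass. *)
Lemma mono_cube S : mono S = \sum_A sgn S A *: cube A.
Proof.
transitivity (\prod_j ((if j \in S then 1 else -1 : R) *: flip j + coin j)).
  apply: eq_bigr => j _; rewrite /flip /coin; set x : {poly R} := 'X^_.
  have E : (2^-1 : R) *: (x + x) = x.
    by rewrite scalerDr -scalerDl -[2^-1]div1r -splitr scale1r.
  case: ifP => _; rewrite ?scale1r ?scaleN1r -?scalerN -scalerDr.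
    by rewrite addrACA [-1 + _]addrC -{1}E; congr (_ *: _); ring.
  rewrite opprB addrACA addNr addr0 scalerDr -scalerDl -[2^-1]div1r -splitr.
  by rewrite scale1r.
rewrite bigA_distr; apply: eq_big => // A _.
rewrite /sgn [X in X *: _]big_mkcond /cube -scaler_prod; apply: eq_bigr => j _.
by case: ifP => _; rewrite ?scale1r.
Qed.

Lemma cube0 : cube finset.set0 = (2^-1 ^+ d) *: \sum_S mono S.
Proof.
rewrite /cube; under eq_bigr do rewrite finset.in_set0 /coin.
rewrite scaler_prod prodr_const card_ord; congr (_ *: _).
by under eq_bigr do rewrite addrC; rewrite bigA_distr; apply: eq_bigl => A.
Qed.

Lemma mono_le1 S : l1 (mono S) <= 1.
Proof.
apply: le_trans (l1_prod _ _ _) _; apply: prodr_ile1 => j _.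
by rewrite l1_ge0; case: ifP => _; rewrite ?l1_Xn ?l1_1 lexx.
Qed.

Lemma coin_le1 j : l1 (coin j) <= 1.
Proof.
rewrite /coin l1Z ger0_norm // -[leRHS](@mulVf _ 2) ?pnatr_eq0 //.
by rewrite ler_wpM2l //; apply: l1D_le; rewrite ?l1_1 ?l1_Xn.
Qed.

Lemma cube0_le1 : l1 (cube finset.set0) <= 1.
Proof.
apply: le_trans (l1_prod _ _ _) _; apply: prodr_ile1 => j _.
by rewrite l1_ge0 finset.in_set0 coin_le1.
Qed.

Lemma cube_smoothing A n :
  l1 (cube A * cube finset.set0 ^+ n) <= (Num.sqrt n.+1%:R)^-1 ^+ #|A|.
Proof.
have -> : cube finset.set0 = \prod_j coin j by apply: eq_bigr => j _; rewrite finset.in_set0.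
rewrite -prodrXl -big_split; apply: le_trans (l1_prod _ _ _) _ => /=.
rewrite -prodr_const [leRHS]big_mkcond; apply: ler_prod => j _.
rewrite l1_ge0; case: ifP => _; first exact: coin_smoothing.
by rewrite -exprS l1_exp_le1 ?coin_le1.
Qed.

(** Each direction in [A] gains (n+1)^(-1/2), so a combination without Walsh coefficients below
    order 2q gains (n+1)^(-q). *)
Lemma cube_sum_smoothing (a : {set 'I_d} -> R) b q n :
  (forall A, (#|A| < 2 * q)%N -> a A = 0) -> (forall A, `|a A| <= b) ->
  l1 ((\sum_A a A *: cube A) * cube finset.set0 ^+ n)
    <= #|{set 'I_d}|%:R * b / n.+1%:R ^+ q.
Proof.
move=> a0 ab; rewrite mulr_suml -mulrA; apply: l1_sum_le => A.
have b0 : 0 <= b by apply: le_trans (ab A).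
rewrite -scalerAl l1Z; have [lt_Aq|le_qA] := ltnP #|A| (2 * q).
  by rewrite a0 // normr0 mul0r divr_ge0 ?exprn_ge0.
apply: ler_pM => //; first exact: l1_ge0.
apply: le_trans (cube_smoothing A n) _.
set s := (_)^-1.
have s01 : 0 <= s <= 1.
  rewrite invr_ge0 sqrtr_ge0 invf_le1 ?sqrtr_gt0 ?ltr0n //.
  by rewrite -[leLHS]sqrtr1 ler_sqrt // ler1n.
have -> : n.+1%:R ^- q = s ^+ (2 * q).
  by rewrite exprM exprVn sqr_sqrtr // exprVn.
by case/andP: s01 => s0 s1; rewrite -(subnK le_qA) exprD ler_piMl ?exprn_ge0 ?exprn_ile1.
Qed.

End CubeExpansion.

(** * Moments of the comparisons made by a uniform ranking *)

Section Rankings.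
Variables (R : realType) (d : nat) (c : 'I_d.+1).
Implicit Types (s : {perm 'I_d.+1}) (A S : {set 'I_d}).

Definition above s : {set 'I_d} := [set i | (s c < s (lift c i))%N].

Definition sg s (a b : 'I_d.+1) : R := if (s a < s b)%N then 1 else -1.

Lemma sgC s a b : a != b -> sg s b a = - sg s a b.
Proof.
move=> ab; rewrite /sg; case: ltngtP => //.
  by rewrite opprK.
by move=> /val_inj/perm_inj eab; rewrite eab eqxx in ab.
Qed.

Lemma sgn_above s A : sgn R (above s) A = \prod_(j in A) sg s c (lift c j).
Proof. by apply: eq_bigr => j _; rewrite inE. Qed.

Lemma normr_sg s a b : `|sg s a b| = 1.
Proof. by rewrite /sg; case: ifP; rewrite ?normrN1 ?normr1. Qed.

(** The Walsh coefficient at [A] of the law of [above c s]: the mixed moment of the +1/-1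
    comparisons of [c] with the opponents in [A]. *)
Definition ranking_moment A : R :=
  #|{perm 'I_d.+1}|%:R^-1 * \sum_s sgn R (above s) A.

Let M_gt0 : 0 < #|{perm 'I_d.+1}|%:R :> R.
Proof. by rewrite ltr0n; apply/card_gt0P; exists 1%g. Qed.

Lemma ranking_moment_le1 A : `|ranking_moment A| <= 1.
Proof.
rewrite normrM ger0_norm ?invr_ge0 // mulrC ler_pdivrMr // mul1r.
apply: le_trans (ler_norm_sum _ _ _) _; rewrite -sumr_const; apply: ler_sum.
by move=> s _; rewrite sgn_above normr_prod big1 // => j _; rewrite normr_sg.
Qed.

Lemma ranking_moment0 : ranking_moment finset.set0 = 1.
Proof.
rewrite /ranking_moment; under eq_bigr do rewrite /sgn big_set0.
by rewrite sumr_const mulVf // gt_eqF.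
Qed.

(** Reversing the ranking is a bijection that changes the sign of every comparison. *)
Lemma ranking_moment_odd A : odd #|A| -> ranking_moment A = 0.
Proof.
move=> oddA; rewrite /ranking_moment.
suff -> : \sum_s sgn R (above s) A = 0 by rewrite mulr0.
pose r : {perm 'I_d.+1} := perm (@rev_ord_inj d.+1).
set S := \sum_s _; suff : S = - S.
  by move=> SS; lra.
rewrite /S {1}(reindex_inj (mulIg r)) -sumrN; apply: eq_bigr => s _.
rewrite !sgn_above -[RHS]mulN1r -(_ : \prod_(j in A) -1 = -1); last first.
  by rewrite prodr_const -signr_odd oddA expr1.
rewrite -big_split; apply: eq_bigr => j _ /=; rewrite mulN1r -sgC ?neq_lift //.
by rewrite /sg !permM !permE /=; congr (if _ then _ else _); have := ltn_ord (s c); have := ltn_ord (s (lift c j)); clear; lia.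
Qed.

(** For three candidates, the product of the comparisons of one with the other two is -1 if it is
    the middle one and 1 otherwise. In each ranking the three products therefore add up to 1, and by
    symmetry they have equal sums over all rankings. *)
Lemma ranking_moment2 A : #|A| = 2%N -> ranking_moment A = 3^-1.
Proof.
move=> /eqP/cards2P[i [j] [neq_ij ->]].
have ne_lift : lift c i != lift c j by rewrite (inj_eq lift_inj).
set a := lift c i in ne_lift; set b := lift c j in ne_lift.
have ca : c != a by rewrite neq_lift.
have cb : c != b by rewrite neq_lift.
pose P (x y z : 'I_d.+1) := \sum_s sg s x y * sg s x z.
have swap (t : {perm 'I_d.+1}) x y z : P (t x) (t y) (t z) = P x y z :> R.
  rewrite /P [RHS](reindex_inj (mulgI t)); apply: eq_bigr => s _.
  by rewrite /sg !permM.
have Pab : P a c b = P c a b.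
  by rewrite -(swap (tperm c a)) tpermL tpermR tpermD.
have Pba : P b c a = P c b a.
  by rewrite -(swap (tperm c b)) tpermL tpermR tpermD // eq_sym.
have PC x y z : P x y z = P x z y by apply: eq_bigr => s _; rewrite mulrC.
have : P c a b + P a c b + P b c a = #|{perm 'I_d.+1}|%:R.
  rewrite -!big_split -sumr_const; apply: eq_bigr => s _ /=.
  rewrite ![sg s _ c]sgC // [sg s b a]sgC // /sg.
  have : s c != s a by rewrite (inj_eq perm_inj).
  have : s c != s b by rewrite (inj_eq perm_inj).
  have : s a != s b by rewrite (inj_eq perm_inj).
  rewrite -!val_eqE /=.
  by case: (ltngtP (s c) (s a)) => // h1; case: (ltngtP (s c) (s b)) => // h2;
    case: (ltngtP (s a) (s b)) => // h3 _ _ _; (try by ring); exfalso; lia.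
rewrite Pba Pab [P c b a]PC => E.
rewrite /ranking_moment (eq_bigr (fun s => sg s c a * sg s c b)); last first.
  by move=> s _; rewrite sgn_above big_setU1 ?big_set1 // inE.
rewrite -/(P c a b) -E.
have P0 : P c a b != 0.
  by apply: contraTneq M_gt0 => P0; rewrite -E P0 !addr0 ltxx.
rewrite (_ : _ + _ = P c a b * 3); last by ring.
by rewrite invfM mulrAC mulVf ?mul1r.
Qed.

(** List the opponents outside [S], then [c], then those in [S], and rank each candidate by its
    index in this list. *)
Lemma above_surj S : exists s, above s = S.
Proof.
pose L := [seq lift c i | i <- enum (~: S)] ++ c :: [seq lift c i | i <- enum S].
have c_notin (B : {set 'I_d}) : c \notin [seq lift c i | i <- enum B].
  by apply/mapP => -[i _ /eqP]; rewrite (negPf (neq_lift _ _)).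
have in_lift (B : {set 'I_d}) i : (lift c i \in [seq lift c j | j <- enum B]) = (i \in B).
  by rewrite mem_map ?mem_enum //; exact: lift_inj.
have memL j : j \in L.
  rewrite mem_cat inE; case: (unliftP c j) => [i ->|->]; last by rewrite eqxx orbT.
  by rewrite !in_lift inE; case: (i \in S); rewrite ?orbT.
have sizeL : size L = d.+1.
  rewrite size_cat /= !size_map -!cardE addnS addnC cardsC card_ord //.
have ltL j : (index j L < d.+1)%N by rewrite -[leqRHS]sizeL index_mem.
have injL : injective (fun j => Ordinal (ltL j)).
  move=> j k /(congr1 val) /= E.
  by rewrite -(nth_index c (memL j)) E nth_index.
exists (perm injL); apply/finset.setP => i; rewrite inE !permE /=.
rewrite /L !index_cat (negPf (c_notin _)) /= eqxx addn0 in_lift inE.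
case: (boolP (i \in S)) => Si /=; last first.
  by apply/negbTE; rewrite -leqNgt; apply: ltnW; rewrite index_mem in_lift inE.
by rewrite (negPf (neq_lift _ _)) addnS ltnS leq_addr.
Qed.

End Rankings.

(** * The law of one vote compared with independent and with equal coins *)

Section RankingLaw.
Variables (R : realType) (d : nat) (c : 'I_d.+1) (e : 'I_d -> nat).
Implicit Types (s : {perm 'I_d.+1}) (A S : {set 'I_d}).

Definition ranking_law : {poly R} :=
  #|{perm 'I_d.+1}|%:R^-1 *: \sum_s mono R e (above c s).

Definition unanimous : {poly R} := 2^-1 *: (mono R e [set: 'I_d] + 1).

Let M_gt0 : 0 < #|{perm 'I_d.+1}|%:R :> R.
Proof. by rewrite ltr0n; apply/card_gt0P; exists 1%g. Qed.

Lemma ranking_law_cube :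
  ranking_law = \sum_A ranking_moment R c A *: cube R e A.
Proof.
rewrite /ranking_law; under eq_bigr do rewrite mono_cube.
rewrite exchange_big scaler_sumr; apply: eq_bigr => A _ /=.
by rewrite -scaler_suml scalerA.
Qed.

Lemma unanimous_cube :
  unanimous = \sum_(A : {set 'I_d}) (2^-1 * (1 + (-1) ^+ #|A|)) *: cube R e A.
Proof.
have -> : unanimous = 2^-1 *: (mono R e [set: 'I_d] + mono R e finset.set0).
  by rewrite /unanimous [mono R e finset.set0]big1 // => j _; rewrite finset.in_set0.
rewrite !mono_cube -big_split scaler_sumr; apply: eq_bigr => A _ /=.
rewrite -scalerDl scalerA; congr (_ * (_ + _) *: _).
  by rewrite /sgn big1 // => j _; rewrite finset.in_setT.
by rewrite -prodr_const; apply: eq_bigr => j _; rewrite finset.in_set0.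
Qed.

Lemma cube0_delta :
  cube R e finset.set0 = \sum_A (A == finset.set0)%:R *: cube R e A.
Proof.
rewrite (bigD1 finset.set0) //= eqxx scale1r big1 ?addr0 // => A /negPf ->.
by rewrite scale0r.
Qed.

(** Both laws have mass 1 and centred coordinates, so the Walsh expansion of the difference starts
    at order 2. *)
Lemma ranking_law_smoothing n :
  l1 ((ranking_law - cube R e finset.set0) * cube R e finset.set0 ^+ n)
    <= #|{set 'I_d}|%:R * 1 / n.+1%:R.
Proof.
rewrite -[leRHS]mulr1 mulrAC -[_%:R in X in _ / X]expr1 mulr1.
pose a A : R := ranking_moment R c A - (A == finset.set0)%:R.
have -> : ranking_law - cube R e finset.set0 = \sum_A a A *: cube R e A.
  rewrite ranking_law_cube cube0_delta -sumrB.
  by apply: eq_bigr => A _; rewrite scalerBl.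
apply: cube_sum_smoothing => A; rewrite /a.
  case E : #|A| => [|[|]] // _.
    by rewrite (cards0_eq E) eqxx ranking_moment0 subrr.
  by rewrite ranking_moment_odd ?E // -cards_eq0 E subrr.
have [->|_] := eqVneq A finset.set0.
  by rewrite ranking_moment0 subrr normr0.
by rewrite subr0 ranking_moment_le1.
Qed.

Lemma ranking_law_smoothing2 n :
  l1 ((ranking_law - cube R e finset.set0 - 3^-1 *: (unanimous - cube R e finset.set0))
      * cube R e finset.set0 ^+ n)
    <= #|{set 'I_d}|%:R * 2 / n.+1%:R ^+ 2.
Proof.
pose z A : R := (A == finset.set0)%:R.
pose a A : R := ranking_moment R c A - z A
  - 3^-1 * (2^-1 * (1 + (-1) ^+ #|A|) - z A).
have -> : ranking_law - cube R e finset.set0 - 3^-1 *: (unanimous - cube R e finset.set0)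
    = \sum_A a A *: cube R e A.
  rewrite ranking_law_cube cube0_delta unanimous_cube -!sumrB scaler_sumr -sumrB.
  by apply: eq_bigr => A _; rewrite /a /z -!scalerBl scalerA -scalerBl.
apply: cube_sum_smoothing => A; rewrite /a /z.
  case E : #|A| => [|[|[|[|]]]] // _.
  - by rewrite (cards0_eq E) eqxx ranking_moment0 expr0 /=; field.
  - by rewrite ranking_moment_odd ?E // -cards_eq0 E expr1 /=; field.
  - by rewrite ranking_moment2 // -cards_eq0 E expr2 /=; field.
  - by rewrite ranking_moment_odd ?E // -cards_eq0 E !exprS expr0 /=; field.
have [->|_] := eqVneq A finset.set0.
  rewrite ranking_moment0 cards0 expr0 /= [X in `|X|](_ : _ = 0) ?normr0 //.
  by field.
have := ranking_moment_le1 R c A; rewrite -signr_odd !ler_norml => /andP[h1 h2].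
by case: (odd _); rewrite /= ?expr1 ?expr0; apply/andP; split; lra.
Qed.

Lemma ranking_law_le1 : l1 ranking_law <= 1.
Proof.
rewrite /ranking_law l1Z ger0_norm ?invr_ge0 // mulrC ler_pdivrMr // mul1r.
rewrite -[leRHS]mulr1; apply: l1_sum_le => s; exact: mono_le1.
Qed.

Lemma unanimous_le1 : l1 unanimous <= 1.
Proof.
rewrite /unanimous l1Z ger0_norm // -[leRHS](@mulVf _ 2) ?pnatr_eq0 //.
by rewrite ler_wpM2l //; apply: l1D_le; rewrite ?mono_le1 ?l1_1.
Qed.

(** The Doeblin weight 2^d / (d+1)!: each of the 2^d patterns, of mass 2^(-d) under F, comes from at
    least one of the (d+1)! rankings. *)
Definition minorization : R := #|{set 'I_d}|%:R / #|{perm 'I_d.+1}|%:R.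

Let T_gt0 : 0 < #|{set 'I_d}|%:R :> R.
Proof. by rewrite ltr0n; apply/card_gt0P; exists finset.set0. Qed.

Let count_ge1 S : (0 < #|[set s | above c s == S]%SET|)%N.
Proof.
have [s aS] := above_surj c S; apply/card_gt0P; exists s.
by rewrite inE aS eqxx.
Qed.

Let sum_count : (\sum_S #|[set s | above c s == S]%SET| = #|{perm 'I_d.+1}|)%N.
Proof.
rewrite -sum1_card (partition_big (above c) predT) //=; apply: eq_bigr => S _.
by rewrite -sum1dep_card.
Qed.

Lemma minorization_gt0_le1 : 0 < minorization <= 1.
Proof.
rewrite divr_gt0 //= ler_pdivrMr // mul1r ler_nat -sum_count -sum1_card.
by apply: leq_sum => S _.
Qed.

(* Every pattern of comparisons with [c] occurs for some ranking. *)
Lemma ranking_law_minorization :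
  l1 (ranking_law - minorization *: cube R e finset.set0) <= 1 - minorization.
Proof.
have cardT : #|{set 'I_d}|%:R = 2 ^+ d :> R.
  by rewrite -cardsT -powersetT card_powerset cardsT card_ord natrX.
have -> : ranking_law - minorization *: cube R e finset.set0 =
    #|{perm 'I_d.+1}|%:R^-1 *: \sum_S
       (#|[set s | above c s == S]%SET|%:R - 1) *: mono R e S.
  rewrite cube0 scalerA /minorization cardT exprVn mulrAC mulfV ?mul1r; last first.
    by rewrite expf_neq0 // pnatr_eq0.
  rewrite -scalerBr; congr (_ *: _); rewrite (partition_big (above c) predT) //=.
  rewrite -sumrB; apply: eq_bigr => S _; rewrite scalerBl scale1r; congr (_ - _).
  rewrite (eq_bigr (fun _ => mono R e S)) => [|s /eqP -> //].
  by rewrite sumr_const scaler_nat cardsE.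
rewrite l1Z ger0_norm ?invr_ge0 //.
rewrite -(ler_pM2l M_gt0) mulrA mulfV ?gt_eqF // mul1r mulrBr mulr1.
rewrite /minorization mulrCA mulfV ?gt_eqF // mulr1.
apply: le_trans (l1_sum _ _ _) _; rewrite -sum_count natr_sum -sum1_card natr_sum.
rewrite -sumrB; apply: ler_sum => S _; rewrite l1Z ger0_norm; last first.
  by rewrite subr_ge0 ler1n.
by rewrite ler_piMr ?mono_le1 // subr_ge0 ler1n.
Qed.

End RankingLaw.

(** [K] is chosen before [e] because the encoding used later has exponents depending on the number
    of voters. *)
Lemma ranking_replacement (R : realType) (d : nat) (c : 'I_d.+1) :
  exists K : R, forall (e : 'I_d -> nat) k r, (r < 3)%N ->
    l1 (ranking_law R c e ^+ (3 * k + r)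
        - cube R e finset.set0 ^+ (2 * k + r) * unanimous R e ^+ k) <= K / k.+1%:R.
Proof.
have c2 : 0 <= #|{set 'I_d}|%:R * 1 :> R by rewrite mulr1.
have c4 : 0 <= #|{set 'I_d}|%:R * 2 :> R by rewrite mulr_ge0.
have [K hK] := replacement c2 c4 (minorization_gt0_le1 R c).
exists K => e; apply: (hK _ _ _ (ranking_law R c e - minorization R d *: cube R e finset.set0)).
- exact: cube0_le1.
- exact: unanimous_le1.
- exact: ranking_law_le1.
- by rewrite addrC subrK.
- exact: ranking_law_minorization.
- exact: ranking_law_smoothing.
- exact: ranking_law_smoothing2.
Qed.

(** * Tallies encoded as digits, and reduction to binomial distribution functions *)

Lemma digits_inj d B (a b : 'I_d -> nat) :
  (forall i, a i < B)%N -> (forall i, b i < B)%N ->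
  (\sum_i a i * B ^ i = \sum_i b i * B ^ i)%N -> a =1 b.
Proof.
elim: d a b => [|d IHd] a b aB bB; first by move=> _ [].
have shift (f : 'I_d.+1 -> nat) :
    (\sum_i f i * B ^ i = (\sum_(i < d) f (lift ord0 i) * B ^ i) * B + f ord0)%N.
  rewrite big_ord_recl muln1 addnC big_distrl; congr (_ + _)%N.
  by apply: eq_bigr => i _; rewrite lift0 expnSr mulnA.
rewrite !shift => E.
have E0 : a ord0 = b ord0.
  by have := congr1 (modn^~ B) E; rewrite /= !modnMDl !modn_small.
move: E; rewrite E0 => /addIn /eqP; rewrite eqn_pmul2r ?(leq_ltn_trans _ (aB ord0)) //.
move=> /eqP /(IHd _ _ (fun i => aB _) (fun i => bB _)) E i.
by case: (unliftP ord0 i) => [j ->|->]; [exact: E|].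
Qed.

Lemma natr_forall (R : comPzSemiRingType) (I : finType) (P : pred I) :
  [forall i, P i]%:R = \prod_i (P i)%:R :> R.
Proof.
case: (boolP [forall i, P i]) => [/forallP h|/forallPn[i /negPf hi]].
  by rewrite big1 // => i _; rewrite h.
by rewrite (bigD1 i) //= hi mul0r.
Qed.

Definition binp (R : realType) n i : R := 'C(n, i)%:R / 2 ^+ n.

Section WinnerFunctional.
Variables (R : realType) (d n : nat).

Definition base (j : 'I_d) : nat := (n.+1 ^ j)%N.

(* The powers of [n+1] encode the vector of the numbers of voters preferring [c]
   to each other candidate as the exponent of a monomial in one variable. *)
Definition wins (k : nat) : R :=
  [exists a : {ffun 'I_d -> 'I_n.+1},
     (\sum_i a i * base i == k)%N && [forall i, n < 2 * a i]%N]%:R.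

Lemma wins_le1 k : `|wins k| <= 1.
Proof. by rewrite /wins; case: [exists _, _]; rewrite ?normr1 ?normr0. Qed.

Lemma winsE (a : 'I_d -> nat) : (forall i, a i <= n)%N ->
  wins (\sum_i a i * base i)%N = [forall i, n < 2 * a i]%N%:R.
Proof.
move=> an; congr (_%:R); congr (nat_of_bool _); apply/existsP/forallP => [[b]|h].
  move=> /andP[/eqP/digits_inj E /forallP h] i.
  by rewrite -E // => j; rewrite ltnS.
exists [ffun i => inord (a i)]; apply/andP; split.
  by apply/eqP; apply: eq_bigr => i _; rewrite ffunE inordK // ltnS.
by apply/forallP => i; rewrite ffunE inordK ?h // ltnS.
Qed.

Lemma condorcet_winner_lift (c : 'I_d.+1) (P : profile d.+1 n) :
  condorcet_winner P c =
    [forall i : 'I_d, n < 2 * #|[set v : 'I_n | i \in above c (P v)]%SET|]%N.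
Proof.
have E i : [set v : 'I_n | ranks_above P v c (lift c i)]%SET =
    [set v : 'I_n | i \in above c (P v)]%SET.
  by apply/finset.setP => v; rewrite !inE.
apply/forallP/forallP => h i.
  by have := h (lift c i); rewrite eq_sym neq_lift E.
by case: (unliftP c i) => [j ->|->]; [rewrite E; apply/implyP => _; exact: h|rewrite eqxx].
Qed.

(** Expanding the n-th power of the sum over rankings yields one monomial per profile, whose
    exponent encodes the tallies of [c] against each opponent. *)
Lemma prob_cw_lin (c : 'I_d.+1) :
  prob_cw R n c = lin wins (ranking_law R c base ^+ n).
Proof.
rewrite /ranking_law exprZn linZ /prob_cw [_ / _]mulrC card_ffun card_ord natrX exprVn.
congr (_ * _).
rewrite -[X in lin _ X](_ : \prod_(v < n) \sum_s mono R base (above c s) = _);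
  last by rewrite prodr_const card_ord.
rewrite bigA_distr_bigA /= lin_sum -sum1_card natr_sum big_mkcond.
apply: eq_bigr => P _; rewrite inE condorcet_winner_lift.
have -> : \prod_(i < n) mono R base (above c (P i)) =
    'X^(\sum_i #|[set v : 'I_n | i \in above c (P v)]%SET| * base i).
  rewrite exchange_big expr_sum; apply: eq_bigr => j _ /=.
  rewrite mulnC exprM -prodr_const [RHS]big_mkcond.
  by apply: eq_bigr => v _; rewrite inE.
rewrite lin_Xn winsE => [|i]; last by rewrite -[leqRHS]card_ord max_card.
by case: [forall _, _].
Qed.

Lemma coin_exp (j : 'I_d) N :
  coin R base j ^+ N = \sum_(l < N.+1) binp R N l *: 'X^(l * base j).
Proof.
rewrite /coin exprZn exprDn scaler_sumr; apply: eq_bigr => l _.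
by rewrite expr1n mul1r -[_ *+ 'C(_, _)]scaler_nat scalerA mulrC exprVn -exprM mulnC.
Qed.

Lemma unanimous_exp k :
  unanimous R base ^+ k = \sum_(i < k.+1) binp R k i *: 'X^(\sum_j i * @base j).
Proof.
rewrite /unanimous exprZn addrC exprDn scaler_sumr; apply: eq_bigr => i _.
rewrite expr1n mul1r -[_ *+ 'C(_, _)]scaler_nat scalerA mulrC exprVn; congr (_ *: _).
rewrite /mono -prodrXl expr_sum; apply: eq_bigr => j _.
by rewrite finset.in_setT -exprM mulnC.
Qed.

Lemma mixture_lin N k : (N + k = n)%N ->
  lin wins (cube R base finset.set0 ^+ N * unanimous R base ^+ k) =
  \sum_(i < k.+1) binp R k i *
    (\sum_(l < N.+1) binp R N l * (n < 2 * (l + i))%N%:R) ^+ d.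
Proof.
move=> Nk; rewrite unanimous_exp mulr_sumr lin_sum; apply: eq_bigr => i _.
rewrite -scalerAr linZ; congr (_ * _).
have -> : cube R base finset.set0 ^+ N = \prod_j coin R base j ^+ N.
  by rewrite prodrXl; congr (_ ^+ _); apply: eq_bigr => j _; rewrite finset.in_set0.
under eq_bigr do rewrite coin_exp.
rewrite bigA_distr_bigA mulr_suml lin_sum /=.
rewrite -[RHS](_ : \prod_(j < d) \sum_(l < N.+1) binp R N l * (n < 2 * (l + i))%N%:R = _);
  last by rewrite prodr_const card_ord.
rewrite bigA_distr_bigA /=.
apply: eq_bigr => f _; rewrite scaler_prod -expr_sum -scalerAl -exprD linZ.
rewrite [RHS]big_split /=; congr (_ * _); rewrite -big_split /=.
under eq_bigr do rewrite -mulnDl.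
(* A digit is a tally: at most N independent votes plus the common contribution i <= k, hence at
   most N + k = n, as the encoding requires. *)
rewrite lin_Xn (winsE (a := fun j => (f j + i)%N)) ?natr_forall // => j.
by have := ltn_ord (f j); have := ltn_ord i; move: Nk; clear; lia.
Qed.

End WinnerFunctional.

Definition binp_cdf (R : realType) N L : R := \sum_(l < L) binp R N l.

Lemma binp_small (R : realType) N l : (N < l)%N -> binp R N l = 0.
Proof. by move=> ?; rewrite /binp bin_small // mul0r. Qed.

Lemma binp_sub (R : realType) N l : (l <= N)%N -> binp R N (N - l) = binp R N l.
Proof. by move=> ?; rewrite /binp bin_sub. Qed.

(** The symmetry l -> N - l of the fair binomial law turns the upper tail into an initial segment.
    Its length [i + uphalf (N - k)] rounds up because the majority is strict; the parity term comes
    from there. *)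
Lemma majority_cdf (R : realType) N k i : (k <= N)%N ->
  \sum_(l < N.+1) binp R N l * (N + k < 2 * (l + i))%N%:R
    = binp_cdf R N (i + uphalf (N - k)).
Proof.
move=> kN; rewrite (reindex_inj rev_ord_inj) /binp_cdf /=.
(* [L] may exceed N + 1, so both sums are padded to the common length [m]; the atoms beyond N
   vanish. *)
set L := (i + _)%N; set m := maxn L N.+1.
rewrite (big_ord_widen m (fun l => binp R N l)) ?leq_maxl // [RHS]big_mkcond.
rewrite (big_ord_widen m (fun l => binp R N (N.+1 - l.+1) *
   (N + k < 2 * (N.+1 - l.+1 + i))%N%:R)) ?leq_maxr // [LHS]big_mkcond.
apply: eq_bigr => l _; case: ltnP => [lN|/binp_small ->]; last by case: ifP.
rewrite subSS binp_sub //.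
have -> : (N + k < 2 * (N - l + i))%N = (l < L)%N by rewrite /L; move: kN lN; clear; lia.
by case: (_ < _)%N; rewrite ?mulr1 ?mulr0.
Qed.

Lemma condorcet_replacement (R : realType) d (c : 'I_d.+1) :
  exists K : R, forall k r, (r < 3)%N ->
    `| prob_cw R (3 * k + r) c
       - \sum_(i < k.+1) binp R k i * binp_cdf R (2 * k + r) (i + uphalf (k + r)) ^+ d |
      <= K / k.+1%:R.
Proof.
have [K hK] := ranking_replacement R c; exists K => k r r3; set n := (3 * k + r)%N.
apply: le_trans (hK (@base d n) k r r3).
have Nk : (2 * k + r + k = n)%N by rewrite /n; clear; lia.
rewrite prob_cw_lin; apply: le_trans (lin_le_l1 _ (wins_le1 R d n)).
rewrite linB (mixture_lin _ _ Nk) le_eqVlt; apply/orP; left.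
apply/eqP; congr (`|_ - _|); apply: eq_bigr => i _; congr (_ * _ ^+ _).
rewrite -Nk majority_cdf; last by clear; lia.
by congr binp_cdf; congr (_ + uphalf _)%N; clear; lia.
Qed.

(** * Elementary real estimates: midpoint rule, Cauchy weight, exponential inequalities *)

Section RealAnalysis.
Variable R : realType.
Implicit Types (x y z t h : R) (f : R -> R).

Lemma is_derive_comp1 (f g : R -> R) x (df dg : R) :
  is_derive (g x) 1 f df -> is_derive x 1 g dg -> is_derive x 1 (fun y => f (g y)) (df * dg).
Proof. move=> hf hg; exact: is_derive1_comp hf hg. Qed.

Lemma is_derive_affine (a b x : R) : is_derive x 1 (fun y => a * y + b) a.
Proof.
have -> : (fun y => a * y + b) = a \*: id + cst b by apply/funext.
by apply: is_derive_eq; rewrite addr0 /GRing.scale /= mulr1.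
Qed.

Lemma is_derive_comp_affine f (a b x df : R) :
  is_derive (a * x + b) 1 f df -> is_derive x 1 (fun y => f (a * y + b)) (a * df).
Proof.
by move=> hf; rewrite mulrC; apply: is_derive_comp1 => //; exact: is_derive_affine.
Qed.

Lemma MVT_line f f' a b : (forall x, is_derive x 1 f (f' x)) ->
  exists2 c, Num.min a b <= c <= Num.max a b & f b - f a = f' c * (b - a).
Proof.
move=> df.
have cf x : {for x, continuous f}.
  by apply: differentiable_continuous; apply/derivable1_diffP; apply: ex_derive.
have wlg u v : u <= v -> exists2 c, u <= c <= v & f v - f u = f' c * (v - u).
  move=> uv; have [] := @MVT_segment _ f f' u v uv (fun x _ => df x).
    exact: continuous_subspaceT.
  by move=> c; rewrite in_itv /= => cuv E; exists c.
have [ab|ba] := leP a b; first by have [c h E] := wlg _ _ ab; exists c.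
have [c h E] := wlg _ _ (ltW ba); exists c => //.
by rewrite -opprB E -mulrN opprB.
Qed.

(** A Cauchy-type weight: it dominates Gaussian terms with polynomial factors, survives unit shifts
    up to a constant, and has the primitive [atan], which bounds its lattice sums. *)
Definition rho z : R := (1 + z ^+ 2)^-1.

Lemma rho_gt0 z : 0 < rho z.
Proof. by rewrite invr_gt0 ltr_pwDl ?sqr_ge0. Qed.

Lemma rho_le1 z : rho z <= 1.
Proof. by rewrite invf_le1 ?ltr_pwDl ?sqr_ge0 // lerDl sqr_ge0. Qed.

Lemma rho_shift z t : `|t| <= 1 -> rho z <= 3 * rho (z + t).
Proof.
move=> t1; have [h1 h2] : 0 < 1 + z ^+ 2 /\ 0 < 1 + (z + t) ^+ 2.
  by rewrite !ltr_pwDl ?sqr_ge0.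
rewrite -[leLHS]div1r ler_pdivrMr // mulrAC ler_pdivlMr // mul1r.
have t2 : t ^+ 2 <= 1 by rewrite -real_normK ?num_real // exprn_ile1.
have := sqr_ge0 (z - t).
rewrite (_ : (z - t) ^+ 2 = z ^+ 2 - 2 * (z * t) + t ^+ 2); last by ring.
rewrite (_ : (z + t) ^+ 2 = z ^+ 2 + 2 * (z * t) + t ^+ 2); last by ring.
by have := sqr_ge0 z; move=> ? ?; lra.
Qed.

(** As a function of the half-width, the midpoint error has the symmetric second difference of [G]
    as its derivative. The mean value theorem then needs no second derivative of [G]. *)
Lemma midpoint_cell (A G : R -> R) C z h : 0 <= h <= 1 ->
  (forall x, is_derive x 1 A (G x)) ->
  (forall t, `|t| <= 1 -> `|G (z + t) + G (z - t) - 2 * G z| <= C * t ^+ 2) ->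
  `|A (z + h) - A (z - h) - 2 * h * G z| <= C * h ^+ 3.
Proof.
move=> /andP[h0 h1] dA hG.
pose H t := A (z + t) - A (z - t) - 2 * t * G z.
have dH t : is_derive t 1 H (G (z + t) + G (z - t) - 2 * G z).
  have d1 : is_derive t 1 (fun t => A (1 * t + z)) (1 * G (1 * t + z)).
    exact: is_derive_comp_affine.
  have d2 : is_derive t 1 (fun t => A (-1 * t + z)) (-1 * G (-1 * t + z)).
    exact: is_derive_comp_affine.
  have d3 : is_derive t 1 (fun t => 2 * G z * t + 0) (2 * G z).
    exact: is_derive_affine.
  have -> : H = (fun t => A (1 * t + z)) - (fun t => A (-1 * t + z))
      - (fun t => 2 * G z * t + 0).
    apply/funext => s; rewrite /H -[RHS]/(A _ - A _ - (_ + 0)) addr0.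
    by congr (A _ - A _ - _); ring.
  apply: is_derive_eq; rewrite mul1r mulN1r opprK; congr (G _ + G _ - _); ring.
have [c] := MVT_line 0 h dH.
rewrite min_l ?max_r // => /andP[c0 ch].
have -> : H 0 = 0 by rewrite /H mulr0 mul0r addr0 !subr0 subrr.
rewrite !subr0 -/(H h) => ->.
rewrite normrM (ger0_norm h0) exprSr mulrA ler_wpM2r //.
have C0 : 0 <= C by have := le_trans (normr_ge0 _) (hG 1 _); rewrite normr1 expr1n mulr1; apply.
have c1 : `|c| <= 1 by rewrite ger0_norm // (le_trans ch).
by apply: le_trans (hG _ c1) _; rewrite ler_wpM2l // lerXn2r ?nnegrE.
Qed.

(** Up to the factor 3 of [rho_shift], each term is at most sqrt(s)/2 times the increment of [atan]
    over a cell of width 2/sqrt(s); the increments telescope to at most pi. *)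
Lemma sum_rho : exists K, forall n s : nat, (0 < s)%N ->
  \sum_(l < n.+1) rho ((2 * l%:R - n%:R) / Num.sqrt s%:R) <= K * Num.sqrt s%:R.
Proof.
exists (3 * pi) => n s s0; set S : R := Num.sqrt s%:R.
have S1 : 1 <= S by rewrite -sqrtr1 ler_sqrt // ler1n.
have S0 : 0 < S by apply: lt_le_trans S1.
pose x (l : nat) : R := atan ((2 * l%:R - n%:R - 1) / S).
apply: le_trans (_ : 3 * S / 2 * \sum_(l < n.+1) (x l.+1 - x l) <= _).
  rewrite mulr_sumr; apply: ler_sum => l _.
  set z := (_ / S); rewrite /x.
  have -> : (2 * l.+1%:R - n%:R - 1) / S = z + S^-1.
    by rewrite -[l.+1%:R]natr1 /z; ring.
  have -> : (2 * l%:R - n%:R - 1) / S = z - S^-1 by rewrite /z; ring.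
  have [c] := MVT_line (z - S^-1) (z + S^-1) (@is_derive1_atan R).
  have Sle : z - S^-1 <= z + S^-1 by rewrite lerD2l ge0_cp // invr_ge0 ltW.
  rewrite min_l // max_r // => /andP[c1 c2] ->.
  have := @rho_shift z (c - z); rewrite subrKC => h.
  have : rho z <= 3 * rho c.
    apply: h; rewrite ler_norml; have : S^-1 <= 1 by rewrite invf_le1.
    by move=> ?; apply/andP; split; lra.
  rewrite -/(rho c) => {}h; apply: le_trans h _.
  rewrite [leRHS](_ : _ = 3 * rho c) //.
  by field; rewrite gt_eqF.
rewrite -(big_mkord xpredT (fun l => x l.+1 - x l)) telescope_sumr //.
have xpi : x n.+1 - x 0%N <= pi.
  have := atan_gtNpi2 ((2 * 0%:R - n%:R - 1) / S).
  have := atan_ltpi2 ((2 * n.+1%:R - n%:R - 1) / S).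
  by rewrite /x => ? ?; lra.
have := ler_wpM2l (ltW S0) xpi; have := mulr_ge0 (ltW S0) (pi_ge0 R); lra.
Qed.

Lemma expR_poly_le (t : R) (p : nat) : 0 <= t -> t ^+ p.+1 * expR (- t) <= p.+1`!%:R.
Proof.
move=> t0; rewrite expRN ler_pdivrMr ?expR_gt0 //.
rewrite -ler_pdivrMl ?ltr0n ?fact_gt0 // mulrC.
by apply: le_trans (expR_ge1Dxn p t0); rewrite lerDr.
Qed.

Lemma is_derive_expRN (x : R) : is_derive x 1 (fun x => expR (- x)) (- expR (- x)).
Proof.
have := @is_derive_comp_affine expR (-1) 0 x _ (is_derive_expR _).
rewrite addr0 !mulN1r => h.
have -> // : (fun y => expR (- y)) = (fun y : R => expR (-1 * y + 0)).
  by apply/funext => y; rewrite addr0 mulN1r.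
Qed.

Lemma expRN_lip (a b m : R) : m <= a -> m <= b -> `|expR (- a) - expR (- b)| <= `|a - b| * expR (- m).
Proof.
move=> ma mb.
have [c /andP[c1 _] ->] := MVT_line b a is_derive_expRN.
rewrite normrM mulrC ler_wpM2l // normrN gtr0_norm ?expR_gt0 // ler_expR lerN2.
by apply: le_trans c1; rewrite le_min ma mb.
Qed.

(** This and [binomial_ratio_ge] bracket (1-v)/(1+v) exp(2v), the ratio of consecutive binomial
    weights divided by their Gaussian profile. It differs from 1 only at order v^3. Here the
    difference [F] vanishes at 0 and has derivative v (exp v - exp (-v)). *)
Lemma binomial_ratio_le1 (v : R) : 0 <= v -> (1 - v) * expR (2 * v) <= 1 + v.
Proof.
move=> v0.
pose F v : R := (1 + v) * expR (- v) - (1 - v) * expR v.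
have dF x : is_derive x 1 F (x * (expR x - expR (- x))).
  have d1 := is_derive_expRN x.
  have -> : F = (cst 1 + id) * (fun x => expR (- x)) - (cst 1 - id) * expR by [].
  by apply: is_derive_eq; rewrite /GRing.scale /= !fctE /=; ring.
have [c] := MVT_line 0 v dF; rewrite min_l // max_r // => /andP[c0 cv].
rewrite subr0 => E.
have : 0 <= F v - F 0.
  by rewrite E !mulr_ge0 // subr_ge0 ler_expR; lra.
rewrite /F !(subr0, addr0, oppr0, expR0, mul1r) subrr subr0 subr_ge0.
rewrite -(ler_pM2r (expR_gt0 v)) -!mulrA -!expRD addNr expR0 mulr1.
by rewrite [2 * v]mulrC mulrDr mulr1.
Qed.

Lemma expR_ge_quadratic (x : R) : 0 <= x -> 1 + x + x ^+ 2 / 2 <= expR x.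
Proof.
move=> x0; pose F x : R := expR x - (1 + x + x ^+ 2 / 2).
have dF y : is_derive y 1 F (expR y - (1 + y)).
  have -> : F = expR - (cst 1 + id + 2^-1 \*: (id : R -> R) ^+ 2).
    by apply/funext => z; rewrite /F [_ / 2]mulrC.
  by apply: is_derive_eq; rewrite /GRing.scale /=; field.
have [c] := MVT_line 0 x dF; rewrite min_l // max_r // subr0 => _ E.
have : 0 <= F x - F 0 by rewrite E mulr_ge0 // subr_ge0 expR_ge1Dx.
by rewrite /F expR0 expr0n /= mul0r !addr0 subrr subr0 subr_ge0.
Qed.

Lemma binomial_ratio_ge (v : R) : 0 <= v <= 1 ->
  (1 - v ^+ 3) * (1 + v) <= (1 - v) * expR (2 * v).
Proof.
move=> /andP[v0 v1].
have h : (1 + v + v ^+ 2) * (1 + v) <= expR (2 * v).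
  rewrite mulr_natl mulr2n expRD.
  apply: le_trans (_ : (1 + v + v ^+ 2 / 2) * (1 + v + v ^+ 2 / 2) <= _).
    have v4 := exprn_ge0 4 v0.
    have -> : (1 + v + v ^+ 2 / 2) * (1 + v + v ^+ 2 / 2) =
      (1 + v + v ^+ 2) * (1 + v) + v ^+ 4 / 4 by field.
    lra.
  have v2 := sqr_ge0 v.
  by rewrite ler_pM ?expR_ge_quadratic //; lra.
have -> : (1 - v ^+ 3) * (1 + v) = (1 - v) * ((1 + v + v ^+ 2) * (1 + v)) by ring.
by rewrite ler_wpM2l // subr_ge0.
Qed.

End RealAnalysis.

(** * The standard Gaussian, domination by it, and its tails *)

Section Gaussian.
Variable R : realType.
Implicit Types (x y z t : R) (f g w : R -> R).
Local Notation mu := (@lebesgue_measure R).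

Definition phi z : R := expR (- (z ^+ 2 / 2)) / Num.sqrt (2 * pi).

Let sqrt2pi_ge1 : 1 <= Num.sqrt (2 * pi) :> R.
Proof. by rewrite -[leLHS]sqrtr1 ler_sqrt ?mulr_ge0 ?pi_ge0 //; have := pi_ge2 R; lra. Qed.

Lemma phi_gt0 z : 0 < phi z.
Proof. by rewrite divr_gt0 ?expR_gt0 // (lt_le_trans ltr01). Qed.

Lemma phi_le_expR z : phi z <= expR (- (z ^+ 2 / 2)).
Proof.
by rewrite ler_pdivrMr ?(lt_le_trans ltr01) // ler_peMr ?expR_ge0.
Qed.

Lemma phi_normal_pdf : phi = normal_pdf 0 1.
Proof.
apply/funext => z; rewrite normal_pdfE ?oner_neq0 // /phi mulrC.
by rewrite /normal_peak /normal_fun subr0 !expr1n mul1r mulr_natl mulNr.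
Qed.

Lemma phi_poly_le z : phi z * (1 + z ^+ 2) <= 13 * rho z.
Proof.
have h0 : 0 < 1 + z ^+ 2 by rewrite ltr_pwDl ?sqr_ge0.
rewrite /rho ler_pdivlMr // -mulrA.
have e0 := expR_ge0 (- (z ^+ 2 / 2)).
apply: le_trans (ler_wpM2r _ (phi_le_expR z)) _; first by rewrite mulr_ge0 // ltW.
have t0 : 0 <= z ^+ 2 / 2 by rewrite divr_ge0 ?sqr_ge0.
have : expR (- (z ^+ 2 / 2)) <= 1 by rewrite -[leRHS]expR0 ler_expR oppr_le0.
have h1 : z ^+ 2 / 2 * expR (- (z ^+ 2 / 2)) <= 1 := expR_poly_le 0 t0.
have h2 : (z ^+ 2 / 2) ^+ 2 * expR (- (z ^+ 2 / 2)) <= 2 := expR_poly_le 1 t0.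
move: h1 h2; set e := expR _; set u := z ^+ 2 / 2 => h1 h2 e1.
rewrite (_ : z ^+ 2 = 2 * u); last by rewrite /u; field.
rewrite (_ : e * _ = e + 4 * (u * e) + 4 * (u ^+ 2 * e)); last by ring.
lra.
Qed.

Lemma is_derive_phi z : is_derive z 1 phi (- z * phi z).
Proof.
have d1 : is_derive z 1 (fun z : R => - (z ^+ 2 / 2)) (- z).
  have -> : (fun z : R => - (z ^+ 2 / 2)) = - (2^-1 \*: (id : R -> R) ^+ 2).
    by apply/funext => s; rewrite /= mulrC.
  by apply: is_derive_eq; rewrite /GRing.scale /=; field.
have d2 := is_derive_comp1 (is_derive_expR _) d1.
have E : phi = (Num.sqrt (2 * pi))^-1 \*: (fun y : R => expR (- (y ^+ 2 / 2))).
  by apply/funext => s; rewrite /phi mulrC.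
by rewrite {1}E; apply: is_derive_eq; rewrite /phi /GRing.scale /=; ring.
Qed.

Lemma continuous_phi : continuous phi.
Proof. by rewrite phi_normal_pdf; apply: continuous_normal_pdf; rewrite oner_neq0. Qed.

Lemma integrable_phi : mu.-integrable setT (EFin \o phi).
Proof. by rewrite phi_normal_pdf; exact: integrable_normal_pdf. Qed.

Lemma Rintegral_phi : (\int[mu]_z phi z = 1)%R.
Proof. by rewrite phi_normal_pdf /Rintegral integral_normal_pdf. Qed.

Lemma integrable_scale M f (A : set (measurableTypeR R)) : measurable A ->
  mu.-integrable A (EFin \o f) -> mu.-integrable A (EFin \o (fun z => M * f z)).
Proof.
move=> mA intf; have -> : EFin \o (fun z => M * f z) = (fun z => M%:E * (EFin \o f) z)%E.
  by apply/funext => z /=; rewrite EFinM.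
exact: integrableZl.
Qed.

Definition dominated M f := continuous f /\ forall z, `|f z| <= M * phi z.

Lemma integrable_dominated M f : dominated M f -> mu.-integrable setT (EFin \o f).
Proof.
move=> [cf fM].
apply: (@le_integrable _ _ _ mu setT _ _ (EFin \o (fun z => M * phi z))) => //.
- by apply/measurable_EFinP; exact: continuous_measurable_fun.
- move=> z _ /=; rewrite lee_fin; apply: le_trans (fM z) (ler_norm _).
- exact: integrable_scale integrable_phi.
Qed.

Definition prim f x : R := (\int[mu]_(t in `]-oo, x]) f t)%R.

Lemma is_derive_prim f x : continuous f -> mu.-integrable setT (EFin \o f) ->
  is_derive x 1 (prim f) (f x).
Proof.
move=> cf int_f; have intf : mu.-integrable `]-oo, (x + 1)] (EFin \o f).
  exact: integrableS int_f.
have xlt : x < x + 1 by rewrite ltrDl.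
have [|d1 d2] := @continuous_FTC1 R f -oo%O x (x + 1) xlt intf _ (cf x).
  by rewrite ltNyr.
by rewrite -d2 derive1E; apply: derivableP.
Qed.

(** The standard normal distribution function. *)
Definition Gam : R -> R := prim phi.

Let int_phi (A : set (measurableTypeR R)) : measurable A -> mu.-integrable A (EFin \o phi).
Proof. by move=> mA; apply: integrableS integrable_phi. Qed.

Lemma prim_compl f x : mu.-integrable setT (EFin \o f) ->
  (\int[mu]_z f z - prim f x = \int[mu]_(z in `]x, +oo[) f z)%R.
Proof.
move=> intf; have := @Rintegral_itvB R f -oo%O +oo%O x.
by rewrite set_itvNyy => ->.
Qed.

Let dom_le M f (A : set (measurableTypeR R)) : measurable A -> dominated M f ->
  `|\int[mu]_(z in A) f z| <= M * \int[mu]_(z in A) phi z.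
Proof.
move=> mA domf; have [_ fM] := domf.
have intf : mu.-integrable A (EFin \o f).
  by apply: integrableS (integrable_dominated domf).
rewrite -RintegralZl //; last exact: int_phi.
apply: (le_trans (le_normr_Rintegral mA intf)).
apply: le_Rintegral => //; first exact: integrable_norm.
exact/integrable_scale/int_phi.
Qed.

Lemma prim_le M f x : dominated M f -> `|prim f x| <= M * Gam x.
Proof. by move=> domf; apply: dom_le. Qed.

Lemma prim_compl_le M f x : dominated M f ->
  `|\int[mu]_z f z - prim f x| <= M * (1 - Gam x).
Proof.
move=> domf; rewrite (prim_compl x (integrable_dominated domf)) -Rintegral_phi (prim_compl x integrable_phi).
exact: dom_le.
Qed.

Lemma Gam_ge0 x : 0 <= Gam x.
Proof. by apply: Rintegral_ge0 => z _; rewrite ltW ?phi_gt0. Qed.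

Lemma Gam_le1 x : Gam x <= 1.
Proof.
rewrite -subr_ge0 -Rintegral_phi (prim_compl x integrable_phi).
by apply: Rintegral_ge0 => z _; rewrite ltW ?phi_gt0.
Qed.

(* Chebyshev's inequality, the second moment being bounded through a wider Gaussian. *)
Lemma normal_pdf_tail (sg : R) : sg != 0 ->
  exists K, forall (A : set (measurableTypeR R)) x, measurable A ->
  (forall z, A z -> x ^+ 2 <= z ^+ 2) ->
  x ^+ 2 * (\int[mu]_(z in A) normal_pdf 0 sg z)%R <= K.
Proof.
(* Doubling the variance halves the exponent: one half absorbs the factor z^2, the other half is the
   wider density. *)
move=> sg0; pose s : R := Num.sqrt 2 * sg.
have sg2 : 0 < sg ^+ 2 by rewrite exprn_even_gt0.
have s2 : s ^+ 2 = 2 * sg ^+ 2 by rewrite exprMn sqr_sqrtr.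
have s0 : s != 0 by rewrite mulf_neq0 // sqrtr_eq0 -ltNge.
have p0 := normal_peak_gt0 s0.
have q0 := normal_peak_gt0 sg0.
pose K := 4 * sg ^+ 2 * normal_peak sg / normal_peak s.
have K0 : 0 <= K.
  by apply: divr_ge0 (ltW p0); apply: mulr_ge0 (ltW q0); apply: mulr_ge0 (ltW sg2).
exists K => A x mA Ax.
have intn t B : t != 0 -> measurable B -> mu.-integrable B (EFin \o normal_pdf 0 t).
  by move=> t0 mB; apply: integrableS (@integrable_normal_pdf R 0 t).
have tailK z : A z -> x ^+ 2 * normal_pdf 0 sg z <= K * normal_pdf 0 s z.
  move=> Az; rewrite !normal_pdfE // /normal_fun s2 !subr0.
  set e1 := expR _; set e2 := expR _.
  have -> : x ^+ 2 * (normal_peak sg * e1) = normal_peak sg * (x ^+ 2 * e1) by ring.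
  have -> : K * (normal_peak s * e2) = normal_peak sg * (4 * sg ^+ 2 * e2).
    by rewrite /K; field; rewrite gt_eqF.
  rewrite {}/e1 {}/e2 ler_wpM2l ?(ltW q0) //.
  have z2 := sqr_ge0 z; have x2 := sqr_ge0 x.
  apply: le_trans (ler_wpM2r (expR_ge0 _) (Ax z Az)) _.
  have t0 : 0 <= z ^+ 2 / (4 * sg ^+ 2) by rewrite divr_ge0 // mulr_ge0 // ltW.
  have h : z ^+ 2 / (4 * sg ^+ 2) * expR (- (z ^+ 2 / (4 * sg ^+ 2))) <= 1 := expR_poly_le 0 t0.
  have -> : - z ^+ 2 / (sg ^+ 2 *+ 2) = - (z ^+ 2 / (4 * sg ^+ 2)) + - (z ^+ 2 / (4 * sg ^+ 2)).
    by field.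
  have -> : - z ^+ 2 / (2 * sg ^+ 2 *+ 2) = - (z ^+ 2 / (4 * sg ^+ 2)) by field.
  rewrite expRD mulrA ler_wpM2r ?expR_ge0 //.
  set e1 := expR _ in h *.
  rewrite [leLHS](_ : _ = 4 * sg ^+ 2 * (z ^+ 2 / (4 * sg ^+ 2) * e1)); last by field.
  by rewrite ler_piMr // mulr_ge0 // ltW.
rewrite -RintegralZl //; last exact: intn.
apply: le_trans (_ : \int[mu]_(z in A) (K * normal_pdf 0 s z) <= _).
  by apply: le_Rintegral => //; apply: integrable_scale => //; exact: intn.
rewrite RintegralZl //; last exact: intn.
rewrite ler_piMr // -lee_fin /Rintegral.
rewrite fineK; last first.
  by apply: integrable_fin_num => //; exact: intn.
rewrite -(integral_normal_pdf 0 s).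
apply: ge0_subset_integral => //=.
  by apply/measurable_EFinP; exact: measurable_normal_pdf.
by move=> z _; rewrite lee_fin normal_pdf_ge0.
Qed.

Lemma Gam_tails : exists K, forall x, 0 < x ->
  Gam (- x) <= K / x ^+ 2 /\ 1 - Gam x <= K / x ^+ 2.
Proof.
have [K] := normal_pdf_tail (oner_neq0 R); rewrite -phi_normal_pdf => hK; exists K => x x0.
have x20 : 0 < x ^+ 2 by rewrite exprn_gt0.
split; rewrite ler_pdivlMr // mulrC.
  apply: hK => // z; rewrite /= in_itv /= => zx.
  by rewrite -[z ^+ 2]sqrrN lerXn2r ?nnegrE ?(ltW x0) //; lra.
rewrite -Rintegral_phi (prim_compl x integrable_phi); apply: hK => // z.
by rewrite /= in_itv /= andbT => zx; rewrite lerXn2r ?nnegrE ?(ltW x0) //; lra.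
Qed.

End Gaussian.

(** * Weighted first-order Taylor expansions and the summed midpoint rule *)

Section FirstOrderExpansions.
Variable R : realType.
Implicit Types (x y z t a : R) (f g w : R -> R).

(** The weight [w] is [rho] for functions with a Gaussian factor, which must be summed over a
    lattice, and 1 for bounded ones. A product of the two kinds is again of the first kind. *)
Definition taylor1 w f f1 := exists2 C : R, 0 <= C & forall z,
  [/\ `|f z| <= C * w z, `|f1 z| <= C * w z &
      forall t, `|t| <= 1 -> `|f (z + t) - f z - t * f1 z| <= C * t ^+ 2 * w z].

Lemma taylor1_C2 K w f f1 f2 : 0 <= K ->
  (forall z, 0 <= w z) -> (forall z t, `|t| <= 1 -> w (z + t) <= 3 * w z) ->
  (forall z, is_derive z 1 f (f1 z)) -> (forall z, is_derive z 1 f1 (f2 z)) ->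
  (forall z, `|f z| <= K * w z) -> (forall z, `|f1 z| <= K * w z) ->
  (forall z, `|f2 z| <= K * w z) ->
  taylor1 w f f1.
Proof.
move=> K0 w0 w3 df df1 fK f1K f2K; exists (3 * K) => [|z]; first exact: mulr_ge0.
have K3 : K * w z <= 3 * K * w z by have := mulr_ge0 K0 (w0 z); lra.
split=> [||t t1]; [exact: le_trans K3|exact: le_trans K3|].
have near x c : Num.min z x <= c <= Num.max z x -> `|c - z| <= `|x - z|.
  case: (leP z x) => zx /andP[h1 h2].
    by rewrite !ger0_norm ?subr_ge0 // lerD2r.
  by rewrite !ler0_norm ?subr_le0 ?(ltW zx) // lerN2 lerD2r.
have [c /near hc E] := MVT_line z (z + t) df.
have [c' /near hc' E'] := MVT_line z c df1.
have zt : z + t - z = t by ring.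
rewrite zt in hc E.
rewrite E (_ : _ - _ = (f1 c - f1 z) * t); last by ring.
rewrite E' !normrM.
have h2 : `|f2 c'| <= 3 * K * w z.
  apply: le_trans (f2K c') _; rewrite [3 * K]mulrC -mulrA ler_wpM2l //.
  have := w3 z (c' - z); rewrite subrKC; apply.
  exact: le_trans hc' (le_trans hc t1).
rewrite -[t ^+ 2]real_normK ?num_real //.
rewrite [leRHS](_ : _ = 3 * K * w z * `|t| * `|t|); last by ring.
by rewrite ler_wpM2r // ler_pM.
Qed.

Lemma taylor1_mul w f f1 g g1 : (forall z, 0 <= w z) ->
  taylor1 w f f1 -> taylor1 (fun=> 1) g g1 ->
  taylor1 w (fun z => f z * g z) (fun z => f1 z * g z + f z * g1 z).
Proof.
move=> w0 [C C0 hf] [D D0 hg]; exists (4 * C * D) => [|z].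
  by rewrite !mulr_ge0.
have [f_le f1_le ft] := hf z; have [g_le g1_le gt] := hg z.
rewrite !mulr1 in g_le g1_le.
have CDw : 0 <= C * D * w z by rewrite !mulr_ge0.
have prod_le (a b : R) : `|a| <= C * w z -> `|b| <= D -> `|a * b| <= C * D * w z.
  by move=> ha hb; rewrite normrM [leRHS]mulrAC ler_pM.
split=> [||t t1].
- by apply: le_trans (prod_le _ _ f_le g_le) _; lra.
- apply: le_trans (ler_normD _ _) _.
  by have := prod_le _ _ f1_le g_le; have := prod_le _ _ f_le g1_le; lra.
have -> : f (z + t) * g (z + t) - f z * g z - t * (f1 z * g z + f z * g1 z) =
    (f (z + t) - f z - t * f1 z) * g (z + t)
    + (f z + t * f1 z) * (g (z + t) - g z - t * g1 z) + t ^+ 2 * (f1 z * g1 z) by ring.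
have t2 : 0 <= t ^+ 2 by exact: sqr_ge0.
have h1 : `|(f (z + t) - f z - t * f1 z) * g (z + t)| <= t ^+ 2 * (C * D * w z).
  have [g_le' _ _] := hg (z + t); rewrite mulr1 in g_le'.
  rewrite normrM (_ : t ^+ 2 * _ = C * t ^+ 2 * w z * D); last by ring.
  by rewrite ler_pM // ft.
have h2 : `|(f z + t * f1 z) * (g (z + t) - g z - t * g1 z)| <= 2 * (t ^+ 2 * (C * D * w z)).
  rewrite normrM (_ : 2 * _ = (C * w z + C * w z) * (D * t ^+ 2 * 1)); last by ring.
  rewrite ler_pM ?gt //; apply: le_trans (ler_normD _ _) _.
  rewrite lerD // normrM -[leRHS]mul1r ler_pM //.
have h3 : `|t ^+ 2 * (f1 z * g1 z)| <= t ^+ 2 * (C * D * w z).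
  by rewrite normrM ger0_norm // ler_wpM2l // prod_le.
apply: le_trans (ler_normD _ _) _; apply: le_trans (lerD (ler_normD _ _) (lexx _)) _.
have -> : 4 * C * D * t ^+ 2 * w z = 4 * (t ^+ 2 * (C * D * w z)) by ring.
lra.
Qed.

Lemma taylor1_exp g g1 d : taylor1 (fun=> 1) g g1 ->
  taylor1 (fun=> 1) (fun z => g z ^+ d) (fun z => d%:R * (g z ^+ d.-1 * g1 z)).
Proof.
move=> hg; elim: d => [|d IHd].
  exists 1 => // z; split=> [||t _]; rewrite ?expr0 ?mul0r ?normr1 ?normr0 ?mulr1 //.
  by rewrite subrr mulr0 subr0 normr0 mul1r sqr_ge0.
have := taylor1_mul (fun=> ler01) hg IHd.
congr taylor1; apply/funext => z; first by rewrite exprS.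
case: d {IHd} => [|d]; first by rewrite /= !expr0; ring.
by rewrite /= -[d.+2%:R]natr1 !exprS; ring.
Qed.

Lemma taylor1_sym w f f1 : taylor1 w f f1 -> exists2 C : R, 0 <= C & forall z t,
  `|t| <= 1 -> `|f (z + t) + f (z - t) - 2 * f z| <= C * w z * t ^+ 2.
Proof.
move=> [C C0 hf]; exists (2 * C) => [|z t t1]; first exact: mulr_ge0.
have [_ _ h] := hf z.
have h1 := h t t1; have h2 := h (- t); rewrite normrN sqrrN in h2.
have -> : f (z + t) + f (z - t) - 2 * f z =
  (f (z + t) - f z - t * f1 z) + (f (z - t) - f z - - t * f1 z) by ring.
apply: le_trans (ler_normD _ _) _.
have -> : 2 * C * w z * t ^+ 2 = C * t ^+ 2 * w z + C * t ^+ 2 * w z by ring.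
by rewrite lerD // h2.
Qed.

(** The sum of n signs with l of them positive, scaled by sqrt(s), sits at [center]; its cell runs
    from [node l] to [node l.+1] and has width 2/sqrt(s). The scale is separate from n because 2k +
    r coins will be measured at scale 2k. *)
Definition node (n s l : nat) : R := (2 * l%:R - n%:R - 1) / Num.sqrt s%:R.
Definition center (n s l : nat) : R := (2 * l%:R - n%:R) / Num.sqrt s%:R.

(** A cell costs s^(-3/2) times [rho] at its centre, and by [sum_rho] these weights add up to order
    sqrt(s) instead of n. *)
Lemma midpoint_sum (A G G1 : R -> R) : taylor1 (@rho R) G G1 ->
  (forall x, is_derive x 1 A (G x)) ->
  exists K, forall n s : nat, (0 < s)%N ->
  \sum_(l < n.+1) `|A (node n s l.+1) - A (node n s l)
     - 2 / Num.sqrt s%:R * G (center n s l)| <= K / s%:R.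
Proof.
move=> /taylor1_sym[C C0 hG] dA; have [K hK] := sum_rho R.
exists (C * K) => n s s0; set S : R := Num.sqrt s%:R.
have S1 : 1 <= S by rewrite -[leLHS]sqrtr1 ler_sqrt // ler1n.
have S0 : 0 < S by apply: lt_le_trans S1.
have S2 : S ^+ 2 = s%:R by rewrite sqr_sqrtr.
apply: le_trans (_ : \sum_(l < n.+1) C * rho (center n s l) * S^-1 ^+ 3 <= _).
  apply: ler_sum => l _.
  have -> : node n s l.+1 = center n s l + S^-1.
    by rewrite /node /center -[l.+1%:R]natr1 -/S; ring.
  have -> : node n s l = center n s l - S^-1 by rewrite /node /center -/S; ring.
  apply: midpoint_cell => //; last by move=> t t1; exact: hG.
  by rewrite invr_ge0 (ltW S0) invf_le1.
rewrite -mulr_suml -mulr_sumr -S2.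
rewrite [leRHS](_ : _ = C * (K * S) * S^-1 ^+ 3); last by field; rewrite gt_eqF.
by rewrite ler_wpM2r ?exprn_ge0 ?invr_ge0 ?(ltW S0) // ler_wpM2l // hK.
Qed.

Lemma rho_shift3 z t : `|t| <= 1 -> rho (z + t) <= 3 * rho z.
Proof.
by move=> t1; have := @rho_shift R (z + t) (- t); rewrite normrN addrK; apply.
Qed.

Lemma phi_rho z : phi z <= 13 * rho z.
Proof.
by apply: le_trans (phi_poly_le z); rewrite ler_peMr ?(ltW (phi_gt0 z)) // lerDl sqr_ge0.
Qed.

Lemma taylor1_phi : taylor1 (@rho R) (@phi R) (fun z => - z * phi z).
Proof.
have p0 z : 0 <= phi z :> R by rewrite ltW // phi_gt0.
have bound (c z : R) : `|c| <= 1 + z ^+ 2 -> `|c * phi z| <= 13 * rho z.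
  move=> h; rewrite normrM (ger0_norm (p0 z)) mulrC.
  by apply: le_trans (phi_poly_le z); rewrite ler_wpM2l.
apply: (@taylor1_C2 13 (@rho R) (@phi R) (fun z => - z * phi z)
  (fun z => (z ^+ 2 - 1) * phi z)) => [|z||||z|z|z].
- by [].
- by rewrite ltW // rho_gt0.
- exact: rho_shift3.
- exact: is_derive_phi.
- move=> z; have := is_derive_phi z => d1.
  have -> : (fun z : R => - z * phi z) = (- (id : R -> R)) * (@phi R) by [].
  by apply: is_derive_eq; rewrite /GRing.scale /= !fctE /=; ring.
- by rewrite -[phi z]mul1r bound // normr1 lerDl sqr_ge0.
- rewrite bound // normrN; have := sqr_ge0 (`|z| - 1).
  rewrite -[z ^+ 2]real_normK ?num_real //.
  have := sqr_ge0 `|z|; rewrite sqrrB1; lra.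
- by rewrite bound // ler_norml; have := sqr_ge0 z; move=> ?; apply/andP; split; lra.
Qed.

Lemma is_derive_Gam z : is_derive z 1 (@Gam R) (phi z).
Proof. exact: is_derive_prim (@continuous_phi R) (integrable_phi R). Qed.

(** [Psi] and [psi] are the distribution function and density of variance 2, the variance of the 2k
    independent votes at the scale sqrt(k) of the k common ones. *)
Definition Psi z : R := Gam (z / Num.sqrt 2).
Definition psi z : R := phi (z / Num.sqrt 2) / Num.sqrt 2.

Lemma is_derive_Psi z : is_derive z 1 Psi (psi z).
Proof.
have := @is_derive_comp_affine R _ (Num.sqrt 2)^-1 0 z _ (is_derive_Gam _).
rewrite addr0 mulrC [_^-1 * z]mulrC -/(psi z); congr is_derive.
by apply/funext => y; rewrite addr0 mulrC.
Qed.

Lemma Psi_ge0_le1 z : 0 <= Psi z <= 1.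
Proof. by rewrite Gam_ge0 Gam_le1. Qed.

Lemma taylor1_Psi : taylor1 (fun=> 1) Psi psi.
Proof.
set a : R := (Num.sqrt 2)^-1.
have a01 : 0 <= a <= 1.
  rewrite invr_ge0 sqrtr_ge0 invf_le1 ?sqrtr_gt0 //.
  by rewrite -[leLHS]sqrtr1 ler_sqrt //; lra.
have [a0 a1] := andP a01.
have [C C0 hphi] := taylor1_phi.
apply: (@taylor1_C2 (1 + C) (fun=> 1) Psi psi
  (fun z => a ^+ 2 * (- (z * a) * phi (z * a)))) => [|z|z t _|z|z|z|z|z].
- by rewrite addr_ge0.
- exact: ler01.
- lra.
- exact: is_derive_Psi.
- have := @is_derive_comp_affine R _ a 0 z _ (is_derive_phi _).
  rewrite addr0 => h.
  have d1 : is_derive z 1 (a \*: (fun y => phi (a * y + 0))) (a *: (a * (- (a * z) * phi (a * z)))).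
    exact: is_deriveZ.
  have -> : psi = a \*: (fun y : R => phi (a * y + 0)).
    by apply/funext => y; rewrite /psi /= addr0 mulrC [a * y]mulrC.
  by move: d1; congr is_derive; rewrite /GRing.scale /= [z * a]mulrC; ring.
- have /andP[h0 h1] := Psi_ge0_le1 z.
  by rewrite ger0_norm // mulr1 (le_trans h1) // lerDl.
- have [h1 _ _] := hphi (z * a).
  rewrite mulr1 /psi normrM -/a (ger0_norm a0) -[leRHS]mulr1 ler_pM //.
  apply: le_trans h1 _; have := rho_le1 (z * a); have := ler_wpM2l C0 (rho_le1 (z * a)); lra.
- have [_ h1 _] := hphi (z * a).
  rewrite mulr1 normrM ger0_norm ?sqr_ge0 // -[leRHS]mul1r ler_pM ?sqr_ge0 //.
    by rewrite exprn_ile1.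
  apply: le_trans h1 _; have := ler_wpM2l C0 (rho_le1 (z * a)); lra.
Qed.

End FirstOrderExpansions.

(** * Local limit theorem for the fair binomial law, up to normalization *)

Section BinomialLocalLimit.
Variable R : realType.

Definition deviation (n l : nat) : R := 2 * l%:R - n%:R.

Lemma deviationS n l : deviation n l.+1 = deviation n l + 2.
Proof. by rewrite /deviation -[l.+1%:R]natr1; ring. Qed.

Lemma deviation_sub n l : (l <= n)%N -> deviation n (n - l) = - deviation n l.
Proof. by move=> ln; rewrite /deviation natrB //; ring. Qed.

(** The binomial weight divided by its Gaussian profile. With n + 1 in place of n in the variance,
    the ratio of consecutive values is exactly (1-v)/(1+v) exp(2v), with v as in [q_step]. *)
Let q n l : R := binp R n l * expR (deviation n l ^+ 2 / (2 * n.+1%:R)).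

Let n1_gt0 n : 0 < n.+1%:R :> R.
Proof. by rewrite ltr0n. Qed.

Let q_step n l : (l < n)%N -> let v := (deviation n l + 1) / n.+1%:R in
  q n l.+1 * (1 + v) = q n l * ((1 - v) * expR (2 * v)).
Proof.
move=> ln v; rewrite /q deviationS.
have n1 := n1_gt0 n.
have n10 : n.+1%:R != 0 :> R by rewrite gt_eqF.
have -> : (deviation n l + 2) ^+ 2 / (2 * n.+1%:R) =
    deviation n l ^+ 2 / (2 * n.+1%:R) + 2 * v by rewrite /v; field.
rewrite expRD [_ * expR _ in RHS]mulrC -!mulrA mulrCA [RHS]mulrCA.
have -> : 1 + v = 2 * l.+1%:R / n.+1%:R.
  by rewrite /v /deviation -[n.+1%:R]natr1 -[l.+1%:R]natr1; field; rewrite natr1.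
have -> : 1 - v = 2 * (n - l)%:R / n.+1%:R.
  by rewrite /v /deviation natrB 1?ltnW // -[n.+1%:R]natr1; field; rewrite natr1.
have E : l.+1%:R * 'C(n, l.+1)%:R = (n - l)%:R * 'C(n, l)%:R :> R.
  by rewrite -!natrM mul_bin_left.
rewrite /binp; set e1 := expR _; set e2 := expR _.
transitivity (l.+1%:R * 'C(n, l.+1)%:R * (2 * e1 * e2 / n.+1%:R / 2 ^+ n)); first by ring.
rewrite E; ring.
Qed.

Let q_ge0 n l : 0 <= q n l.
Proof. by rewrite mulr_ge0 ?expR_ge0 // divr_ge0. Qed.

(** Moving outwards from the middle, each step multiplies [q] by a factor between 1 - v^3 and 1. All
    the v so far are at most the final deviation over n + 1, so j steps lose at most j times its
    cube. *)
Let q_bounds n j : (uphalf n + j <= n)%N ->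
  q n (uphalf n) * (1 - j%:R * (deviation n (uphalf n + j) / n.+1%:R) ^+ 3)
    <= q n (uphalf n + j) <= q n (uphalf n).
Proof.
set l0 := uphalf n.
have dev0 : 0 <= deviation n l0.
  by rewrite /deviation -natrM subr_ge0 ler_nat /l0; clear; lia.
elim: j => [|j IHj] ljn; first by rewrite addn0 mul0r subr0 mulr1 lexx.
rewrite addnS; have := IHj _; rewrite addnS in ljn; move/(_ (ltnW ljn)).
set l := (l0 + j)%N in ljn *; move=> /andP[lo up].
have devl : 0 <= deviation n l.
  by apply: le_trans dev0 _; rewrite /deviation lerD2r ler_wpM2l // ler_nat leq_addr.
have devn : deviation n l + 1 <= n.+1%:R.
  rewrite -subr_ge0 /deviation -[n.+1%:R]natr1.
  have : l.+1%:R <= n%:R :> R by rewrite ler_nat.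
  by rewrite -natr1; lra.
have n1 := n1_gt0 n.
have := q_step ljn; set v := (_ / _) => /= E.
have v0 : 0 <= v by apply: divr_ge0; [exact: addr_ge0|exact: ltW].
have v1 : v <= 1 by rewrite ler_pdivrMr // mul1r.
have v1p : 0 < 1 + v by rewrite ltr_pwDl.
have q0 := q_ge0 n l; have q00 := q_ge0 n l0.
apply/andP; split; rewrite -(ler_pM2r v1p) E; last first.
  have := binomial_ratio_le1 v0 => h.
  by rewrite ler_pM // ?mulr_ge0 ?expR_ge0 // subr_ge0.
have v01 : 0 <= v <= 1 by rewrite v0.
apply: le_trans (ler_wpM2l q0 (binomial_ratio_ge v01)).
rewrite [leRHS]mulrA ler_wpM2r ?(ltW v1p) //.
set w := deviation n l.+1 / n.+1%:R.
have vw : v <= w by rewrite ler_pM2r ?invr_gt0 // deviationS lerD2l ler1n.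
have uw : deviation n l / n.+1%:R <= w by rewrite ler_pM2r ?invr_gt0 // deviationS lerDl.
have u0 : 0 <= deviation n l / n.+1%:R by rewrite divr_ge0.
set u := deviation n l / n.+1%:R in lo uw u0 *.
have h1 : u ^+ 3 <= w ^+ 3 by rewrite lerXn2r ?nnegrE // (le_trans u0).
have h2 : v ^+ 3 <= w ^+ 3 by rewrite lerXn2r ?nnegrE // (le_trans v0).
have h3 : q n l0 * (j%:R * u ^+ 3) <= q n l0 * (j%:R * w ^+ 3).
  by rewrite ler_wpM2l // ler_wpM2l.
have h4 : q n l * v ^+ 3 <= q n l0 * w ^+ 3 by rewrite ler_pM ?exprn_ge0.
rewrite -[j.+1%:R]natr1.
have -> : q n l0 * (1 - (j%:R + 1) * w ^+ 3) =
  q n l0 - q n l0 * (j%:R * w ^+ 3) - q n l0 * w ^+ 3 by ring.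
have -> : q n l * (1 - v ^+ 3) = q n l - q n l * v ^+ 3 by ring.
have {}lo : q n l0 - q n l0 * (j%:R * u ^+ 3) <= q n l by rewrite -[X in X - _]mulr1 -mulrBr.
lra.
Qed.

(** The witness [kap] is the value of [q] at the middle; nothing is claimed about its size, which
    [binp_cells] determines from the total mass. *)
Lemma binp_envelope n : exists2 kap : R, 0 <= kap & forall l, (l <= n)%N ->
  let e := expR (- (deviation n l ^+ 2 / (2 * n.+1%:R))) in
  `|binp R n l - kap * e| <= kap * e * (deviation n l ^+ 4 / n.+1%:R ^+ 3).
Proof.
exists (q n (uphalf n)); first exact: q_ge0.
have n1 := n1_gt0 n.
move=> l ln /=; wlog le_l : l ln / (uphalf n <= l)%N.
  move=> h; have [/h ->//|lt_l] := leqP (uphalf n) l.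
  have := h (n - l)%N (leq_subr _ _) _.
  rewrite deviation_sub // binp_sub // sqrrN.
  rewrite (_ : (- deviation n l) ^+ 4 = deviation n l ^+ 4); last by ring.
  by apply; move: lt_l ln; clear; lia.
set e := expR _.
have := @q_bounds n (l - uphalf n); rewrite subnKC // => /(_ ln) /andP[lo up].
set kap := q n (uphalf n) in lo up *.
have e0 : 0 < e by exact: expR_gt0.
have qE : q n l = binp R n l / e by rewrite /q -expRN opprK.
rewrite qE in lo up.
have {}up : binp R n l <= kap * e by rewrite -ler_pdivrMr.
rewrite ler_pdivlMr // in lo.
have k0 : 0 <= kap by exact: q_ge0.
have jd : (l - uphalf n)%:R <= deviation n l.
  rewrite natrB // /deviation -subr_ge0.
  have h1 : n%:R <= 2 * (uphalf n)%:R :> R by rewrite -natrM ler_nat; clear; lia.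
  have h2 : (uphalf n)%:R <= l%:R :> R by rewrite ler_nat.
  lra.
have d0 : 0 <= deviation n l by apply: le_trans jd.
have h : (l - uphalf n)%:R * (deviation n l / n.+1%:R) ^+ 3 <= deviation n l ^+ 4 / n.+1%:R ^+ 3.
  rewrite expr_div_n [_ ^+ 4]exprS -[leRHS]mulrA ler_wpM2r //.
  by rewrite divr_ge0 ?exprn_ge0.
rewrite ler0_norm ?subr_le0 // opprB.
have ke : 0 <= kap * e by rewrite mulr_ge0 // ltW.
have := ler_wpM2l ke h.
move: lo; rewrite mulrBr mulr1 mulrBl [kap * _ * e]mulrAC.
by move=> h1 h2; apply: le_trans h2; rewrite lerBlDr addrC -lerBlDr.
Qed.

(** Brings the quartic relative error under the summable weight [rho]. The moments 1, 2, 6 of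
    [expR_poly_le] give 704 * 2 + 24 + 4096 * 6 = 26008, below 200^2. *)
Let gauss_quartic (z : R) :
  expR (- (z ^+ 2 / 8)) * (8 * z ^+ 4 + 3 * z ^+ 2) <= 200 ^+ 2 * rho z.
Proof.
have h0 : 0 < 1 + z ^+ 2 by rewrite ltr_pwDl ?sqr_ge0.
have t0 : 0 <= z ^+ 2 / 8 by rewrite divr_ge0 ?sqr_ge0.
have h1 : z ^+ 2 / 8 * expR (- (z ^+ 2 / 8)) <= 1 := expR_poly_le 0 t0.
have h2 : (z ^+ 2 / 8) ^+ 2 * expR (- (z ^+ 2 / 8)) <= 2 := expR_poly_le 1 t0.
have h3 : (z ^+ 2 / 8) ^+ 3 * expR (- (z ^+ 2 / 8)) <= 6 := expR_poly_le 2 t0.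
rewrite /rho ler_pdivlMr // (_ : z ^+ 4 = (z ^+ 2) ^+ 2); last by rewrite -exprM.
move: h1 h2 h3; set e := expR _; set t := z ^+ 2 / 8.
have -> : z ^+ 2 = 8 * t by rewrite /t; field.
have -> : e * (8 * (8 * t) ^+ 2 + 3 * (8 * t)) * (1 + 8 * t) =
  704 * (t ^+ 2 * e) + 24 * (t * e) + 4096 * (t ^+ 3 * e) by ring.
lra.
Qed.

(** Passing from variance n + 1 to s changes the exponent by at most 3 z^2 / s. Both exponents are
    at least z^2 / 8, since n + 1 <= 4 s, so the Lipschitz bound of the exponential applies. *)
Lemma binp_phi : exists2 K : R, 0 <= K & forall n s,
  (0 < s)%N -> (n <= s + 2)%N -> (s <= n + 2)%N ->
  exists2 kap : R, 0 <= kap & forall l, (l <= n)%N ->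
  `|binp R n l - kap * phi (center R n s l)| <= kap * (K / s%:R * rho (center R n s l)).
Proof.
exists (200 ^+ 2) => [|n s s0 ns sn]; first exact: exprn_ge0.
have [kap kap0 hk] := binp_envelope n.
have sq1 : 1 <= Num.sqrt (2 * pi) :> R.
  by rewrite -[leLHS]sqrtr1 ler_sqrt ?mulr_ge0 ?pi_ge0 //; have := pi_ge2 R; lra.
have sq0 : 0 < Num.sqrt (2 * pi) :> R by apply: lt_le_trans sq1.
exists (kap * Num.sqrt (2 * pi)) => [|l ln]; first by rewrite mulr_ge0 // ltW.
set z := center R n s l.
have s0' : 0 < s%:R :> R by rewrite ltr0n.
have n1 := n1_gt0 n.
have devE : deviation n l = z * Num.sqrt s%:R.
  by rewrite /z /center divfK // gt_eqF // sqrtr_gt0.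
have dev2 : deviation n l ^+ 2 = z ^+ 2 * s%:R by rewrite devE exprMn sqr_sqrtr.
have dev4 : deviation n l ^+ 4 = z ^+ 4 * s%:R ^+ 2.
  rewrite devE exprMn; congr (_ * _).
  transitivity ((Num.sqrt s%:R ^+ 2) ^+ 2 : R); first by rewrite -exprM.
  by rewrite sqr_sqrtr.
have := hk l ln; rewrite /= dev2 dev4; set a := z ^+ 2 * s%:R / _ => {}hk.
rewrite /phi [kap * _ * _]mulrA mulrAC mulfK ?gt_eqF //.
have z2 := sqr_ge0 z.
have z4 : 0 <= z ^+ 4 by rewrite exprn_even_ge0.
have r1 : n.+1%:R <= 4 * s%:R :> R by rewrite -natrM ler_nat; move: s0 ns; clear; lia.
have r2 : s%:R <= 2 * n.+1%:R :> R by rewrite -natrM ler_nat; move: sn; clear; lia.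
have ma : z ^+ 2 / 8 <= a.
  rewrite /a ler_pdivlMr ?mulr_gt0 //.
  have := ler_wpM2l z2 r1; lra.
have mb : z ^+ 2 / 8 <= z ^+ 2 / 2 by lra.
have ab : `|a - z ^+ 2 / 2| <= 3 * z ^+ 2 / s%:R.
  have -> : a - z ^+ 2 / 2 = z ^+ 2 / (2 * n.+1%:R) * (s%:R - n.+1%:R).
    by rewrite /a; field; rewrite addrC natr1 gt_eqF.
  rewrite normrM ger0_norm; last by rewrite divr_ge0 // mulr_ge0 // ltW.
  have h3 : `|s%:R - n.+1%:R| <= 3 :> R.
    have h4 : n.+1%:R <= s%:R + 3 :> R by rewrite -natrD ler_nat; move: ns; clear; lia.
    have h5 : s%:R <= n.+1%:R + 3 :> R by rewrite -natrD ler_nat; move: sn; clear; lia.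
    by rewrite ler_norml; apply/andP; split; lra.
  apply: le_trans (ler_wpM2l _ h3) _; first by rewrite divr_ge0 // mulr_ge0 // ltW.
  rewrite [leRHS](_ : _ = z ^+ 2 / s%:R * 3); last by ring.
  by rewrite ler_wpM2r // ler_wpM2l // lef_pV2 ?posrE ?mulr_gt0.
have := expRN_lip ma mb => lip.
have q4 : z ^+ 4 * s%:R ^+ 2 / n.+1%:R ^+ 3 <= 8 * z ^+ 4 / s%:R.
  rewrite ler_pdivrMr ?exprn_gt0 // [leRHS]mulrAC ler_pdivlMr //.
  rewrite (_ : _ * s%:R = z ^+ 4 * s%:R ^+ 3); last by ring.
  rewrite (_ : 8 * z ^+ 4 * _ = z ^+ 4 * (2 * n.+1%:R) ^+ 3); last by ring.
  by rewrite ler_wpM2l // lerXn2r ?nnegrE ?mulr_ge0 // ltW.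
have ea : expR (- a) <= expR (- (z ^+ 2 / 8)) by rewrite ler_expR lerN2.
set e8 := expR (- (z ^+ 2 / 8)) in lip ea.
have e80 : 0 <= e8 by exact: expR_ge0.
have total : `|binp R n l - kap * expR (- (z ^+ 2 / 2))| <=
   kap * (e8 * (8 * z ^+ 4 + 3 * z ^+ 2) / s%:R).
  rewrite -(subrK (kap * expR (- a)) (binp R n l)) -addrA -mulrBr.
  apply: le_trans (ler_normD _ _) _.
  rewrite [leRHS](_ : _ = kap * (e8 * (8 * z ^+ 4 / s%:R)) + kap * (3 * z ^+ 2 / s%:R * e8));
    last by ring.
  rewrite lerD //.
    apply: le_trans hk _; rewrite -mulrA ler_wpM2l //.
    by rewrite ler_pM ?expR_ge0 // divr_ge0 ?exprn_ge0 ?(ltW n1) // mulr_ge0 // exprn_ge0.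
  rewrite normrM (ger0_norm kap0) ler_wpM2l //; apply: le_trans lip _.
  by rewrite ler_wpM2r.
apply: le_trans total _; rewrite -[kap * Num.sqrt _ * _]mulrA ler_wpM2l //.
have gq := gauss_quartic z.
have r0 := rho_gt0 z.
apply: le_trans (_ : 200 ^+ 2 / s%:R * rho z <= _).
  by rewrite [leRHS]mulrAC ler_wpM2r ?invr_ge0 ?(ltW s0').
by rewrite ler_peMl // mulr_ge0 ?(ltW r0) // divr_ge0 // ltW.
Qed.

End BinomialLocalLimit.

(** * Binomial atoms against Gaussian cells *)

Section BinomialCells.
Variable R : realType.

Lemma sum_binp n : \sum_(l < n.+1) binp R n l = 1.
Proof.
rewrite /binp -mulr_suml -natr_sum.
have -> : (\sum_(l < n.+1) 'C(n, l) = 2 ^ n)%N.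
  by rewrite -[2%N]/(1 + 1)%N expnDn; apply: eq_bigr => i _; rewrite !exp1n !muln1.
by rewrite natrX mulfV // expf_neq0 // pnatr_eq0.
Qed.

Lemma binp_ge0 n l : 0 <= binp R n l.
Proof. by rewrite divr_ge0 // exprn_ge0. Qed.

Lemma Gam_le (x y : R) : x <= y -> Gam x <= Gam y.
Proof.
move=> xy; have [c _ E] := MVT_line x y (@is_derive_Gam R).
by rewrite -subr_ge0 E mulr_ge0 ?(ltW (phi_gt0 _)) // subr_ge0.
Qed.

Lemma node_le n s l : node R n s l <= node R n s l.+1.
Proof.
by rewrite ler_wpM2r ?invr_ge0 ?sqrtr_ge0 // !lerD2r ler_wpM2l // ler_nat.
Qed.

Lemma sum_node (A : R -> R) n s L :
  \sum_(l < L) (A (node R n s l.+1) - A (node R n s l)) = A (node R n s L) - A (node R n s 0).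
Proof.
by rewrite -(big_mkord xpredT (fun l => A (node R n s l.+1) - A (node R n s l))) telescope_sumr.
Qed.

Lemma node0 n s : node R n s 0 = - (n.+1%:R / Num.sqrt s%:R).
Proof. by rewrite /node -[n.+1%:R]natr1; ring. Qed.

Lemma node_last n s : node R n s n.+1 = n.+1%:R / Num.sqrt s%:R.
Proof. by rewrite /node -[n.+1%:R]natr1; ring. Qed.

Lemma node_tails : exists2 K : R, 0 <= K & forall n s, (0 < s)%N -> (s <= n + 2)%N ->
  Gam (node R n s 0) <= K / s%:R /\ 1 - Gam (node R n s n.+1) <= K / s%:R.
Proof.
have [K hK] := Gam_tails R.
have K0 : 0 <= K.
  have [h _] := hK 1 ltr01; rewrite expr1n divr1 in h.
  exact: le_trans (Gam_ge0 _) h.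
exists (4 * K) => [|n s s0 sn]; first exact: mulr_ge0.
have s0' : 0 < s%:R :> R by rewrite ltr0n.
have n1 : 0 < n.+1%:R :> R by rewrite ltr0n.
rewrite node0 node_last; set x := _ / _.
have x0 : 0 < x by rewrite divr_gt0 // sqrtr_gt0.
have le_x : K / x ^+ 2 <= 4 * K / s%:R.
  rewrite /x expr_div_n sqr_sqrtr // invf_div mulrA.
  rewrite ler_pdivrMr ?exprn_gt0 // mulrAC ler_pdivlMr //.
  rewrite [leLHS](_ : _ = K * s%:R ^+ 2); last by ring.
  rewrite [leRHS](_ : _ = K * (2 * n.+1%:R) ^+ 2); last by ring.
  rewrite ler_wpM2l // lerXn2r ?nnegrE ?mulr_ge0 //.
  by rewrite -natrM ler_nat; move: sn; clear; lia.
by have [h1 h2] := hK x x0; split; exact: le_trans le_x.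
Qed.

(** The atoms have mass 1, and the midpoint sum of [phi] has mass 1 + O(1/s). Comparing them forces
    [kap] to be 2/sqrt(s) up to a factor 1 + O(1/s), which removes the unknown height. *)
Lemma binp_cells : exists2 K : R, 0 <= K & forall n s,
  (0 < s)%N -> (n <= s + 2)%N -> (s <= n + 2)%N ->
  \sum_(l < n.+1) `|binp R n l - (Gam (node R n s l.+1) - Gam (node R n s l))| <= K / s%:R.
Proof.
have [Kb Kb0 hb] := binp_phi R; have [Kr hr] := sum_rho R.
have [K1 h1] := midpoint_sum (taylor1_phi R) (@is_derive_Gam R).
have [K2 K20 h2] := node_tails.
have Kr0 : 0 <= Kr.
  have := hr 0%N 1%N isT; rewrite sqrtr1 mulr1; apply: le_trans.
  by apply: sumr_ge0 => l _; rewrite ltW ?rho_gt0.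
have K10 : 0 <= K1.
  by have := h1 0%N 1%N isT; rewrite divr1; apply: le_trans; exact: sumr_ge0.
pose K3 := K1 + 2 * K2; pose K4 := 2 * (Kb * Kr); pose K5 := K3 + K4.
have K30 : 0 <= K3 by rewrite addr_ge0 // mulr_ge0.
have K40 : 0 <= K4 by rewrite !mulr_ge0.
have K50 : 0 <= K5 by rewrite addr_ge0.
exists (2 * K4 + 2 * K5 * (1 + K3) + K1 + 4 * K5) => [|n s s0 ns sn].
  by rewrite !addr_ge0 // !mulr_ge0 // addr_ge0.
have s0' : 0 < s%:R :> R by rewrite ltr0n.
have s1 : 1 <= s%:R :> R by rewrite ler1n.
set S : R := Num.sqrt s%:R.
have S0 : 0 < S by rewrite sqrtr_gt0.
have S2 : S ^+ 2 = s%:R by rewrite sqr_sqrtr // ltW.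
pose cell l : R := Gam (node R n s l.+1) - Gam (node R n s l).
have cell0 l : 0 <= cell l by rewrite subr_ge0 Gam_le // node_le.
have sum_cell : \sum_(l < n.+1) cell l <= 1.
  rewrite sum_node; have := Gam_ge0 (node R n s 0); have := Gam_le1 (node R n s n.+1); lra.
have Ks (K : R) : 0 <= K -> K / s%:R <= K.
  by move=> K0; rewrite ler_pdivrMr // ler_peMr.
(* For small s the sum is at most 2, the two total masses, and the summand [4 * K5] of the constant
   covers it. For large s, K5/s <= 1/2 will bound [kk] by 2. *)
have [small|large] := ltP s%:R (2 * K5).
  apply: le_trans (_ : 2 <= _).
    apply: le_trans (_ : \sum_(l < n.+1) (binp R n l + cell l) <= _).
      apply: ler_sum => l _; apply: le_trans (ler_normB _ _) _.
      by rewrite !ger0_norm ?binp_ge0 // cell0.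
    by rewrite big_split /= sum_binp; lra.
  rewrite ler_pdivlMr //; have := mulr_ge0 K50 K30; lra.
have [kap kap0 hk] := hb n s s0 ns sn.
(* The ratio of the unknown height to the midpoint weight 2/S, to be shown close to 1. *)
pose kk := kap * S / 2.
have kk0 : 0 <= kk by rewrite divr_ge0 // mulr_ge0 // ltW.
have kapE : kap = kk * (2 / S) by rewrite /kk; field; rewrite gt_eqF.
have E1 : \sum_(l < n.+1) `|binp R n l - kap * phi (center R n s l)| <= kk * (K4 / s%:R).
  apply: le_trans (_ : \sum_(l < n.+1) kap * (Kb / s%:R * rho (center R n s l)) <= _).
    by apply: ler_sum => l _; apply: hk; rewrite -ltnS.
  rewrite -!mulr_sumr; apply: le_trans (_ : kap * (Kb / s%:R * (Kr * S)) <= _).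
    by rewrite ler_wpM2l // ler_wpM2l ?divr_ge0 ?(ltW s0') // hr.
  rewrite kapE /K4 le_eqVlt; apply/orP; left; apply/eqP.
  by field; rewrite !gt_eqF.
pose T := \sum_(l < n.+1) 2 / S * phi (center R n s l).
have E2 : \sum_(l < n.+1) `|cell l - 2 / S * phi (center R n s l)| <= K1 / s%:R by exact: h1.
have T0 : 0 <= T.
  by apply: sumr_ge0 => l _; rewrite mulr_ge0 ?divr_ge0 ?(ltW S0) ?(ltW (phi_gt0 _)).
have T1 : `|1 - T| <= K3 / s%:R.
  have -> : 1 - T = Gam (node R n s 0) + (1 - Gam (node R n s n.+1))
      + \sum_(l < n.+1) (cell l - 2 / S * phi (center R n s l)).
    by rewrite sumrB sum_node -/T; ring.
  have [t1 t2] := h2 n s s0 sn.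
  apply: le_trans (ler_normD _ _) _.
  have -> : K3 / s%:R = K2 / s%:R + K2 / s%:R + K1 / s%:R by rewrite /K3; ring.
  rewrite lerD //; last by apply: le_trans (ler_norm_sum _ _ _) _.
  rewrite ger0_norm ?lerD // addr_ge0 ?Gam_ge0 // subr_ge0; exact: Gam_le1.
have kT : `|1 - kk * T| <= kk * (K4 / s%:R).
  apply: le_trans _ E1; rewrite -(sum_binp n) mulr_sumr -sumrB.
  apply: le_trans (ler_norm_sum _ _ _) _; apply: ler_sum => l _.
  by rewrite kapE mulrA.
have k1 : `|1 - kk| <= kk * (K5 / s%:R).
  have -> : 1 - kk = (1 - kk * T) - kk * (1 - T) by ring.
  apply: le_trans (ler_normB _ _) _.
  have -> : kk * (K5 / s%:R) = kk * (K4 / s%:R) + kk * (K3 / s%:R) by rewrite /K5; ring.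
  by rewrite lerD // normrM (ger0_norm kk0) ler_wpM2l.
have K5s : K5 / s%:R <= 2^-1 by rewrite ler_pdivrMr // mulrC; lra.
have kk2 : kk <= 2.
  have := ler_wpM2l kk0 K5s; move: k1; rewrite ler_norml => /andP[k1 _].
  lra.
have {}k1 : `|1 - kk| <= 2 * (K5 / s%:R).
  by apply: le_trans k1 _; rewrite ler_wpM2r // divr_ge0 // ltW.
have T3 : T <= 1 + K3.
  by move: T1; rewrite ler_norml => /andP[T1 _]; have := Ks K3 K30; lra.
apply: le_trans (_ : \sum_(l < n.+1) (`|binp R n l - kap * phi (center R n s l)|
    + `|1 - kk| * (2 / S * phi (center R n s l))
    + `|cell l - 2 / S * phi (center R n s l)|) <= _).
  apply: ler_sum => l _.
  have p0 : 0 <= 2 / S * phi (center R n s l).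
    by rewrite mulr_ge0 ?divr_ge0 ?(ltW S0) ?(ltW (phi_gt0 _)).
  rewrite -[`|1 - kk| * _](_ : `|(1 - kk) * (2 / S * phi (center R n s l))| = _);
    last by rewrite normrM (ger0_norm p0).
  rewrite (_ : binp R n l - _ = (binp R n l - kap * phi (center R n s l))
    - (1 - kk) * (2 / S * phi (center R n s l)) - (cell l - 2 / S * phi (center R n s l)));
    last by rewrite kapE /cell; ring.
  by apply: le_trans (ler_normB _ _) _; rewrite lerD2r ler_normB.
rewrite !big_split /= -mulr_sumr -/T.
have e1 : kk * (K4 / s%:R) <= 2 * (K4 / s%:R) by rewrite ler_wpM2r // divr_ge0 // ltW.
have e2 : `|1 - kk| * T <= 2 * (K5 / s%:R) * (1 + K3) by rewrite ler_pM.
have e3 : 0 <= 4 * K5 / s%:R by rewrite divr_ge0 ?(ltW s0') // mulr_ge0.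
rewrite [leRHS](_ : _ = 2 * (K4 / s%:R) + 2 * (K5 / s%:R) * (1 + K3) + K1 / s%:R + 4 * K5 / s%:R);
  last by ring.
lra.
Qed.

(** [binp_cdf] sums the atoms strictly below [L], whose cells end at [node L], halfway between two
    atoms. This continuity correction makes the error O(1/s) instead of O(1/sqrt(s)). *)
Lemma binp_cdf_Gam : exists2 K : R, 0 <= K & forall n s L,
  (0 < s)%N -> (n <= s + 2)%N -> (s <= n + 2)%N -> (L <= n.+1)%N ->
  `|binp_cdf R n L - Gam (node R n s L)| <= K / s%:R.
Proof.
have [K K0 hK] := binp_cells; have [K' K'0 hK'] := node_tails.
exists (K + K') => [|n s L s0 ns sn Ln]; first exact: addr_ge0.
have [t _] := hK' n s s0 sn.
have -> : binp_cdf R n L - Gam (node R n s L) =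
    \sum_(l < L) (binp R n l - (Gam (node R n s l.+1) - Gam (node R n s l)))
    - Gam (node R n s 0).
  by rewrite sumrB sum_node /binp_cdf; ring.
apply: le_trans (ler_normB _ _) _; rewrite mulrDl lerD //; last first.
  by rewrite ger0_norm // Gam_ge0.
apply: le_trans (ler_norm_sum _ _ _) _; apply: le_trans (hK n s s0 ns sn).
rewrite (big_ord_widen n.+1
  (fun l => `|binp R n l - (Gam (node R n s l.+1) - Gam (node R n s l))|)) //.
by rewrite big_mkcond /=; apply: ler_sum => l _; case: ifP.
Qed.

End BinomialCells.

(** * Binomial averages of smooth functions as Gaussian integrals *)

Section DiscreteToIntegral.
Variable R : realType.
Local Notation mu := (@lebesgue_measure R).
Implicit Types (f g : R -> R) (x z a t : R).

Lemma continuous_is_derive f f' : (forall z, is_derive z 1 f (f' z)) -> continuous f.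
Proof.
move=> df z; apply: differentiable_continuous; apply/derivable1_diffP; exact: ex_derive.
Qed.

Lemma continuous_mul f g : continuous f -> continuous g -> continuous (fun z => f z * g z).
Proof. by move=> cf cg z; apply: cvgM; [exact: cf|exact: cg]. Qed.

Lemma continuous_pow f d : continuous f -> continuous (fun z => f z ^+ d).
Proof.
move=> cf; elim: d => [|d IHd]; first by move=> z; exact: cvg_cst.
have -> : (fun z => f z ^+ d.+1) = (fun z => f z * f z ^+ d).
  by apply/funext => z; rewrite exprS.
exact: continuous_mul.
Qed.

Lemma continuous_Psi : continuous (@Psi R).
Proof. exact: continuous_is_derive (@is_derive_Psi R). Qed.

Lemma continuous_psi : continuous (@psi R).
Proof.
apply: (@continuous_mul (fun z => phi (z / Num.sqrt 2)) (cst _)); last by move=> z; exact: cvg_cst.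
move=> z; apply: (@continuous_comp _ _ _ (fun z : R => z / Num.sqrt 2) (@phi R)).
  by apply: cvgM; [exact: cvg_id|exact: cvg_cst].
exact: continuous_phi.
Qed.

Lemma taylor1_psi :
  taylor1 (fun=> 1) (@psi R) (fun z => (Num.sqrt 2)^-1 ^+ 2 * (- (z / Num.sqrt 2) * phi (z / Num.sqrt 2))).
Proof.
set a : R := (Num.sqrt 2)^-1.
have a0 : 0 <= a by rewrite invr_ge0 sqrtr_ge0.
have a1 : a <= 1.
  rewrite invf_le1 ?sqrtr_gt0 //.
  by rewrite -[leLHS]sqrtr1 ler_sqrt //; lra.
have [C C0 hphi] := taylor1_phi R.
have Cr z : C * rho z <= C by have := ler_wpM2l C0 (rho_le1 z); rewrite mulr1.
exists C => // z; have [h1 h2 h3] := hphi (z * a); split.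
- rewrite /psi normrM -/a (ger0_norm a0) ler_pM //.
  exact: le_trans h1 (Cr _).
- rewrite mulr1 normrM ger0_norm ?sqr_ge0 // -[leRHS]mul1r ler_pM ?sqr_ge0 //.
    by rewrite exprn_ile1.
  exact: le_trans h2 (Cr _).
move=> t t1; have := h3 (t * a); rewrite normrM (ger0_norm a0) => /(_ (mulr_ile1 _ a0 t1 a1)).
rewrite normr_ge0 => /(_ isT) h; rewrite /psi -/a.
have -> : phi ((z + t) * a) * a - phi (z * a) * a - t * (a ^+ 2 * (- (z * a) * phi (z * a))) =
  (phi (z * a + t * a) - phi (z * a) - t * a * (- (z * a) * phi (z * a))) * a.
  by rewrite mulrDl; ring.
rewrite normrM (ger0_norm a0) -[leRHS]mulr1 mulr1 ler_pM //.
apply: le_trans h _.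
rewrite [leLHS](_ : _ = C * rho (z * a) * t ^+ 2 * a ^+ 2); last by ring.
have Ct : 0 <= C * rho (z * a) * t ^+ 2.
  apply: mulr_ge0 (sqr_ge0 t); apply: mulr_ge0 => //.
  by rewrite ltW ?rho_gt0.
apply: le_trans (ler_piMr Ct (exprn_ile1 2 a0 a1)) _.
by rewrite ler_wpM2r ?sqr_ge0.
Qed.

Lemma dominated_phi_mul g C : continuous g -> (forall z, `|g z| <= C) ->
  dominated C (fun z => phi z * g z).
Proof.
move=> cg gC; split; first exact: continuous_mul (@continuous_phi R) cg.
move=> z; rewrite normrM gtr0_norm ?phi_gt0 // mulrC ler_wpM2r //.
by rewrite ltW ?phi_gt0.
Qed.

(** The midpoint rule is used twice, for [phi] to replace the atoms and for phi g to recover its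
    integral; the midpoint values of phi g cancel. The cells cover a bounded interval, and the two
    tails are O(1/k). *)
Lemma discrete_to_integral g g1 : continuous g -> taylor1 (fun=> 1) g g1 ->
  exists2 K : R, 0 <= K & forall k, (0 < k)%N ->
  `|\sum_(i < k.+1) binp R k i * g (center R k k i)
     - (\int[mu]_z (phi z * g z))%R| <= K / k%:R.
Proof.
move=> cg tg; have [C C0 hg] := tg.
have gC z : `|g z| <= C by have [h _ _] := hg z; rewrite mulr1 in h.
pose G z := phi z * g z.
have domG : dominated C G := dominated_phi_mul cg gC.
have rho0 (z : R) : 0 <= rho z by rewrite ltW // rho_gt0.
have tG := taylor1_mul rho0 (taylor1_phi R) tg.
have [K1 h1] := midpoint_sum (taylor1_phi R) (@is_derive_Gam R).
have [K2 h2] := midpoint_sum tG (fun x => is_derive_prim x domG.1 (integrable_dominated domG)).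
have [K3 K30 h3] := binp_cells R.
have [K4 K40 h4] := node_tails R.
have K10 : 0 <= K1.
  by have := h1 0%N 1%N isT; rewrite divr1; apply: le_trans; exact: sumr_ge0.
have K20 : 0 <= K2.
  by have := h2 0%N 1%N isT; rewrite divr1; apply: le_trans; exact: sumr_ge0.
exists (C * K3 + C * K1 + K2 + C * K4 + C * K4) => [|k k0].
  by rewrite !addr_ge0 ?mulr_ge0.
set I := (\int[mu]_z _)%R.
set S : R := Num.sqrt k%:R.
pose x := node R k k; pose z := center R k k.
have kk : (k <= k + 2)%N by rewrite leq_addr.
have [t0 t1] := h4 k k k0 kk.
have gsum (u : nat -> R) K : \sum_(i < k.+1) `|u i| <= K / k%:R ->
    `|\sum_(i < k.+1) u i * g (z i)| <= C * K / k%:R.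
  move=> uK; apply: le_trans (ler_norm_sum _ _ _) _.
  apply: le_trans (_ : \sum_(i < k.+1) C * `|u i| <= _).
    by apply: ler_sum => i _; rewrite normrM mulrC ler_wpM2r.
  by rewrite -mulr_sumr -mulrA ler_wpM2l.
have e1 := gsum (fun i => binp R k i - (Gam (x i.+1) - Gam (x i))) K3 (h3 k k k0 kk kk).
have e2 := gsum (fun i => Gam (x i.+1) - Gam (x i) - 2 / S * phi (z i)) K1 (h1 k k k0).
have e3 : `|\sum_(i < k.+1) (prim G (x i.+1) - prim G (x i) - 2 / S * G (z i))| <= K2 / k%:R.
  by apply: le_trans (ler_norm_sum _ _ _) (h2 k k k0).
have e4 : `|prim G (x 0%N)| <= C * K4 / k%:R.
  by apply: le_trans (prim_le _ domG) _; rewrite -mulrA ler_wpM2l.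
have e5 : `|I - prim G (x k.+1)| <= C * K4 / k%:R.
  by apply: le_trans (prim_compl_le _ domG) _; rewrite -mulrA ler_wpM2l.
rewrite (_ : _ - I =
    \sum_(i < k.+1) (binp R k i - (Gam (x i.+1) - Gam (x i))) * g (z i)
    + \sum_(i < k.+1) (Gam (x i.+1) - Gam (x i) - 2 / S * phi (z i)) * g (z i)
    - \sum_(i < k.+1) (prim G (x i.+1) - prim G (x i) - 2 / S * G (z i))
    - prim G (x 0%N) - (I - prim G (x k.+1))); last first.
  have -> : \sum_(i < k.+1) (binp R k i - (Gam (x i.+1) - Gam (x i))) * g (z i)
    + \sum_(i < k.+1) (Gam (x i.+1) - Gam (x i) - 2 / S * phi (z i)) * g (z i)
    - \sum_(i < k.+1) (prim G (x i.+1) - prim G (x i) - 2 / S * G (z i))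
    = \sum_(i < k.+1) binp R k i * g (z i)
      - \sum_(i < k.+1) (prim G (x i.+1) - prim G (x i)).
    by rewrite -big_split -!sumrB /=; apply: eq_bigr => i _; rewrite /G; ring.
  by rewrite (sum_node (prim G)) -/(x _); ring.
rewrite [leRHS](_ : _ = C * K3 / k%:R + C * K1 / k%:R + K2 / k%:R
  + C * K4 / k%:R + C * K4 / k%:R); last by ring.
do 3 (apply: le_trans (ler_normB _ _) _; apply: lerD => //).
by apply: le_trans (ler_normD _ _) _; apply: lerD.
Qed.

End DiscreteToIntegral.

(** * Expansion of the conditional probability in the parity shift *)

Section MixtureAsymptotics.
Variables (R : realType) (d : nat).
Local Notation mu := (@lebesgue_measure R).
Implicit Types (z : R).

Definition dPsiX z : R := d%:R * (Psi z ^+ d.-1 * psi z).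

Lemma continuous_dPsiX : continuous dPsiX.
Proof.
apply: (@continuous_mul R (cst d%:R)); first by move=> z; exact: cvg_cst.
apply: continuous_mul; last exact: continuous_psi.
exact: continuous_pow (@continuous_Psi R).
Qed.

Lemma taylor1_dPsiX : exists g1, taylor1 (fun=> 1) dPsiX g1.
Proof.
have t1 := taylor1_mul (fun=> ler01) (taylor1_exp d.-1 (taylor1_Psi R)) (taylor1_psi R).
have tc : taylor1 (fun=> 1) (fun=> d%:R : R) (fun=> 0).
  exists d%:R => // z; split=> [||t _]; rewrite ?mulr1 ?normr0 ?normr_nat //.
  by rewrite subrr mulr0 subr0 normr0 mulr_ge0 ?sqr_ge0.
have := taylor1_mul (fun=> ler01) tc t1.
by eexists; eassumption.
Qed.

Definition mixture0 : R := (\int[mu]_z (phi z * Psi z ^+ d))%R.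
Definition mixture1 : R := (\int[mu]_z (phi z * dPsiX z))%R.

Lemma exprn_lip (a b : R) : 0 <= a <= 1 -> 0 <= b <= 1 ->
  `|a ^+ d - b ^+ d| <= d%:R * `|a - b|.
Proof.
move=> /andP[a0 a1] /andP[b0 b1]; rewrite subrXX normrM mulrC ler_wpM2r //.
apply: le_trans (ler_norm_sum _ _ _) _.
apply: le_trans (_ : \sum_(i < d) 1 <= _); last by rewrite sumr_const card_ord.
apply: ler_sum => i _; rewrite ger0_norm ?mulr_ge0 ?exprn_ge0 //.
by rewrite mulr_ile1 ?exprn_ge0 ?exprn_ile1.
Qed.

Lemma binp_cdf_ge0_le1 n L : 0 <= binp_cdf R n L <= 1.
Proof.
rewrite /binp_cdf sumr_ge0 => [|i _]; last exact: binp_ge0.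
rewrite -(sum_binp R n); set m := maxn L n.+1.
rewrite (big_ord_widen m (fun l => binp R n l)) ?leq_maxl //.
rewrite [leRHS](big_ord_widen m (fun l => binp R n l)) ?leq_maxr //.
rewrite big_mkcond [leRHS]big_mkcond /=; apply: ler_sum => i _.
have := binp_ge0 R n i; case: (ltnP i n.+1) => [_|/binp_small ->]; by case: ifP.
Qed.

(** Because 2 uphalf(k+r) + [k+r even] = k + r + 1, the remainder r cancels and only the parity of k
    + r survives, which is that of 3k + r. *)
Lemma node_shift k r i : (0 < k)%N ->
  node R (2 * k + r) (2 * k) (i + uphalf (k + r)) =
  (center R k k i - (~~ odd (k + r))%:R / Num.sqrt k%:R) / Num.sqrt 2.
Proof.
move=> k0; rewrite /node /center natrM sqrtrM // -mulrBl -mulrA -invfM [X in _ / X]mulrC.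
congr (_ / _).
have : ((2 * uphalf (k + r)) + ~~ odd (k + r) = k + r + 1)%N.
  by rewrite -{2 3}(odd_double_half (k + r)) uphalf_half; case: odd; clear; lia.
move: (uphalf _) (nat_of_bool _) => u o E.
have -> : o%:R = (k + r + 1)%:R - (2 * u)%:R :> R by rewrite -E; ring.
ring.
Qed.

Lemma mixture_asymptotics : exists2 K : R, 0 <= K & forall k r, (0 < k)%N -> (r < 3)%N ->
  `|\sum_(i < k.+1) binp R k i * binp_cdf R (2 * k + r) (i + uphalf (k + r)) ^+ d
    - (mixture0 - (~~ odd (k + r))%:R / Num.sqrt k%:R * mixture1)| <= K / k%:R.
Proof.
have tP := taylor1_exp d (taylor1_Psi R).
have [K0 K00 h0] := discrete_to_integral (continuous_pow (d := d) (@continuous_Psi R)) tP.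
have [g1 tg1] := taylor1_dPsiX.
have [K1 K10 h1] := discrete_to_integral continuous_dPsiX tg1.
have [K2 K20 h2] := binp_cdf_Gam R.
have [C C0 hC] := tP.
exists (d%:R * K2 + C + K0 + K1) => [|k r k0 r3]; first by rewrite !addr_ge0 ?mulr_ge0.
have k0' : 0 < k%:R :> R by rewrite ltr0n.
set S : R := Num.sqrt k%:R.
have S1 : 1 <= S by rewrite -[leLHS]sqrtr1 ler_sqrt // ler1n.
have S0 : 0 < S by apply: lt_le_trans S1.
have S2 : S ^+ 2 = k%:R by rewrite sqr_sqrtr // ltW.
set tau : R := (~~ odd (k + r))%:R.
have tau01 : 0 <= tau <= 1 by rewrite /tau; case: odd; rewrite /= ?lexx ?ler01.
have [tau0 tau1] := andP tau01.
(* As tau <= 1, the square of [del] is at most 1/k, so a first-order expansion in [del] already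
   reaches the required error. *)
pose del := tau / S.
have del0 : 0 <= del by rewrite divr_ge0 // ltW.
have del1 : del <= 1 by rewrite ler_pdivrMr // mul1r (le_trans tau1).
have del2 : del ^+ 2 <= k%:R^-1.
  by rewrite /del expr_div_n S2 ler_piMl ?invr_ge0 ?(ltW k0') // exprn_ile1.
pose z := center R k k.
have e1 (i : 'I_k.+1) : `|binp_cdf R (2 * k + r) (i + uphalf (k + r)) ^+ d
    - Psi (z i - del) ^+ d| <= d%:R * K2 / k%:R.
  apply: le_trans (exprn_lip (binp_cdf_ge0_le1 _ _) (Psi_ge0_le1 _)) _.
  rewrite -mulrA ler_wpM2l // /Psi -node_shift //.
  have [a1 a2 a3 a4] : [/\ (0 < 2 * k)%N, (2 * k + r <= 2 * k + 2)%N,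
      (2 * k <= 2 * k + r + 2)%N & (i + uphalf (k + r) <= (2 * k + r).+1)%N].
    by have := ltn_ord i; move: k0 r3; clear; move=> ? ? ?; split; lia.
  apply: le_trans (h2 _ _ _ a1 a2 a3 a4) _.
  by rewrite ler_wpM2l // lef_pV2 ?posrE ?ltr0n // ler_nat leq_pmull.
have e2 (i : 'I_k.+1) : `|Psi (z i - del) ^+ d - Psi (z i) ^+ d + del * dPsiX (z i)| <= C / k%:R.
  have [_ _ h] := hC (z i); have := h (- del); rewrite normrN ger0_norm // => /(_ del1).
  rewrite mulr1 sqrrN mulNr opprK => {}h; apply: le_trans h _.
  by rewrite ler_wpM2l.
have wsum (u : nat -> R) K : (forall i : 'I_k.+1, `|u i| <= K) ->
    `|\sum_(i < k.+1) binp R k i * u i| <= K.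
  move=> uK; apply: le_trans (ler_norm_sum _ _ _) _.
  apply: le_trans (_ : \sum_(i < k.+1) binp R k i * K <= _).
    by apply: ler_sum => i _; rewrite normrM ger0_norm ?binp_ge0 // ler_wpM2l ?binp_ge0.
  by rewrite -mulr_suml sum_binp mul1r.
have {}e1 := wsum (fun i => binp_cdf R (2 * k + r) (i + uphalf (k + r)) ^+ d
    - Psi (z i - del) ^+ d) _ e1.
have {}e2 := wsum (fun i => Psi (z i - del) ^+ d - Psi (z i) ^+ d + del * dPsiX (z i)) _ e2.
have e3 := h0 k k0; have e4 := h1 k k0.
rewrite -/mixture0 -/z in e3; rewrite -/mixture1 -/z in e4.
rewrite -/del (_ : _ - (_ - _) =
  \sum_(i < k.+1) binp R k i * (binp_cdf R (2 * k + r) (i + uphalf (k + r)) ^+ d - Psi (z i - del) ^+ d)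
  + \sum_(i < k.+1) binp R k i * (Psi (z i - del) ^+ d - Psi (z i) ^+ d + del * dPsiX (z i))
  + (\sum_(i < k.+1) binp R k i * Psi (z i) ^+ d - mixture0)
  - del * (\sum_(i < k.+1) binp R k i * dPsiX (z i) - mixture1)); last first.
  rewrite -big_split /= mulrBr mulr_sumr.
  have -> : \sum_(i < k.+1) (binp R k i * (binp_cdf R (2 * k + r) (i + uphalf (k + r)) ^+ d - Psi (z i - del) ^+ d)
    + binp R k i * (Psi (z i - del) ^+ d - Psi (z i) ^+ d + del * dPsiX (z i)))
    = \sum_(i < k.+1) binp R k i * binp_cdf R (2 * k + r) (i + uphalf (k + r)) ^+ d
      - \sum_(i < k.+1) binp R k i * Psi (z i) ^+ d
      + \sum_(i < k.+1) del * (binp R k i * dPsiX (z i)).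
    by rewrite -sumrB -big_split; apply: eq_bigr => i _ /=; ring.
  by ring.
rewrite !mulrDl; apply: le_trans (ler_normB _ _) _; apply: lerD; last first.
  rewrite normrM (ger0_norm del0) -[leRHS]mul1r ler_pM //.
apply: le_trans (ler_normD _ _) _; apply: lerD => //.
by apply: le_trans (ler_normD _ _) _; apply: lerD.
Qed.

End MixtureAsymptotics.

(** * Determinant, inverse and quadratic form of H *)

Section CovarianceMatrix.
Variable R : realType.

(** One block matrix is factored in two ways, with the triangular factor on the left or on the
    right; taking determinants gives both sides. *)
Lemma det_1Dmul n (u : 'cV[R]_n) (v : 'rV[R]_n) :
  \det (1%:M + u *m v) = 1 + (v *m u) ord0 ord0.
Proof.
have E1 : block_mx 1%:M (- v) u 1%:M =
    block_mx (1%:M : 'M[R]_1) 0 u 1%:M *m block_mx 1%:M (- v) 0 (1%:M + u *m v).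
  rewrite mulmx_block !mul1mx !mulmx1 !mul0mx ?mulmx0 !addr0.
  by rewrite mulmxN addrCA addNr addr0.
have E2 : block_mx 1%:M (- v) u 1%:M =
    block_mx (1%:M + v *m u) (- v) 0 1%:M *m block_mx (1%:M : 'M[R]_1) 0 u 1%:M.
  rewrite mulmx_block !mul1mx !mulmx1 !mul0mx !mulmx0 !add0r.
  by rewrite mulNmx addrK.
have := E1; rewrite E2 => /(congr1 determinant).
rewrite !det_mulmx !det_ublock !det_lblock !det1 !mul1r !mulr1.
by rewrite det_mx11 !mxE eqxx => <-.
Qed.

Lemma mulmx_const n (a b : R) : (const_mx a : 'M[R]_n) *m (const_mx b : 'M[R]_n) = const_mx (n%:R * (a * b)).
Proof.
apply/matrixP => i j; rewrite !mxE; under eq_bigr do rewrite !mxE.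
by rewrite sumr_const card_ord mulr_natl.
Qed.

Variable d : nat.

Let d2_neq0 : d.+2%:R != 0 :> R.
Proof. by rewrite pnatr_eq0. Qed.

Lemma det_Hmat : \det (Hmat R d.+1) = d.+2%:R / 2 / 6 ^+ d.
Proof.
rewrite /Hmat detZ /=.
have -> : 2^-1 *: const_mx 1 = (const_mx 2^-1 : 'cV[R]_d) *m (const_mx 1 : 'rV[R]_d).
  by apply/matrixP => i j; rewrite !mxE big_ord1 !mxE.
rewrite det_1Dmul mxE; under eq_bigr do rewrite !mxE mul1r.
rewrite sumr_const card_ord -mulr_natl exprVn mulrC; congr (_ / _).
by rewrite -[d.+2%:R]natr1 -[d.+1%:R]natr1; field.
Qed.

Lemma invmx_Hmat :
  invmx (Hmat R d.+1) = 6 *: (1%:M - d.+2%:R^-1 *: const_mx 1).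
Proof.
suff E : Hmat R d.+1 *m (6 *: (1%:M - d.+2%:R^-1 *: const_mx 1)) = 1%:M.
  by rewrite -[RHS](mulKmx (mulmx1_unit E).1) E mulmx1.
rewrite /Hmat -scalemxAl -scalemxAr scalerA mulVf ?pnatr_eq0 // scale1r.
rewrite mulmxBr mulmx1 mulmxDl mul1mx -scalemxAl -!scalemxAr mulmx_const.
apply/matrixP => i j; rewrite !mxE mulr1 mulr1.
by rewrite -[d.+2%:R]natr1 -[d.+1%:R]natr1; field; rewrite !natr1.
Qed.

Lemma quadHinvE (u : nat -> R) :
  quadHinv d.+1 u = 6 * (\sum_(i < d) u i ^+ 2 - (\sum_(i < d) u i) ^+ 2 / d.+2%:R).
Proof.
rewrite /quadHinv invmx_Hmat -scalemxAr -scalemxAl mxE; congr (_ * _).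
rewrite mulmxBr mulmx1 mulmxBl -scalemxAr -scalemxAl !mxE; congr (_ - _).
  by apply: eq_bigr => i _; rewrite !mxE expr2.
rewrite mulrC; congr (_ / _).
under eq_bigr => i _.
  rewrite !mxE; under eq_bigr do rewrite !mxE mulr1.
  over.
by rewrite -mulr_sumr expr2.
Qed.

(** Completing the square in z yields sqrt(4 pi/(d+2)), and each half-line integral of the kernel
    contributes sqrt(pi/3). The orthant constant turns these factors into the normalization of
    [phi]. *)
Lemma gauss_const_normalization :
  gauss_const R d.+1 * ((Num.sqrt (4 * pi / d.+2%:R))^-1 * Num.sqrt (pi / 3) ^+ d)
    = (Num.sqrt (2 * pi))^-1.
Proof.
rewrite /gauss_const det_Hmat /=.
have pi0 := @pi_gt0 R; have d0 : 0 < d.+2%:R :> R by rewrite ltr0n.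
have sX n (x : R) : 0 <= x -> Num.sqrt x ^+ n = Num.sqrt (x ^+ n).
  move=> x0; elim: n => [|n IHn]; first by rewrite !expr0 sqrtr1.
  by rewrite exprS IHn -sqrtrM // -exprS.
have pi30 : 0 <= pi / 3 :> R by rewrite divr_ge0 // ltW.
have X0 : 0 <= (2 * pi) ^+ d * (d.+2%:R / 2 / 6 ^+ d) :> R.
  apply: mulr_ge0; first by rewrite exprn_ge0 // mulr_ge0 // ltW.
  by rewrite !divr_ge0 // exprn_ge0.
have Y0 : 0 <= 4 * pi / d.+2%:R :> R by rewrite divr_ge0 // mulr_ge0 // ltW.
have Z0 : 0 <= 2 * pi :> R by rewrite mulr_ge0 // ltW.
rewrite sX // div1r -!sqrtrV // -!sqrtrM ?invr_ge0 //.
congr Num.sqrt; rewrite (_ : 6 = 2 * 3 :> R); last by ring.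
rewrite !exprMn exprVn; clear X0 Y0 Z0 pi30 sX d2_neq0.
move: (@pi R) pi0 (d.+2%:R : R) d0 => p p0 q q0; field.
by rewrite !expf_neq0 ?gt_eqF.
Qed.

End CovarianceMatrix.

(** * Tonelli for iterated orthant integrals of mixtures *)

Section IteratedIntegral.
Variable R : realType.
Local Notation T := (measurableTypeR R).
Local Notation mu := (@lebesgue_measure R).
Local Notation pos := [set x : R | 0 < x]%classic.

Lemma measurable_pos : measurable (pos : set T).
Proof. by rewrite -set_itvoy. Qed.

Lemma tonelli_pos (F : T -> T -> R) :
  measurable_fun setT (fun p : T * T => F p.1 p.2) ->
  (forall x z, 0 <= F x z) ->
  (\int[mu]_(x in pos) \int[mu]_z (F x z)%:E = \int[mu]_z \int[mu]_(x in pos) (F x z)%:E)%E.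
Proof.
move=> mF F0; pose G (p : T * T) : \bar R := (F p.1 p.2 * \1_pos p.1)%:E.
have mG : measurable_fun setT G.
  apply/measurable_EFinP; apply: measurable_funM => //.
  apply: (measurableT_comp (f := \1_pos : T -> R)); last exact: measurable_fst.
  exact: measurable_indic measurable_pos.
have G0 p : (0 <= G p)%E by rewrite lee_fin mulr_ge0 // indicE.
have := @fubini_tonelli _ _ T T R mu mu G mG G0 => fub.
transitivity (\int[mu]_x \int[mu]_z G (x, z))%E.
  rewrite integral_mkcond; apply: eq_integral => x _; rewrite patchE; case: ifPn => xD.
    by apply: eq_integral => z _; rewrite /G /= indicE xD mulr1.
  by rewrite integral0_eq // => z _; rewrite /G /= indicE (negPf xD) mulr0.
rewrite fub; apply: eq_integral => z _; rewrite [RHS]integral_mkcond.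
apply: eq_integral => x _; rewrite patchE /G /= indicE.
by case: ifPn => xD; rewrite ?mulr1 // ?(negPf xD) mulr0.
Qed.

Variables (J : finType) (h : J -> nat -> T -> T -> R) (c : J -> nat -> T -> R).
Hypothesis h_ge0 : forall j i z x, 0 <= h j i z x.
Hypothesis measurable_h : forall j i, measurable_fun setT (fun p : T * T => h j i p.1 p.2).
Hypothesis measurable_c : forall j i, measurable_fun setT (c j i).
Hypothesis integral_h : forall j i z, (\int[mu]_(x in pos) (h j i z x)%:E = (c j i z)%:E)%E.

Let c_ge0 j i z : 0 <= c j i z.
Proof. by rewrite -lee_fin -integral_h; apply: integral_ge0 => x _; rewrite lee_fin. Qed.

(** [w] is general because the factor of the outermost coordinate is absorbed into it before the
    induction hypothesis is applied. The sum over [J] allows for the linear factor of the second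
    integral, one summand per coordinate. *)
Lemma iint_pos_mixture k (w : J -> T -> R) :
  (forall j z, 0 <= w j z) -> (forall j, measurable_fun setT (w j)) ->
  iint_pos k (fun u => \int[mu]_z (\sum_j w j z * \prod_(i < k) h j i z (u i))%:E)%E
  = (\int[mu]_z (\sum_j w j z * \prod_(i < k) c j i z)%:E)%E.
Proof.
elim: k w => [|k IHk] w w0 mw /=.
  by apply: eq_integral => z _; congr (_%:E); apply: eq_bigr => j _; rewrite !big_ord0.
pose F x z := \sum_j w j z * h j k z x * \prod_(i < k) c j i z.
transitivity (\int[mu]_(x in pos) \int[mu]_z (F x z)%:E)%E.
  apply: eq_integral => x _.
  rewrite /F -(IHk (fun j z => w j z * h j k z x)); first last.
  - move=> j; apply: measurable_funM => //.
    rewrite (_ : (h j k)^~ x = (fun p : T * T => h j k p.1 p.2) \o (fun z => (z, x))) //.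
    apply: measurableT_comp (measurable_h j k) _.
    exact: measurable_fun_pair.
  - by move=> j z; rewrite mulr_ge0.
  congr iint_pos; apply/funext => u; apply: eq_integral => z _; congr (_%:E).
  apply: eq_bigr => j _; rewrite big_ord_recr /= eqxx mulrAC -mulrA; congr (_ * (_ * _)).
  by apply: eq_bigr => i _; rewrite ltn_eqF.
rewrite tonelli_pos; first last.
- by move=> x z; apply: sumr_ge0 => j _; rewrite !mulr_ge0 // prodr_ge0.
- apply: measurable_sum => j; apply: measurable_funM; [apply: measurable_funM|].
  + by apply: (measurableT_comp (f := w j)).
  + rewrite (_ : (fun t : T * T => _) = (fun p : T * T => h j k p.1 p.2) \o (fun p : T * T => (p.2, p.1))) //.
    apply: measurableT_comp (measurable_h j k) _.
    by apply: measurable_fun_pair; [exact: measurable_snd|exact: measurable_fst].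
  + apply: measurable_prod => i _; exact: (measurableT_comp (f := c j i)).
have measurable_hz j z : measurable_fun (pos : set T) (fun x : T => h j k z x).
  apply: measurable_funTS.
  rewrite (_ : h j k z = (fun p : T * T => h j k p.1 p.2) \o (fun x => (z, x))) //.
  apply: measurableT_comp (measurable_h j k) _.
  exact: measurable_fun_pair.
apply: eq_integral => z _; rewrite /F.
under eq_integral do rewrite -sumEFin.
rewrite ge0_integral_sum //; first last.
- by move=> j x _; rewrite lee_fin !mulr_ge0 // prodr_ge0.
- move=> j; apply/measurable_EFinP; apply: measurable_funM => //.
  by apply: measurable_funM => //; exact: measurable_hz.
- exact: measurable_pos.
rewrite -sumEFin; apply: eq_bigr => j _.
under eq_integral => x _.
  rewrite mulrAC EFinM; over.
rewrite ge0_integralZl_EFin //; first last.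
- by rewrite mulr_ge0 // prodr_ge0.
- by apply/measurable_EFinP; exact: measurable_hz.
- by move=> x _; rewrite lee_fin.
- exact: measurable_pos.
by rewrite integral_h -EFinM big_ord_recr /= mulrA.
Qed.

End IteratedIntegral.

(** * Integration by parts on the line and on the half-line *)

Section GaussianIdentities.
Variable R : realType.
Local Notation T := (measurableTypeR R).
Local Notation mu := (@lebesgue_measure R).
Local Notation pos := [set x : R | 0 < x]%classic.
Local Notation s2 := (Num.sqrt 2 : R).
Local Notation s3 := (Num.sqrt 3 : R).

Let s2_gt0 : 0 < s2. Proof. by rewrite sqrtr_gt0. Qed.
Let s3_gt0 : 0 < s3. Proof. by rewrite sqrtr_gt0. Qed.
Let s2E : s2 ^+ 2 = 2. Proof. by rewrite sqr_sqrtr. Qed.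
Let s3E : s3 ^+ 2 = 3. Proof. by rewrite sqr_sqrtr. Qed.

(** [prim f - F] is constant and both functions are O(1/x^2) at the ends, so the integral is at most
    C/x^2 for every x. The domination uses variance 2 because z phi(z) is not bounded by a multiple
    of phi. *)
Lemma integral_derivative0 (F f : R -> R) (K : R) : 0 <= K ->
  (forall x : R, is_derive x 1 F (f x)) -> continuous f ->
  (forall z, `|f z| <= K * normal_pdf 0 s2 z) -> (forall x, `|F x| <= K * phi x) ->
  mu.-integrable setT (EFin \o f) /\ (\int[mu]_z f z = 0)%R.
Proof.
move=> K0 dF cf fK FK; have s20 : s2 != 0 by rewrite gt_eqF.
have intn (A : set T) : measurable A -> mu.-integrable A (EFin \o (fun z => K * normal_pdf 0 s2 z)).
  move=> mA; apply: integrable_scale => //.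
  by apply: integrableS (@integrable_normal_pdf R 0 s2).
have intf : mu.-integrable setT (EFin \o f).
  apply: (@le_integrable _ _ _ mu setT _ _ (EFin \o (fun z => K * normal_pdf 0 s2 z))) => //.
  - by apply/measurable_EFinP; exact: continuous_measurable_fun.
  - by move=> z _ /=; rewrite lee_fin; apply: le_trans (fK z) (ler_norm _).
  - exact: intn.
split=> //; set I := (\int[mu]_z f z)%R.
have [K1 hK1] := normal_pdf_tail s20.
have tail (A : set T) x : measurable A -> (forall z, A z -> x ^+ 2 <= z ^+ 2) -> 0 < x ->
    `|\int[mu]_(z in A) f z|%R <= K * K1 / x ^+ 2.
  move=> mA Ax x0; have intA : mu.-integrable A (EFin \o f) by apply: integrableS intf.
  apply: (le_trans (le_normr_Rintegral mA intA)).
  apply: le_trans (_ : (\int[mu]_(z in A) (K * normal_pdf 0 s2 z))%R <= _).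
    by apply: le_Rintegral => //; [exact: integrable_norm|exact: intn].
  rewrite RintegralZl //; last first.
    by apply: integrableS (@integrable_normal_pdf R 0 s2).
  by rewrite -mulrA ler_wpM2l // ler_pdivlMr ?exprn_gt0 // mulrC hK1.
have cst x y : prim f x - F x = prim f y - F y.
  have d1 (z : R) : is_derive z 1 (prim f - F) 0.
    have dp := is_derive_prim z cf intf; have dFz := dF z.
    by apply: is_derive_eq; rewrite subrr.
  have [c _] := MVT_line y x d1.
  by rewrite mul0r => /eqP; rewrite subr_eq0 => /eqP.
have bound x : 0 < x -> `|I| <= 2 * (K * K1 + 13 * K) / x ^+ 2.
  move=> x0; have x20 : 0 < x ^+ 2 by rewrite exprn_gt0.
  have e1 : `|I - prim f x| <= K * K1 / x ^+ 2.
    rewrite (prim_compl x intf); apply: tail => // z.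
    by rewrite /= in_itv /= andbT => zx; rewrite lerXn2r ?nnegrE ?(ltW x0) //; lra.
  have e2 : `|prim f (- x)| <= K * K1 / x ^+ 2.
    apply: tail => // z; rewrite /= in_itv /= => zx.
    by rewrite -[z ^+ 2]sqrrN lerXn2r ?nnegrE ?(ltW x0) //; lra.
  have FKx y : y ^+ 2 = x ^+ 2 -> `|F y| <= 13 * K / x ^+ 2.
    move=> yx; apply: le_trans (FK y) _; rewrite [13 * K]mulrC -mulrA ler_wpM2l //.
    apply: le_trans (phi_rho y) _; rewrite ler_wpM2l // /rho yx lef_pV2 ?posrE ?lerDr //.
    by rewrite addr_gt0.
  have e3 := FKx x erefl; have e4 := FKx (- x) (sqrrN x).
  rewrite (_ : I = (I - prim f x) + (F x + (prim f (- x) - F (- x)))); last first.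
    by rewrite -(cst x); ring.
  rewrite [leRHS](_ : _ = K * K1 / x ^+ 2 + (13 * K / x ^+ 2
    + (K * K1 / x ^+ 2 + 13 * K / x ^+ 2))); last by ring.
  apply: le_trans (ler_normD _ _) _; apply: lerD => //.
  apply: le_trans (ler_normD _ _) _; apply: lerD => //.
  by apply: le_trans (ler_normB _ _) _; apply: lerD.
set C := 2 * (K * K1 + 13 * K) in bound.
have C0 : 0 <= C by have := bound 1 ltr01; rewrite expr1n divr1; apply: le_trans.
apply/eqP; rewrite -normr_le0 leNgt; apply/negP => I0.
(* For x^2 = (C + 1)/|I| the bound becomes (C + 1)|I| <= C|I|, a contradiction. *)
have xx : 0 < (C + 1) / `|I| by rewrite divr_gt0 // ltr_wpDl.
have := bound (Num.sqrt ((C + 1) / `|I|)); rewrite sqrtr_gt0 => /(_ xx).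
rewrite sqr_sqrtr ?(ltW xx) // invf_div mulrA ler_pdivlMr ?ltr_wpDl // mulrC.
rewrite ler_pM2r //; lra.
Qed.

Lemma normal_pdf_sqrt2 (z : R) : (1 + z ^+ 2) * phi z <= 5 * s2 * normal_pdf 0 s2 z.
Proof.
have pi0 := @pi_gt0 R.
rewrite normal_pdfE ?gt_eqF // /normal_fun /normal_peak s2E subr0 /phi.
have sp0 : 0 < Num.sqrt (2 * pi) :> R by rewrite sqrtr_gt0 mulr_gt0.
have -> : Num.sqrt (2 * pi *+ 2) = s2 * Num.sqrt (2 * pi) :> R.
  by rewrite -sqrtrM //; congr Num.sqrt; ring.
have -> : - z ^+ 2 / (2 *+ 2) = - (z ^+ 2 / 4) by rewrite -mulrnA mulNr.
rewrite [leRHS](_ : _ = 5 * expR (- (z ^+ 2 / 4)) / Num.sqrt (2 * pi)); last first.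
  by field; rewrite !gt_eqF.
rewrite mulrA ler_wpM2r ?invr_ge0 ?(ltW sp0) //.
have t0 : 0 <= z ^+ 2 / 4 by rewrite divr_ge0 ?sqr_ge0.
have h : z ^+ 2 / 4 * expR (- (z ^+ 2 / 4)) <= 1 := expR_poly_le 0 t0.
have e1 : expR (- (z ^+ 2 / 4)) <= 1 by rewrite -[leRHS]expR0 ler_expR oppr_le0.
have -> : - (z ^+ 2 / 2) = - (z ^+ 2 / 4) + - (z ^+ 2 / 4) by field.
rewrite expRD mulrA ler_wpM2r ?expR_ge0 //.
by rewrite mulrDl mul1r; lra.
Qed.

Lemma is_derive_phiPsiX d (z : R) :
  is_derive z 1 (fun z => phi z * Psi z ^+ d) (phi z * dPsiX d z - z * phi z * Psi z ^+ d).
Proof.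
have d1 := is_derive_phi z; have d2 := is_derive_Psi z.
have -> : (fun z : R => phi z * Psi z ^+ d) = @phi R * @Psi R ^+ d.
  by apply/funext => y; rewrite /= !fctE.
apply: is_derive_eq; rewrite /dPsiX /GRing.scale /= !fctE /=.
by rewrite -mulr_natl; ring.
Qed.

(* Stein's identity, integrating by parts against the Gaussian density. *)
Lemma integral_mean_phi d :
  mu.-integrable setT (EFin \o (fun z : R => z * phi z * Psi z ^+ d)) /\
  (\int[mu]_z (z * phi z * Psi z ^+ d) = mixture1 R d)%R.
Proof.
have [g1 [C C0 hC]] := taylor1_dPsiX R d.
have DC z : `|dPsiX d z| <= C by have [h _ _] := hC z; rewrite mulr1 in h.
pose f (z : R) := phi z * dPsiX d z - z * phi z * Psi z ^+ d.
have cm : continuous (fun z : R => z * phi z * Psi z ^+ d).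
  apply: continuous_mul; last exact: continuous_pow (@continuous_Psi R).
  by apply: continuous_mul; [move=> z; exact: cvg_id|exact: continuous_phi].
have cD : continuous (fun z : R => phi z * dPsiX d z).
  by apply: continuous_mul; [exact: continuous_phi|exact: continuous_dPsiX].
have cf : continuous f by move=> z; apply: cvgB; [exact: cD|exact: cm].
have P1 (z : R) : 0 <= Psi z ^+ d <= 1.
  by have /andP[h0 h1] := Psi_ge0_le1 z; rewrite exprn_ge0 // exprn_ile1.
have K0 : 0 <= (C + 1) * (5 * s2) by rewrite !mulr_ge0 ?addr_ge0 // ltW.
have [||intf If] := integral_derivative0 K0 (is_derive_phiPsiX d) cf.
- move=> z; have /andP[p0 p1] := P1 z.
  have ph0 := phi_gt0 z.
  apply: le_trans (_ : (C + 1) * ((1 + z ^+ 2) * phi z) <= _); last first.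
    rewrite -mulrA ler_wpM2l ?addr_ge0 //; exact: normal_pdf_sqrt2.
  rewrite (_ : _ - _ = phi z * (dPsiX d z - z * Psi z ^+ d)); last by ring.
  rewrite normrM gtr0_norm // [leLHS]mulrC mulrA ler_wpM2r ?(ltW ph0) //.
  apply: le_trans (ler_normB _ _) _; rewrite (normrM z) (ger0_norm p0).
  have z2 : `|z| <= 1 + z ^+ 2.
    rewrite -[z ^+ 2]real_normK ?num_real //.
    by have := sqr_ge0 (`|z| - 1); have := sqr_ge0 `|z|; rewrite sqrrB1; lra.
  have h1 : `|z| * Psi z ^+ d <= 1 + z ^+ 2 by apply: le_trans z2; rewrite ler_piMr.
  have := DC z; have := mulr_ge0 C0 (sqr_ge0 z); lra.
- move=> x; have /andP[p0 p1] := P1 x; have ph0 := phi_gt0 x.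
  rewrite ger0_norm ?mulr_ge0 ?(ltW ph0) // [leRHS]mulrC ler_wpM2l ?(ltW ph0) //.
  apply: le_trans p1 _; have := sqr_ge0 (s2 - 1); rewrite sqrrB1 s2E.
  have s21 : 1 <= s2 by rewrite -[leLHS]sqrtr1 ler_sqrt //; lra.
  have := mulr_ge0 C0 (ltW s2_gt0); lra.
have domD : dominated C (fun z => phi z * dPsiX d z).
  by apply: dominated_phi_mul; [exact: continuous_dPsiX|exact: DC].
have intD := integrable_dominated domD.
have mE : (fun z : R => z * phi z * Psi z ^+ d) = (fun z => phi z * dPsiX d z - f z).
  by apply/funext => z; rewrite /f; ring.
rewrite mE; split.
  have := integrableB measurableT intD intf.
  by congr (mu.-integrable _ _); apply/funext => z /=; rewrite EFinB.
by rewrite RintegralB // If subr0.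
Qed.

Lemma integral_pos_FTC (F f : R -> R) (K M : R) :
  (forall x : R, is_derive x 1 F (f x)) -> continuous f -> (forall x, 0 <= x -> 0 <= f x) ->
  (forall x, M <= x -> `|F x| <= K / x) ->
  (\int[mu]_(x in pos) (f x)%:E = (- F 0)%:E)%E.
Proof.
move=> dF cf f0 FK.
have K0 : 0 <= K.
  have m1 : M <= Num.max M 1 by rewrite le_max lexx.
  have m2 : 0 < Num.max M 1 by rewrite lt_max ltr01 orbT.
  by have := le_trans (normr_ge0 _) (FK _ m1); rewrite pmulr_lge0 // invr_gt0.
have F0 : (F x @[x --> +oo%R] --> (0 : R))%classic.
  apply/cvgrPdist_le => e e0; near=> x.
  rewrite sub0r normrN; apply: le_trans (FK x _) _; first by near: x; apply: nbhs_pinfty_ge; exact: num_real.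
  have x0 : 0 < x by near: x; apply: nbhs_pinfty_gt; exact: num_real.
  rewrite ler_pdivrMr // -ler_pdivrMl // mulrC; near: x; apply: nbhs_pinfty_ge; exact: num_real.
have := @ge0_continuous_FTC2y R f F 0 0 f0 _ F0 _ _ _.
rewrite -set_itvoy integral_itv_obnd_cbnd; last first.
  by apply/measurable_EFinP; apply: measurable_funTS; exact: continuous_measurable_fun.
move=> ->; rewrite ?sub0r -?EFinB ?sub0r //.
- exact: continuous_subspaceT.
- by apply: cvg_at_right_filter; exact: (continuous_is_derive dF).
- by move=> x _; rewrite derive1E; exact: derive_val.
Unshelve. all: by end_near. Qed.

End GaussianIdentities.

(** * The one-dimensional kernel of the mixture *)

Section GaussianKernel.
Variable R : realType.
Local Notation T := (measurableTypeR R).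
Local Notation mu := (@lebesgue_measure R).
Local Notation pos := [set x : R | 0 < x]%classic.
Local Notation s2 := (Num.sqrt 2 : R).
Local Notation s3 := (Num.sqrt 3 : R).

(** The exponent is -3 x^2 + sqrt(3) z x - z^2/4. With the weight exp(-z^2/2), d such factors have
    total coefficient -(d+2)/4 at z^2, and completing the square leaves -3 sum u_i^2 + 3 (sum
    u_i)^2/(d+2), which is minus half of [quadHinv]. *)
Definition kern (z x : R) : R := expR (- (s3 * x - z / 2) ^+ 2).

Let s2_gt0 : 0 < s2. Proof. by rewrite sqrtr_gt0. Qed.
Let s3_gt0 : 0 < s3. Proof. by rewrite sqrtr_gt0. Qed.
Let s2E : s2 ^+ 2 = 2. Proof. by rewrite sqr_sqrtr. Qed.
Let s3E : s3 ^+ 2 = 3. Proof. by rewrite sqr_sqrtr. Qed.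
Let s2_ge1 : 1 <= s2. Proof. by rewrite -[leLHS]sqrtr1 ler_sqrt //; lra. Qed.
Let s3_ge1 : 1 <= s3. Proof. by rewrite -[leLHS]sqrtr1 ler_sqrt //; lra. Qed.
Let s2s3_ge2 : 2 <= s2 * s3.
Proof.
have h : s2 <= s3 by rewrite ler_sqrt //; lra.
by apply: le_trans (_ : s2 * s2 <= _); [rewrite -expr2 s2E|rewrite ler_wpM2l // ltW].
Qed.
Let s2s2 : s2 * s2 = 2. Proof. by rewrite -expr2. Qed.
Let s3s3 : s3 * s3 = 3. Proof. by rewrite -expr2. Qed.

Let sqrt_pi3 : Num.sqrt (pi / 3) * s2 * s3 = Num.sqrt (2 * pi) :> R.
Proof.
have pi0 := @pi_gt0 R; have p3 : 0 <= pi / 3 :> R by rewrite divr_ge0 // ltW.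
rewrite -sqrtrM // -sqrtrM; last by rewrite mulr_ge0.
by congr (Num.sqrt _); field.
Qed.

Let sqrt2pi_gt0 : 0 < Num.sqrt (2 * pi) :> R.
Proof. by rewrite sqrtr_gt0 mulr_gt0 // pi_gt0. Qed.

Lemma kern_phi (z x : R) :
  kern z x = Num.sqrt (2 * pi) * phi (- (s2 * s3) * x + z / s2).
Proof.
rewrite /phi mulrC divfK ?gt_eqF // /kern; congr expR; congr (- _).
have e : z / s2 = z * s2 / 2.
  by apply: (mulIf (lt0r_neq0 s2_gt0)); rewrite divfK ?gt_eqF // mulrAC -[z * s2 * s2]mulrA s2s2; field.
rewrite e [RHS](_ : _ = (s2 ^+ 2 / 2) * (s3 * x - z / 2) ^+ 2); last by field.
by rewrite s2E divff ?mul1r.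
Qed.

Lemma is_derive_kern (z x : R) :
  is_derive x 1 (kern z) (- (2 * s3 * (s3 * x - z / 2)) * kern z x).
Proof.
have -> : kern z = (fun x => expR (- (s3 * x - z / 2) ^+ 2)) by [].
have d0 : is_derive x 1 (fun x : R => s3 * x - z / 2) s3 by exact: is_derive_affine.
have d1 : is_derive x 1 (fun x : R => - (s3 * x - z / 2) ^+ 2) (- (2 * s3 * (s3 * x - z / 2))).
  have -> : (fun x : R => - (s3 * x - z / 2) ^+ 2) = - (fun x : R => s3 * x - z / 2) ^+ 2.
    by apply/funext => y; rewrite !fctE.
  by apply: is_derive_eq; rewrite /GRing.scale /=; ring.
by have := is_derive_comp1 (is_derive_expR _) d1; rewrite [X in is_derive _ _ _ X]mulrC.
Qed.

Lemma is_derive_lincomb (a b x : R) (f g : R -> R) (df dg : R) :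
  is_derive x 1 f df -> is_derive x 1 g dg ->
  is_derive x 1 (fun y => a * f y + b * g y) (a * df + b * dg).
Proof.
move=> hf hg; have -> : (fun y => a * f y + b * g y) = a *: f + b *: g by [].
exact: is_deriveD.
Qed.

Lemma continuous_kern z : continuous (kern z).
Proof. exact: continuous_is_derive (is_derive_kern z). Qed.

Let prim_kern (z x : R) := - (Num.sqrt (pi / 3) * Gam (- (s2 * s3) * x + z / s2)).

Let is_derive_prim_kern (z x : R) : is_derive x 1 (prim_kern z) (kern z x).
Proof.
have d1 := @is_derive_comp_affine R (@Gam R) (- (s2 * s3)) (z / s2) x _ (is_derive_Gam _).
have -> : prim_kern z = (- Num.sqrt (pi / 3)) *: (fun y => Gam (- (s2 * s3) * y + z / s2)).
  by apply/funext => y; rewrite /prim_kern -mulNr.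
apply: is_derive_eq; rewrite /GRing.scale /= kern_phi -sqrt_pi3; ring.
Qed.

Let kern_le (z x : R) : `|z| + 1 <= x -> kern z x <= 4 / x.
Proof.
move=> zx; have z0 := normr_ge0 z; have x1 : 1 <= x by lra.
have zz := ler_norm z.
have w : x / 2 <= s3 * x - z / 2.
  have : x <= s3 * x by rewrite ler_peMl //; lra.
  lra.
have w0 : 0 < s3 * x - z / 2 by lra.
have h : (s3 * x - z / 2) ^+ 2 * kern z x <= 1 := expR_poly_le 0 (sqr_ge0 _).
have x0 : 0 < x by lra.
rewrite ler_pdivlMr //; apply: le_trans (_ : 4 * ((x / 2) ^+ 2 * kern z x) <= _).
  rewrite [leRHS](_ : _ = kern z x * x * x); last by field.
  by rewrite ler_peMr // mulr_ge0 ?expR_ge0 // ltW.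
rewrite -[leRHS]mulr1 ler_wpM2l //; apply: le_trans h; rewrite ler_wpM2r ?expR_ge0 //.
by rewrite lerXn2r ?nnegrE //; lra.
Qed.

Let prim_kern_le : exists K, forall z x, `|z| + 1 <= x -> `|prim_kern z x| <= K / x.
Proof.
have [K hK] := Gam_tails R; exists (Num.sqrt (pi / 3) * K) => z x zx.
have z0 := normr_ge0 z; have x1 : 1 <= x by lra.
have K0 : 0 <= K.
  by have [h _] := hK 1 ltr01; have := le_trans (Gam_ge0 _) h; rewrite expr1n divr1.
rewrite normrN ger0_norm ?mulr_ge0 ?Gam_ge0 // -mulrA ler_wpM2l //.
set y := s2 * s3 * x - z / s2.
have yx : x <= y.
  have h1 : 2 * x <= s2 * s3 * x by rewrite ler_wpM2r //; move: x1; lra.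
  have h2 : z / s2 <= `|z|.
    have i0 : 0 <= s2^-1 by rewrite invr_ge0 ltW.
    apply: le_trans (ler_norm _) _; rewrite normrM (ger0_norm i0).
    by rewrite ler_piMr // invf_le1.
  rewrite /y; lra.
have y0 : 0 < y by lra.
rewrite (_ : - (s2 * s3) * x + z / s2 = - y); last by rewrite /y; ring.
have [h _] := hK _ y0; apply: le_trans h _; rewrite ler_wpM2l // lef_pV2 ?posrE ?exprn_gt0 //; last by lra.
apply: (le_trans yx); rewrite expr2 ler_peMr ?(ltW y0) //; exact: le_trans yx.
Qed.

Lemma integral_kern (z : R) :
  (\int[mu]_(x in pos) (kern z x)%:E = (Num.sqrt (pi / 3) * Psi z)%:E)%E.
Proof.
have [K hK] := prim_kern_le.
rewrite (@integral_pos_FTC R (prim_kern z) (kern z) K (`|z| + 1) (is_derive_prim_kern z)).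
- by rewrite /prim_kern mulr0 add0r opprK.
- exact: continuous_kern.
- by move=> x _; exact: expR_ge0.
- exact: hK.
Qed.

Lemma integral_mul_kern (z : R) :
  (\int[mu]_(x in pos) (x * kern z x)%:E
    = (Num.sqrt (pi / 3) / s3 * (psi z + z / 2 * Psi z))%:E)%E.
Proof.
have [K hK] := prim_kern_le.
(* The x-derivative of [kern] is (sqrt(3) z - 6 x) times [kern]. Solving for x times [kern] gives
   the coefficients -1/6 and sqrt(3) z/6 = z/(2 sqrt(3)) of the primitive [F]. *)
pose a := z / (2 * s3).
pose F := (fun x => - (6^-1) * kern z x + a * prim_kern z x).
have dF (x : R) : is_derive x 1 F (x * kern z x).
  have d1 := is_derive_kern z x; have d2 := is_derive_prim_kern z x.
  have e : a = z * s3 / 6.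
    apply: (mulIf (lt0r_neq0 s3_gt0)); rewrite /a [RHS](_ : _ = z * (s3 * s3) / 6); last by ring.
    by rewrite s3s3; field; rewrite gt_eqF.
  have := is_derive_lincomb (- 6^-1) a d1 d2; congr is_derive; rewrite e.
  rewrite [LHS](_ : _ = s3 * s3 / 3 * x * kern z x); last by field.
  by rewrite s3s3 divff ?mul1r.
rewrite (@integral_pos_FTC R F (fun x => x * kern z x) (4 + `|a| * K) (`|z| + 1) dF).
- congr (_%:E); rewrite /F /prim_kern mulr0 add0r /psi kern_phi mulr0 add0r -sqrt_pi3 -/(Psi z).
  have -> : 6^-1 = (s3 * s2 * s3 * s2)^-1.
    by congr (_^-1); rewrite -mulrA mulrACA s3s3 s2s2; ring.
  rewrite /a; field; rewrite !gt_eqF //.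
- by apply: continuous_mul; [move=> x; exact: cvg_id|exact: continuous_kern].
- by move=> x x0; rewrite mulr_ge0 // expR_ge0.
- move=> x zx; have x0 : 0 < x by have := normr_ge0 z; lra.
  rewrite mulrDl; apply: le_trans (ler_normD _ _) _; apply: lerD.
    have k0 : 0 <= kern z x by exact: expR_ge0.
    by rewrite normrM normrN !ger0_norm //; have := kern_le zx; lra.
  by rewrite normrM -mulrA ler_wpM2l // hK.
Qed.

(* Completing the square in [z] decouples the coordinates of [u]. *)
Lemma integral_prod_kern d (u : nat -> R) :
  (\int[mu]_z (expR (- (z ^+ 2 / 2)) * \prod_(i < d) kern z (u i))%:E
    = (Num.sqrt (4 * pi / d.+2%:R) * expR (- quadHinv d.+1 u / 2))%:E)%E.
Proof.
set S := \sum_(i < d) u i; set Q := \sum_(i < d) u i ^+ 2.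
have d0 : 0 < d.+2%:R :> R by rewrite ltr0n.
(* As a function of z the exponent is -(d+2)/4 z^2 + sqrt(3) S z plus a constant: a normal density
   with this deviation [s] and mean [m0]. *)
pose s := Num.sqrt (2 / d.+2%:R) : R; pose m0 := 2 * s3 * S / d.+2%:R.
have s0 : 0 < s by rewrite sqrtr_gt0 divr_gt0.
have ss : s ^+ 2 = 2 / d.+2%:R by rewrite sqr_sqrtr // divr_ge0 // ltW.
have peak : normal_peak s = (Num.sqrt (4 * pi / d.+2%:R))^-1.
  by rewrite /normal_peak ss; congr (_^-1); congr Num.sqrt; rewrite -mulr_natl; field.
have P0 : 0 < Num.sqrt (4 * pi / d.+2%:R) :> R.
  by rewrite sqrtr_gt0 divr_gt0 // mulr_gt0 // pi_gt0.
have E z : expR (- (z ^+ 2 / 2)) * \prod_(i < d) kern z (u i)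
    = Num.sqrt (4 * pi / d.+2%:R) * expR (- quadHinv d.+1 u / 2) * normal_pdf m0 s z.
  rewrite normal_pdfE ?gt_eqF // peak /normal_fun mulrCA mulrA [_^-1 * _]mulrA mulVf ?gt_eqF // mul1r.
  rewrite /kern -expR_sum -!expRD; congr expR.
  rewrite quadHinvE -/S -/Q sumrN.
  rewrite [X in - (z ^+ 2 / 2) - X](_ : _ = 3 * Q - s3 * z * S + d%:R * (z ^+ 2 / 4)).
    rewrite ss -mulr_natl /m0 -[d.+2%:R]natr1 -[d.+1%:R]natr1.
    have dd : d%:R + 1 + 1 != 0 :> R by rewrite !natr1 pnatr_eq0.
    rewrite [RHS](_ : _ = - 3 * Q + (3 * S ^+ 2 - s3 * s3 * S ^+ 2) / (d%:R + 1 + 1)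
      + s3 * z * S - (d%:R + 1 + 1) / 4 * z ^+ 2); last by field.
    by rewrite s3s3; field.
  rewrite (eq_bigr (fun i : 'I_d => 3 * u i ^+ 2 - s3 * z * u i + z ^+ 2 / 4)); last first.
    by move=> i _; rewrite -[X in _ = X * _ - _ + _]s3s3; field.
  rewrite !big_split /= sumrN -!mulr_sumr sumr_const card_ord -/S -/Q.
  by rewrite -mulr_natl; ring.
under eq_integral do rewrite E EFinM.
rewrite ge0_integralZl_EFin //.
- by rewrite integral_normal_pdf mule1.
- by move=> z _; rewrite lee_fin normal_pdf_ge0.
- by apply/measurable_EFinP; exact: measurable_normal_pdf.
Qed.

Lemma measurable_kern : measurable_fun setT (fun p : T * T => kern p.1 p.2).
Proof.
apply: (measurableT_comp (f := (@expR R))); first exact: measurable_expR.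
apply: measurableT_comp => //; apply: measurable_funX; apply: measurable_funB.
  by apply: measurable_funM => //; exact: measurable_snd.
by apply: measurable_funM => //; exact: measurable_fst.
Qed.

End GaussianKernel.

(** * The orthant integrals as one-dimensional integrals *)

Section LimitConstants.
Variable R : realType.
Local Notation T := (measurableTypeR R).
Local Notation mu := (@lebesgue_measure R).
Local Notation pos := [set x : R | 0 < x]%classic.
Local Notation s3 := (Num.sqrt 3 : R).

Lemma eq_iint_pos k (f g : (nat -> R) -> \bar R) :
  (forall u, (forall i, (i < k)%N -> 0 < u i) -> f u = g u) -> iint_pos k f = iint_pos k g.
Proof.
elim: k f g => [|k IHk] f g fg /=; first by apply: fg.
apply: eq_integral => x; rewrite inE /= => x0; apply: IHk => u u0; apply: fg => i.
by case: eqP => // ik; rewrite ltnS leq_eqVlt => /orP[/eqP //|]; exact: u0.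
Qed.

Variable d : nat.
Let sg : R := Num.sqrt (4 * pi / d.+2%:R).
Let w (z : R) : R := sg^-1 * expR (- (z ^+ 2 / 2)).

Let sg_gt0 : 0 < sg.
Proof. by rewrite sqrtr_gt0 divr_gt0 ?ltr0n // mulr_gt0 // pi_gt0. Qed.

Let w_ge0 z : 0 <= w z.
Proof. by rewrite mulr_ge0 ?invr_ge0 ?expR_ge0 // ltW. Qed.

Let measurable_w : measurable_fun setT (w : T -> R).
Proof.
apply: measurable_funM => //; apply: (measurableT_comp (f := @expR R)); first exact: measurable_expR.
apply: measurableT_comp => //; apply: measurable_funM => //; exact: measurable_funX.
Qed.

Let measurable_kernl (y : R) : measurable_fun setT (fun z : T => kern z y).
Proof.
rewrite (_ : (fun z => kern z y) = (fun p : T * T => kern p.1 p.2) \o (fun z => (z, y))) //.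
apply: measurableT_comp (@measurable_kern R) _; exact: measurable_fun_pair.
Qed.

Let integral_w (C : R) (u : nat -> R) : 0 <= C ->
  (\int[mu]_z (C * (w z * \prod_(i < d) kern z (u i)))%:E
    = (C * expR (- quadHinv d.+1 u / 2))%:E)%E.
Proof.
move=> C0; under eq_integral => z _ do rewrite /w -mulrA mulrA EFinM.
rewrite ge0_integralZl_EFin //.
- by rewrite integral_prod_kern -EFinM mulrA divfK ?gt_eqF.
- by move=> z _; rewrite lee_fin mulr_ge0 ?expR_ge0 // prodr_ge0 // => i _; exact: expR_ge0.
- apply/measurable_EFinP; apply: measurable_funM.
    apply: (measurableT_comp (f := @expR R)); first exact: measurable_expR.
    apply: measurableT_comp => //; apply: measurable_funM => //; exact: measurable_funX.
  by apply: measurable_prod => i _; exact: measurable_kernl.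
- by rewrite mulr_ge0 // invr_ge0 ltW.
Qed.

Let w_phi z : w z = sg^-1 * Num.sqrt (2 * pi) * phi z.
Proof.
rewrite /w /phi -mulrA; congr (_ * _); rewrite [RHS]mulrC divfK // gt_eqF //.
by rewrite sqrtr_gt0 mulr_gt0 // pi_gt0.
Qed.

Let measurable_continuous (f : R -> R) : continuous f -> measurable_fun setT (f : T -> R).
Proof. exact: continuous_measurable_fun. Qed.

Let integrable_mixture0 : mu.-integrable setT (EFin \o (fun z : R => phi z * Psi z ^+ d)).
Proof.
apply: (@integrable_dominated R 1); apply: dominated_phi_mul.
  exact: continuous_pow (@continuous_Psi R).
by move=> z; have /andP[h0 h1] := Psi_ge0_le1 z; rewrite ger0_norm ?exprn_ge0 ?exprn_ile1.
Qed.

Lemma a0_mixture : a0 R d.+1 = mixture0 R d.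
Proof.
rewrite /a0 /=.
pose h (_ : unit) (_ : nat) (z x : T) : R := kern z x.
pose c (_ : unit) (_ : nat) (z : T) : R := Num.sqrt (pi / 3) * Psi z.
pose A := sg^-1 * Num.sqrt (pi / 3) ^+ d * Num.sqrt (2 * pi) : R.
rewrite (@eq_iint_pos _ _ (fun u => \int[mu]_z (\sum_(j : unit) w z * \prod_(i < d) h j i z (u i))%:E)%E); last first.
  move=> u u0; have := integral_w u ler01; rewrite mul1r => <-.
  by apply: eq_integral => z _; rewrite mul1r (big_pred1 tt) //; case.
rewrite (@iint_pos_mixture R _ h c) //; first last.
- by move=> j i z; exact: integral_kern.
- move=> j i; apply: measurable_continuous; apply: continuous_mul; last exact: continuous_Psi.
  by move=> z; exact: cvg_cst.
- by move=> j i; exact: measurable_kern.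
- by move=> j i z x; exact: expR_ge0.
rewrite (eq_integral (fun z : T => (A * (phi z * Psi z ^+ d))%:E)); last first.
  move=> z _; congr (_%:E); rewrite (big_pred1 tt); last by case.
  by rewrite prodr_const card_ord exprMn w_phi /A; ring.
rewrite -/(Rintegral mu setT (fun z => A * (phi z * Psi z ^+ d))) RintegralZl //.
rewrite /mixture0 mulrA -[RHS]mul1r; congr (_ * _).
rewrite /A !mulrA -[_ * _ * _ ^+ d]mulrA gauss_const_normalization mulVf // gt_eqF //.
by rewrite sqrtr_gt0 mulr_gt0 // pi_gt0.
Qed.

(** The d summands give the integral of phi times the derivative of Psi^d, plus d/2 times that of z
    phi Psi^d. By Stein's identity the total is (d+2)/2 times [mixture1], which cancels the d+2 in
    6/(m+1) and leaves 3/sqrt(3). *)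
Lemma a1_mixture n : a1 R d.+1 n = if odd n then 0 else - (s3 * mixture1 R d).
Proof.
rewrite /a1 /=; case: ifP => // _.
(* The absolute value makes the factor nonnegative on the whole line, as the mixture lemma requires;
   on the orthant it is x itself. *)
pose h (j : 'I_d) (i : nat) (z x : T) : R := (if i == j then `|x| else 1) * kern z x.
pose c (j : 'I_d) (i : nat) (z : T) : R :=
  if i == j then Num.sqrt (pi / 3) / s3 * (psi z + z / 2 * Psi z) else Num.sqrt (pi / 3) * Psi z.
pose A := sg^-1 * Num.sqrt (pi / 3) ^+ d * Num.sqrt (2 * pi) / s3 : R.
have s30 : 0 < s3 by rewrite sqrtr_gt0.
rewrite (@eq_iint_pos _ _ (fun u => \int[mu]_z (\sum_(j < d) w z * \prod_(i < d) h j i z (u i))%:E)%E); last first.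
  move=> u u0; rewrite -integral_w; last by apply: sumr_ge0 => i _; rewrite ltW // u0.
  apply: eq_integral => z _; congr (_%:E); rewrite mulr_suml; apply: eq_bigr => j _.
  rewrite mulrCA; congr (_ * _); rewrite /h big_split /=; congr (_ * _).
  rewrite (bigD1 j) //= eqxx gtr0_norm ?u0 // big1 ?mulr1 // => i ij.
  by rewrite (inj_eq val_inj) (negPf ij).
rewrite (@iint_pos_mixture R _ h c) //; first last.
- move=> j i z; rewrite /h /c; case: (i == j).
    rewrite -integral_mul_kern; apply: eq_integral => x; rewrite inE /= => x0.
    by rewrite gtr0_norm.
  rewrite -integral_kern; apply: eq_integral => x _; by rewrite mul1r.
- move=> j i; rewrite /c; case: (i == j); apply: measurable_continuous; apply: continuous_mul.
  + by move=> z; exact: cvg_cst.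
  + move=> z; apply: cvgD; first exact: continuous_psi.
    apply: (continuous_mul (f := fun z : R => z / 2)); last exact: continuous_Psi.
    by apply: continuous_mul; [move=> y; exact: cvg_id|move=> y; exact: cvg_cst].
  + by move=> z; exact: cvg_cst.
  + exact: continuous_Psi.
- move=> j i; rewrite /h; apply: measurable_funM; last exact: measurable_kern.
  case: (i == j) => //; apply: measurableT_comp => //; exact: measurable_snd.
- by move=> j i z x; rewrite /h mulr_ge0 ?expR_ge0 //; case: ifP.
have [intm Im] := integral_mean_phi R d.
have [g1 [C C0 hC]] := taylor1_dPsiX R d.
have intD : mu.-integrable setT (EFin \o (fun z : R => phi z * dPsiX d z)).
  apply: (@integrable_dominated R C); apply: dominated_phi_mul; first exact: continuous_dPsiX.
  by move=> z; have [] := hC z; rewrite mulr1.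
rewrite (eq_integral (fun z : T => (A * (phi z * dPsiX d z + d%:R / 2 * (z * phi z * Psi z ^+ d)))%:E)); last first.
  move=> z _; congr (_%:E).
  rewrite (eq_bigr (fun _ => A * (phi z * (Psi z ^+ d.-1 * psi z) + 2^-1 * (z * phi z * Psi z ^+ d)))).
    by rewrite sumr_const card_ord -mulr_natl /dPsiX; ring.
  move=> j _; rewrite (bigD1 j) //= (eq_bigr (fun _ => Num.sqrt (pi / 3) * Psi z)); last first.
    by move=> i ij; rewrite /c (inj_eq val_inj) (negPf ij).
  rewrite prodr_const (_ : #|_| = d.-1); last first.
    by have := cardC1 j; rewrite card_ord => <-; apply: eq_card.
  rewrite /c eqxx w_phi exprMn /A.
  case: (d) j => [[]//|k] j /=; rewrite !exprS; ring.
rewrite -/(Rintegral mu setT (fun z => A * (phi z * dPsiX d z + d%:R / 2 * (z * phi z * Psi z ^+ d)))).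
have intm' : mu.-integrable setT (EFin \o (fun z : R => d%:R / 2 * (z * phi z * Psi z ^+ d))).
  exact: integrable_scale.
rewrite RintegralZl //; last first.
  have := integrableD measurableT intD intm'.
  by congr (mu.-integrable _ _); apply/funext => z /=; rewrite EFinD.
rewrite RintegralD // RintegralZl // Im -/(mixture1 R d).
have s2pi : Num.sqrt (2 * pi) != 0 :> R by rewrite gt_eqF // sqrtr_gt0 mulr_gt0 // pi_gt0.
have gA : gauss_const R d.+1 * A = s3^-1.
  by rewrite /A !mulrA -[_ * _ * _ ^+ d]mulrA gauss_const_normalization mulVf // mul1r.
have s3V : s3^-1 = s3 / 3.
  by apply: (mulIf (lt0r_neq0 s30)); rewrite mulVf ?gt_eqF // mulrAC -expr2 sqr_sqrtr // divff.
rewrite mulrA -[_ * _ * A]mulrA gA s3V -[d.+2%:R]natr1 -[d.+1%:R]natr1.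
by field; rewrite !natr1.
Qed.

End LimitConstants.

(** * From k blocks back to n voters *)

Section VoterCount.
Variable R : realType.

(** The expansion runs in powers of k, about n/3. The resulting sqrt(3) is the one in [a1_mixture],
    and the remainder r moves 1/sqrt(k) by O(1/k) only. *)
Lemma sqrtn_third (k r : nat) : (0 < k)%N -> (r < 3)%N ->
  `|Num.sqrt 3 / Num.sqrt (3 * k + r)%:R - (Num.sqrt k%:R)^-1| <= 1 / k%:R :> R.
Proof.
move=> k0 r3; have kR : 1 <= k%:R :> R by rewrite (ler_nat R 1).
have kp : 0 < k%:R :> R by lra.
have rR : r%:R <= 3 :> R by rewrite (ler_nat R _ 3) ltnW.
have r0 : 0 <= r%:R :> R by [].
set q := k%:R in kR kp *; set n := (3 * k + r)%:R.
have nE : n = 3 * q + r%:R by rewrite /n natrD natrM.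
pose x := q + r%:R / 3.
have xq : q <= x by rewrite /x lerDl; lra.
have x1 : x <= q + 1 by rewrite /x lerD2l; lra.
have -> : Num.sqrt 3 / Num.sqrt n = (Num.sqrt x)^-1 :> R.
  rewrite (_ : n = 3 * x); last by rewrite nE /x; field.
  by rewrite sqrtrM // invfM mulrA divff ?mul1r // gt_eqF // sqrtr_gt0.
have sx : 0 < Num.sqrt x by rewrite sqrtr_gt0 (lt_le_trans kp).
have sq : 0 < Num.sqrt q by rewrite sqrtr_gt0.
have sqx : Num.sqrt q <= Num.sqrt x by rewrite ler_sqrt //; exact: le_trans (ltW kp) xq.
have qE : Num.sqrt q ^+ 2 = q by rewrite sqr_sqrtr // ltW.
have xE : Num.sqrt x ^+ 2 = x by rewrite sqr_sqrtr // (le_trans (ltW kp)).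
have sq1 : 1 <= Num.sqrt q by rewrite -[leLHS]sqrtr1 ler_sqrt.
have diff : Num.sqrt x - Num.sqrt q <= 1.
  have : (Num.sqrt x - Num.sqrt q) * 1 <= (Num.sqrt x - Num.sqrt q) * (Num.sqrt x + Num.sqrt q).
    by rewrite ler_wpM2l ?subr_ge0 //; move: sq1 sqx; lra.
  by rewrite mulr1 -subr_sqr xE qE => /le_trans; apply; move: x1; lra.
rewrite distrC ger0_norm ?subr_ge0 ?lef_pV2 ?posrE //.
rewrite (_ : _ - _ = (Num.sqrt x - Num.sqrt q) / (Num.sqrt x * Num.sqrt q)); last first.
  by field; rewrite !gt_eqF.
apply: ler_pM => //; rewrite ?subr_ge0 ?invr_ge0 ?mulr_ge0 ?(ltW sx) ?(ltW sq) //.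
by rewrite lef_pV2 ?posrE ?mulr_gt0 // -{1}qE expr2 ler_wpM2r // ltW.
Qed.

End VoterCount.

Theorem theorem10 (R : realType) (m : nat) (hm : (2 <= m)%N)
    (c : 'I_m) (hc : val c = m.-1) :
  exists C : R, exists N : nat, forall n : nat, (N <= n)%N ->
    `| prob_cw R n c - a0 R m - a1 R m n / Num.sqrt (n%:R) | <= C / n%:R.
Proof.
case: m hm c hc => // d _ c _.
have [K1 h1] := condorcet_replacement R c.
have [K2 K20 h2] := mixture_asymptotics R d.
pose M : R := `|mixture1 R d|.
(* n >= 3 gives k >= 1, whence n <= 3k + 2 <= 6k and 1/k <= 6/n. The three constants bound the
   replacement, the expansion for the mixture, and the passage from sqrt(k) to sqrt(n). *)
exists (6 * (`|K1| + K2 + M)), 3%N => n n3.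
pose k := (n %/ 3)%N; pose r := (n %% 3)%N.
have nE : n = (3 * k + r)%N by rewrite mulnC -divn_eq.
have r3 : (r < 3)%N by rewrite ltn_mod.
have k0 : (0 < k)%N by rewrite divn_gt0.
have odd_n : odd n = odd (k + r) by rewrite nE oddD oddM oddD.
have kp : 0 < k%:R :> R by rewrite ltr0n.
have M0 : 0 <= M := normr_ge0 _.
have kn : k%:R^-1 <= 6 / n%:R :> R.
  rewrite -[leRHS]invf_div lef_pV2 ?posrE ?divr_gt0 ?ltr0n //; last by case: (n) n3.
  rewrite ler_pdivrMr // -natrM ler_nat nE; lia.
rewrite a0_mixture a1_mixture.
set t : R := (~~ odd (k + r))%:R in h2.
have t1 : 0 <= t <= 1 by rewrite /t; case: (~~ _); rewrite /= ?lexx ler01.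
have -> : (if odd n then 0 else - (Num.sqrt 3 * mixture1 R d)) / Num.sqrt n%:R
    = - (t * (Num.sqrt 3 / Num.sqrt n%:R) * mixture1 R d).
  rewrite odd_n /t; case: odd => /=; first by rewrite !mul0r oppr0.
  by rewrite mul1r mulNr mulrAC.
rewrite opprK.
have e1 : `|prob_cw R n c - \sum_(i < k.+1) binp R k i * binp_cdf R (2 * k + r) (i + uphalf (k + r)) ^+ d| <= `|K1| / k%:R.
  rewrite nE; apply: le_trans (h1 k r r3) _.
  apply: le_trans (_ : `|K1| / k.+1%:R <= _); first by rewrite ler_wpM2r ?invr_ge0 // ler_norm.
  by rewrite ler_wpM2l // lef_pV2 ?posrE ?ltr0n // ler_nat.
have e2 := h2 k r k0 r3.
have e3 := sqrtn_third R k0 r3; rewrite -nE in e3.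
apply: le_trans (_ : (`|K1| + K2 + M) / k%:R <= _); last first.
  by rewrite [6 * _]mulrC -mulrA ler_wpM2l // !addr_ge0.
set S := \sum_(i < k.+1) _ in e1 e2.
rewrite (_ : _ - _ + _ = (prob_cw R n c - S) + ((S - (mixture0 R d - t / Num.sqrt k%:R * mixture1 R d))
  + t * (Num.sqrt 3 / Num.sqrt n%:R - (Num.sqrt k%:R)^-1) * mixture1 R d)); last by ring.
rewrite [leRHS](_ : _ = `|K1| / k%:R + (K2 / k%:R + M / k%:R)); last by ring.
apply: le_trans (ler_normD _ _) _; apply: lerD => //.
apply: le_trans (ler_normD _ _) _; apply: lerD => //.
have /andP[t0 t1'] := t1.
rewrite normrM [leRHS]mulrC ler_wpM2r // normrM (ger0_norm t0).
by rewrite -[leRHS]div1r; apply: le_trans e3; rewrite ler_piMl.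
Qed.
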